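(* Let $A$ be a finite dimensional weak $C^*$-Hopf algebra with dual $\hat A$ and normalized Haar integrals $h\in A$, $\hat h\in\hat A$; let $M$ be an $A$-module von Neumann algebra, $\omega$ a faithful normal $A$-invariant state on $M$, $\mathcal H_\omega=L^2(M,\omega)$ and $\pi_\omega$ the GNS representation of $M$ on $\mathcal H_\omega$. Put $g_L:=(\hat h\rightharpoonup h)^{1/2}\in A_L$. (i) Let $l_0:=hg_L^{-1}\in\mathcal L(A)$. Then $V:\mathcal H_\omega\to\mathcal H_{cros}$, $V|m\rangle_\omega:=|m\,l_0\rangle_{cros}$, defines an isometry satisfying for all $m\in M$ and $a\in A$ $$V^*|m\,a\rangle_{cros}=|m\,((ag_L)\triangleright1_M)\rangle_\omega,\qquad VV^*|m\,a\rangle_{cros}=|m\,ag_Ll_0\rangle_{cros},\qquad \pi_\omega(m)=V^*\pi_{cros}(m)V.$$ (ii) $V\mathcal H_\omega\subset\mathcal H_{cros}$ is invariant under $\pi_{cros}(M\rtimes A)$, and therefore $\pi_\omega$ extends to a representation (still denoted $\pi_\omega$) of $M\rtimes A$ on $\mathcal H_\omega$ by $\pi_\omega(ma):=V^*\pi_{cros}(ma)V$, yielding $$\pi_\omega(ma)|m'\rangle_\omega=|m(a\triangleright m')\rangle_\omega.$$ (iii) $MhM\subset M\rtimes A$ is an ideal orthogonal to $\ker\pi_\omega$, i.e. $(MhM)(\ker\pi_\omega)=(\ker\pi_\omega)(MhM)=0$.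
   Context: A finite dimensional weak $C^*$-Hopf algebra is a finite dimensional $C^*$-algebra $A$ (unit $1$) with linear maps $\Delta:A\to A\otimes A$, $\varepsilon:A\to\mathbb C$, $S:A\to A$ such that, for all $x,y,z\in A$ in Sweedler notation: $\Delta(xy)=\Delta(x)\Delta(y)$; $\Delta(x^* )=\Delta(x)^*$; $(\Delta\otimes\mathrm{id})\Delta=(\mathrm{id}\otimes\Delta)\Delta$; $(\Delta(1)\otimes1)(1\otimes\Delta(1))=1_{(1)}\otimes1_{(2)}\otimes1_{(3)}$; $(\varepsilon\otimes\mathrm{id})\Delta=\mathrm{id}=(\mathrm{id}\otimes\varepsilon)\Delta$; $\varepsilon(xyz)=\varepsilon(xy_{(1)})\varepsilon(y_{(2)}z)$; $S(x_{(1)})x_{(2)}=1_{(1)}\varepsilon(x1_{(2)})$; $x_{(1)}S(x_{(2)})=\varepsilon(1_{(1)}x)1_{(2)}$; $S(x_{(1)})x_{(2)}S(x_{(3)})=S(x)$. ($\Delta(1)\neq 1\otimes 1$ in general; $S$ is automatically invertible.) Put $x_*:=S(x)^*$. The dual $\hat A$ is the dual vector space with $\langle\psi\varphi|x\rangle=\langle\psi\otimes\varphi|\Delta(x)\rangle$, $\langle\hat\Delta(\psi)|x\otimes y\rangle=\langle\psi|xy\rangle$, $\hat1=\varepsilon$, $\hat\varepsilon(\psi)=\langle\psi|1\rangle$, $\langle\hat S(\psi)|x\rangle=\langle\psi|S(x)\rangle$, $\langle\psi^*|x\rangle=\overline{\langle\psi|x_*\rangle}$; it is again a finite dimensional weak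 $C^*$-Hopf algebra. Write $\varphi\rightharpoonup a=a_{(1)}\langle\varphi|a_{(2)}\rangle$, $a\leftharpoonup\varphi=\langle\varphi|a_{(1)}\rangle a_{(2)}$. $A_L=\{(\varphi\otimes\mathrm{id})(\Delta(1)):\varphi\in\hat A\}$. $l\in A$ is a left integral ($l\in\mathcal L(A)$) if $al=a_{(1)}S(a_{(2)})l$ for all $a$; a right integral if $la=lS(a_{(1)})a_{(2)}$ for all $a$; $h$ is the unique two-sided integral with $S(h_{(1)})h_{(2)}=h_{(1)}S(h_{(2)})=1$, and $\hat h\in\hat A$ is defined likewise. It is known that $\hat h$ is a faithful positive functional on $A$ and that $\hat h\rightharpoonup h\in A_L$ is positive and invertible. An $A$-module von Neumann algebra is a von Neumann algebra $M$ with a linear left action $\triangleright$ of $A$ with $(ab)\triangleright m=a\triangleright(b\triangleright m)$, $1\triangleright m=m$, $a\triangleright(mn)=(a_{(1)}\triangleright m)(a_{(2)}\triangleright n)$, $(a\triangleright m)^*=a_*\triangleright m^*$, $a\triangleright1_M=(a_{(1)}S(a_{(2)}))\triangleright1_M$, each $a\triangleright$ weakly continuous. The state $\omega$ is $A$-invariant if $\omega(h\triangleright m)=\omega(m)$ for all $m$. The crossed product $M\rtimes A=M\otimes_{A_L}A$ (elements $(m\rtimes a)$ modulo $(m\rtimes ba)=(m(b\triangleright1_M)\rtimes a)$, $b\in A_L$) has product $(m\rtimes a)(m'\rtimes a')=(m(a_{(1)}\triangleright m')\rtimes a_{(2)}a')$ and $(m\rtimes a)^*=(1_M\rtimes a^*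 )(m^*\rtimes1)$; write $ma\equiv(m\rtimes a)$, $m\equiv(m\rtimes 1)$, $a\equiv(1_M\rtimes a)$; $MhM$ is the linear span of the $mhm'$. Notation for GNS vectors: $|m\rangle_\omega=\pi_\omega(m)\Omega_\omega$ with $\Omega_\omega$ the cyclic GNS vector. $L^2(A,\hat h)$ is $A$ with scalar product $(a,b)=\langle\hat h|a^*b\rangle$. The regular homomorphism is the injective $*$-homomorphism $\Lambda:M\rtimes A\to\mathcal B(\mathcal H_\omega\otimes L^2(A,\hat h))$, $\Lambda(m\rtimes a)(\xi\otimes|b\rangle)=\pi_\omega(S^{-1}(a_{(1)}b_{(1)})\triangleright m)\xi\otimes|a_{(2)}b_{(2)}\rangle$. $P=\Lambda(1_M\rtimes1)$, $\mathcal H_{cros}=P(\mathcal H_\omega\otimes L^2(A,\hat h))$, $\pi_{cros}$ is the restriction of $\Lambda$ to $\mathcal H_{cros}$, and $|m\,a\rangle_{cros}:=\Lambda(m\rtimes a)(\Omega_\omega\otimes|1\rangle)\in\mathcal H_{cros}$. *)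

(* Defs.v *)
From HB Require Import structures.
From mathcomp Require Import all_boot all_order all_algebra all_field.
From mathcomp Require Import sesquilinear generic_quotient.
From mathcomp Require Import complex.
From mathcomp Require Import boolp classical_sets reals.

Set Implicit Arguments.
Unset Strict Implicit.
Unset Printing Implicit Defensive.
Import Order.TTheory GRing.Theory Num.Theory.
Local Open Scope ring_scope.
Local Open Scope classical_set_scope.

(* Tensor products of modules over a commutative ring.  [tensor E] is the      *)
(* quotient of the finite formal sums of pairs (v, w) that identifies two sums *)
(* on which every bilinear map f with f v w = f v' w' whenever E v w v' w'     *)
(* takes the same value: the universal such f.  E is empty for V ⊗ W.          *)

Section Tensor.
Local Open Scope quotient_scope.
Variables (F : comNzRingType) (V W : lmodType F).
Variable E : V -> W -> V -> W -> Prop.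

Definition balanced (Z : lmodType F) (f : {bilinear V -> W -> Z}) : Prop :=
  forall v w v' w', E v w v' w' -> f v w = f v' w'.

Definition tens_eq (s t : seq (V * W)) : bool :=
  `[< forall (Z : lmodType F) (f : {bilinear V -> W -> Z}), balanced f ->
        \sum_(p <- s) f p.1 p.2 = \sum_(p <- t) f p.1 p.2 >].

Lemma tens_eq_refl : reflexive tens_eq.
Proof. by move=> s; apply/asboolP. Qed.

Lemma tens_eq_sym : symmetric tens_eq.
Proof. by move=> s t; apply/asboolP/asboolP => H Z f fE; rewrite H. Qed.

Lemma tens_eq_trans : transitive tens_eq.
Proof. by move=> s t u /asboolP H1 /asboolP H2; apply/asboolP => Z f fE; rewrite H1 ?H2. Qed.

Canonical tens_eq_equiv := EquivRel tens_eq tens_eq_refl tens_eq_sym tens_eq_trans.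

Definition tensor := {eq_quot tens_eq}.
HB.instance Definition _ := Choice.on tensor.
HB.instance Definition _ := EqQuotient.on tensor.

Definition tens (v : V) (w : W) : tensor := \pi_tensor [:: (v, w)].

(* Sweedler's convention: with t = x_(1) ⊗ x_(2), [sweedler t f] is            *)
(* f x_(1) x_(2), summed over a decomposition of t; independent of the         *)
(* decomposition when f is balanced and bilinear (or conjugate bilinear).      *)
Definition sweedler (Z : nmodType) (t : tensor) (f : V -> W -> Z) : Z :=
  \sum_(p <- repr t) f p.1 p.2.

Lemma sweedler_pi (Z : lmodType F) (f : {bilinear V -> W -> Z}) s :
  balanced f -> sweedler (\pi_tensor s) f = \sum_(p <- s) f p.1 p.2.
Proof.
move=> fE; rewrite /sweedler.
have /eqmodP/asboolP : repr (\pi_tensor s) = s %[mod tensor] by rewrite reprK.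
exact.
Qed.

Lemma tensP (s t : tensor) :
  (forall (Z : lmodType F) (f : {bilinear V -> W -> Z}), balanced f ->
     sweedler s f = sweedler t f) -> s = t.
Proof.
move=> H; rewrite -[s]reprK -[t]reprK; apply/eqmodP/asboolP => Z f fE.
exact: H.
Qed.

Definition tzero : tensor := \pi_tensor [::].
Definition tadd (s t : tensor) : tensor := \pi_tensor (repr s ++ repr t).
Definition tscale (c : F) (t : tensor) : tensor :=
  \pi_tensor [seq (c *: p.1, p.2) | p <- repr t].
Definition topp (t : tensor) : tensor := tscale (-1) t.

Lemma sweedler_tadd (Z : lmodType F) (f : {bilinear V -> W -> Z}) s t :
  balanced f -> sweedler (tadd s t) f = sweedler s f + sweedler t f.
Proof. by move=> fE; rewrite sweedler_pi // big_cat. Qed.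

Lemma sweedler_tscale (Z : lmodType F) (f : {bilinear V -> W -> Z}) c t :
  balanced f -> sweedler (tscale c t) f = c *: sweedler t f.
Proof.
move=> fE; rewrite sweedler_pi // big_map scaler_sumr.
by apply: eq_bigr => p _ /=; rewrite linearZl_LR.
Qed.

Lemma sweedler_tzero (Z : lmodType F) (f : {bilinear V -> W -> Z}) :
  balanced f -> sweedler tzero f = 0.
Proof. by move=> fE; rewrite sweedler_pi // big_nil. Qed.

Lemma taddA : associative tadd.
Proof. by move=> s t u; apply: tensP => Z f fE; rewrite !sweedler_tadd // addrA. Qed.
Lemma taddC : commutative tadd.
Proof. by move=> s t; apply: tensP => Z f fE; rewrite !sweedler_tadd // addrC. Qed.
Lemma tadd0 : left_id tzero tadd.
Proof.
by move=> s; apply: tensP => Z f fE; rewrite sweedler_tadd // sweedler_tzero // add0r.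
Qed.
Lemma taddN : left_inverse tzero topp tadd.
Proof.
move=> s; apply: tensP => Z f fE.
by rewrite sweedler_tadd // sweedler_tscale // sweedler_tzero // scaleN1r addNr.
Qed.

HB.instance Definition _ := GRing.isZmodule.Build tensor taddA taddC tadd0 taddN.

Lemma tscaleA a b t : tscale a (tscale b t) = tscale (a * b) t.
Proof. by apply: tensP => Z f fE; rewrite !sweedler_tscale // scalerA. Qed.
Lemma tscale1 : left_id 1 tscale.
Proof. by move=> t; apply: tensP => Z f fE; rewrite sweedler_tscale // scale1r. Qed.
Lemma tscaleDr : right_distributive tscale +%R.
Proof.
move=> a s t; apply: tensP => Z f fE.
by rewrite sweedler_tscale // !sweedler_tadd // !sweedler_tscale // scalerDr.
Qed.
Lemma tscaleDl t : {morph tscale^~ t : a b / a + b}.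
Proof.
move=> a b; apply: tensP => Z f fE.
by rewrite sweedler_tadd // !sweedler_tscale // scalerDl.
Qed.

HB.instance Definition _ :=
  GRing.Zmodule_isLmodule.Build F tensor tscaleA tscale1 tscaleDr tscaleDl.

Lemma sweedlerE (Z : lmodType F) (f : {bilinear V -> W -> Z}) v w :
  balanced f -> sweedler (tens v w) f = f v w.
Proof. by move=> fE; rewrite sweedler_pi // big_seq1. Qed.

Lemma sweedler_linear (Z : lmodType F) (f : {bilinear V -> W -> Z}) :
  balanced f -> linear (fun t : tensor => sweedler t f).
Proof.
by move=> fE a s t; rewrite [LHS]sweedler_tadd // sweedler_tscale.
Qed.

Lemma tensDl v v' w : tens (v + v') w = tens v w + tens v' w.
Proof.
by apply: tensP => Z f fE; rewrite [RHS]sweedler_tadd // !sweedlerE // linearDl.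
Qed.

Lemma tensDr v w w' : tens v (w + w') = tens v w + tens v w'.
Proof.
by apply: tensP => Z f fE; rewrite [RHS]sweedler_tadd // !sweedlerE // linearDr.
Qed.

Lemma tensZl c v w : tens (c *: v) w = c *: tens v w.
Proof.
by apply: tensP => Z f fE; rewrite [RHS]sweedler_tscale // !sweedlerE // linearZl_LR.
Qed.

Lemma tensZr c v w : tens v (c *: w) = c *: tens v w.
Proof.
by apply: tensP => Z f fE; rewrite [RHS]sweedler_tscale // !sweedlerE // linearZr_LR.
Qed.

Lemma tens_balanced v w v' w' : E v w v' w' -> tens v w = tens v' w'.
Proof. by move=> e; apply: tensP => Z f fE; rewrite !sweedlerE //; exact: fE. Qed.

Lemma tens_sum (t : tensor) : t = sweedler t tens.
Proof.
apply: tensP => Z f fE.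
suff H s : sweedler (\sum_(p <- s) tens p.1 p.2) f = \sum_(p <- s) f p.1 p.2.
  by rewrite [RHS]H.
elim: s => [|p s IHs]; first by rewrite !big_nil [LHS]sweedler_tzero.
by rewrite !big_cons [LHS]sweedler_tadd // IHs sweedlerE.
Qed.

End Tensor.

Definition no_rel {T U : Type} (_ : T) (_ : U) (_ : T) (_ : U) : Prop := False.

Notation "V ⊗ W" := (tensor (@no_rel V W)) (at level 40, left associativity) : type_scope.
Notation "v ⊗ w" := (tens (@no_rel _ _) v w) (at level 40, left associativity) : ring_scope.

(* In [{dot V for Num.conj}] the form is linear in its first argument; [inner] is *)
(* the same scalar product, antilinear in the first and linear in the second.  *)
Section InnerProduct.
Variables (R : realType) (V : lmodType R[i]) (dot : {dot V for Num.conj}).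

Definition dot_norm (x : V) : R[i] := sqrtC (dot x x).

Definition dot_complete : Prop :=
  forall u : nat -> V,
    (forall e : R[i], 0 < e -> exists N, forall m n,
       (N <= m)%N -> (N <= n)%N -> dot_norm (u m - u n) < e) ->
    exists l, forall e : R[i], 0 < e -> exists N, forall n,
       (N <= n)%N -> dot_norm (u n - l) < e.

End InnerProduct.

Record hilbertSpace (R : realType) := HilbertSpace {
  hcarrier :> lmodType R[i];
  hdot : {dot hcarrier for Num.conj};
  hcomplete : dot_complete hdot
}.

Section Operators.
Variables (R : realType) (H : hilbertSpace R).

Definition inner (xi eta : H) : R[i] := hdot H eta xi.
Definition hnorm (xi : H) : R[i] := dot_norm (hdot H) xi.

Definition bounded_operator (T : H -> H) : Prop :=
  linear T /\ exists c : R[i], forall xi, hnorm (T xi) <= c * hnorm xi.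

(* The operations of B are explicit so that the predicate also applies to the  *)
(* crossed product.                                                            *)
Record star_representation (B : lmodType R[i]) (mul : B -> B -> B) (one : B)
    (star : B -> B) (pi : B -> H -> H) : Prop := {
  rep_bounded : forall x, bounded_operator (pi x);
  rep_linear : forall c x y xi, pi (c *: x + y) xi = c *: pi x xi + pi y xi;
  rep_mul : forall x y xi, pi (mul x y) xi = pi x (pi y xi);
  rep_one : forall xi, pi one xi = xi;
  rep_star : forall x xi eta, inner (pi x xi) eta = inner xi (pi (star x) eta)
}.

End Operators.

Section StarAlgebras.
Variables (R : realType) (B : algType R[i]).

Record star_axioms (star : B -> B) : Prop := {
  star_semilinear : forall c x y, star (c *: x + y) = c^* *: star x + star y;
  star_mul : forall x y, star (x * y) = star y * star x;
  star_invol : forall x, star (star x) = x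
}.

Record cstar_norm (star : B -> B) (nrm : B -> R[i]) : Prop := {
  nrm_ge0 : forall x, 0 <= nrm x;
  nrm_eq0 : forall x, nrm x = 0 -> x = 0;
  nrm_scale : forall c x, nrm (c *: x) = `|c| * nrm x;
  nrm_add : forall x y, nrm (x + y) <= nrm x + nrm y;
  nrm_mul : forall x y, nrm (x * y) <= nrm x * nrm y;
  nrm_cstar : forall x, nrm (star x * x) = nrm x ^+ 2
}.

Definition positive_elt (star : B -> B) (x : B) : Prop :=
  exists y, x = star y * y.

End StarAlgebras.

(* A von Neumann algebra is presented by its algebra together with a faithful  *)
(* unital *-representation on a Hilbert space whose image is its bicommutant.  *)
Record vonNeumannAlgebra (R : realType) := VonNeumannAlgebra {
  vn_alg :> algType R[i];
  vn_star : vn_alg -> vn_alg;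
  vn_starP : star_axioms vn_star;
  vn_space : hilbertSpace R;
  vn_rep : vn_alg -> vn_space -> vn_space;
  vn_repP : star_representation *%R 1 vn_star vn_rep;
  vn_faithful : forall x y, (forall xi, vn_rep x xi = vn_rep y xi) -> x = y;
  vn_bicommutant : forall T, bounded_operator T ->
    (forall U, bounded_operator U ->
       (forall x xi, U (vn_rep x xi) = vn_rep x (U xi)) ->
       forall xi, T (U xi) = U (T xi)) ->
    exists x, forall xi, T xi = vn_rep x xi
}.

Section VonNeumann.
Variables (R : realType) (M : vonNeumannAlgebra R).

Definition vn_le (x y : M) : Prop := positive_elt (@vn_star R M) (y - x).

Definition vn_lub (D : set M) (x : M) : Prop :=
  (forall d, D d -> vn_le d x) /\
  (forall y, (forall d, D d -> vn_le d y) -> vn_le x y).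

Record state (omega : M -> R[i]) : Prop := {
  state_linear : forall c x y, omega (c *: x + y) = c * omega x + omega y;
  state_ge0 : forall x, 0 <= omega (vn_star x * x);
  state_one : omega 1 = 1
}.

Definition faithful_functional (omega : M -> R[i]) : Prop :=
  forall x, omega (vn_star x * x) = 0 -> x = 0.

Definition normal_functional (omega : M -> R[i]) : Prop :=
  forall (D : set M) (x : M),
    (exists d, D d) ->
    (forall d, D d -> positive_elt (@vn_star R M) d) ->
    (forall d d', D d -> D d' -> exists d'', [/\ D d'', vn_le d d'' & vn_le d' d'']) ->
    vn_lub D x ->
    (forall d, D d -> omega d <= omega x) /\
    (forall c, (forall d, D d -> omega d <= c) -> omega x <= c).

(* Continuity at every point for the weak operator topology, generated by the  *)
(* seminorms x |-> |(xi, x eta)|.                                              *)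
Definition weakly_continuous (T : M -> M) : Prop :=
  forall (x0 : M) (xi eta : vn_space M) (e : R[i]), 0 < e ->
    exists (s : seq (vn_space M * vn_space M)) (d : R[i]), 0 < d /\
      forall x : M,
        (forall p, p \in s -> `|inner p.1 (vn_rep (x - x0) p.2)| < d) ->
        `|inner xi (vn_rep (T x - T x0) eta)| < e.

Record gns (omega : M -> R[i]) := GNS {
  gns_space :> hilbertSpace R;
  gns_rep : M -> gns_space -> gns_space;
  gns_vec : gns_space;
  gns_repP : star_representation *%R 1 (@vn_star R M) gns_rep;
  gns_state : forall x, inner gns_vec (gns_rep x gns_vec) = omega x;
  gns_cyclic : forall xi (e : R[i]), 0 < e ->
    exists x, hnorm (xi - gns_rep x gns_vec) < e
}.

Arguments gns_rep {omega} g _ _.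
Arguments gns_vec {omega} g.

Definition gket omega (G : gns omega) (m : M) : G := gns_rep G m (gns_vec G).

End VonNeumann.

Arguments gns_rep {R M omega} g _ _.
Arguments gns_vec {R M omega} g.

Section TensorSquare.
Variables (R : realType) (A : falgType R[i]).

Definition tmul (s t : A ⊗ A) : A ⊗ A :=
  sweedler s (fun a b => sweedler t (fun c d => (a * c) ⊗ (b * d))).

Definition tstar (star : A -> A) (t : A ⊗ A) : A ⊗ A :=
  sweedler t (fun a b => star a ⊗ star b).

Definition tassoc (t : A ⊗ (A ⊗ A)) : (A ⊗ A) ⊗ A :=
  sweedler t (fun a u => sweedler u (fun b c => (a ⊗ b) ⊗ c)).

End TensorSquare.


Record weakCstarHopf (R : realType) (A : falgType R[i]) := WeakCstarHopf {
  star : A -> A;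
  comul : {linear A -> (A ⊗ A)%type};
  counit : 'Hom(A, R[i]^o);
  antip : 'End(A);
  starP : star_axioms star;
  (* Completeness is automatic in finite dimension. *)
  cstarP : exists nrm, cstar_norm star nrm;
  comulM : forall x y, comul (x * y) = tmul (comul x) (comul y);
  comul_star : forall x, comul (star x) = tstar star (comul x);
  comulA : forall x,
    sweedler (comul x) (fun x1 x2 => comul x1 ⊗ x2) =
    tassoc (sweedler (comul x) (fun x1 x2 => x1 ⊗ comul x2));
  (* (Δ(1) ⊗ 1)(1 ⊗ Δ(1)) = 1_(1) ⊗ 1_(2) ⊗ 1_(3) *)
  comul1 :
    sweedler (comul 1) (fun a b =>
      sweedler (comul 1) (fun c d => (a ⊗ (b * c)) ⊗ d)) =
    sweedler (comul 1) (fun a b => comul a ⊗ b);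
  counitl : forall x, sweedler (comul x) (fun x1 x2 => counit x1 *: x2) = x;
  counitr : forall x, sweedler (comul x) (fun x1 x2 => counit x2 *: x1) = x;
  counitM : forall x y z,
    counit (x * y * z) =
    sweedler (comul y) (fun y1 y2 => counit (x * y1) * counit (y2 * z));
  antipl : forall x,
    sweedler (comul x) (fun x1 x2 => antip x1 * x2) =
    sweedler (comul 1) (fun a b => counit (x * b) *: a);
  antipr : forall x,
    sweedler (comul x) (fun x1 x2 => x1 * antip x2) =
    sweedler (comul 1) (fun a b => counit (a * x) *: b);
  antipS : forall x,
    sweedler (comul x) (fun x1 x2 =>
      sweedler (comul x1) (fun y1 y2 => antip y1 * y2 * antip x2)) = antip x
}.

(* The part of a weak Hopf algebra structure that integrals refer to, so that  *)
(* one definition of the Haar integral serves both A and its dual.             *)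
Record hopf_ops (F : comNzRingType) (V : lmodType F) := HopfOps {
  op_mul : V -> V -> V;
  op_one : V;
  op_comul : V -> V ⊗ V;
  op_antip : V -> V
}.

Section Integrals.
Variables (F : comNzRingType) (V : lmodType F) (D : hopf_ops V).

Definition left_integral (l : V) : Prop :=
  forall a, op_mul D a l =
    op_mul D (sweedler (op_comul D a) (fun a1 a2 => op_mul D a1 (op_antip D a2))) l.

Definition right_integral (l : V) : Prop :=
  forall a, op_mul D l a =
    op_mul D l (sweedler (op_comul D a) (fun a1 a2 => op_mul D (op_antip D a1) a2)).

Definition haar_integral (h : V) : Prop :=
  [/\ left_integral h, right_integral h,
      sweedler (op_comul D h) (fun h1 h2 => op_mul D (op_antip D h1) h2) = op_one D &
      sweedler (op_comul D h) (fun h1 h2 => op_mul D h1 (op_antip D h2)) = op_one D].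

End Integrals.

Section WeakHopf.
Variables (R : realType) (A : falgType R[i]) (W : weakCstarHopf A).
Local Notation dualA := 'Hom(A, R[i]^o).

Definition alg_ops : hopf_ops A :=
  HopfOps *%R 1 (comul W) (antip W).

Definition dual_mul (psi phi : dualA) : dualA :=
  linfun (fun x => sweedler (comul W x) (fun x1 x2 => psi x1 * phi x2) : R[i]^o).

Definition pair2 (psi phi : dualA) (x y : A) : R[i]^o := psi x * phi y.

Lemma pair2_bilinear psi phi :
  bilinear_for *:%R *:%R (pair2 psi phi : A -> A -> R[i]^o).
Proof.
split=> u c a b; rewrite /pair2 linearP.
- by rewrite mulrDl -scalerAl.
- by rewrite mulrDr; congr (_ + _); rewrite mulrCA.
Qed.

HB.instance Definition _ psi phi :=
  bilinear_isBilinear.Build _ _ _ _ _ _ (pair2 psi phi) (pair2_bilinear psi phi).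

Lemma dual_mulP psi phi x :
  dual_mul psi phi x = sweedler (comul W x) (pair2 psi phi).
Proof.
pose f x := sweedler (comul W x) (pair2 psi phi).
have lf : linear f.
  move=> c a b; rewrite /f linearP; exact: sweedler_linear.
pose F : {linear A -> R[i]^o} := HB.pack f (GRing.isLinear.Build _ _ _ _ _ lf).
exact: (lfunE F).
Qed.

Definition dual_basis (i : 'I_(\dim {:A})) : dualA :=
  linfun (coord (vbasis {:A}) i : A -> R[i]^o).

(* The element of dualA ⊗ dualA with <dual_comul psi | x ⊗ y> = <psi | xy>:    *)
(* see dual_comulP.                                                            *)
Definition dual_comul (psi : dualA) : dualA ⊗ dualA :=
  \sum_(i < \dim {:A}) \sum_(j < \dim {:A}) psi ((vbasis {:A})`_i * (vbasis {:A})`_j)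
     *: (dual_basis i ⊗ dual_basis j).

Definition eval2 (x y : A) (phi chi : dualA) : R[i]^o := phi x * chi y.

Lemma eval2_bilinear x y :
  bilinear_for *:%R *:%R (eval2 x y : dualA -> dualA -> R[i]^o).
Proof.
split=> u c a b; rewrite /eval2 add_lfunE scale_lfunE.
- by rewrite mulrDl -scalerAl.
- by rewrite mulrDr; congr (_ + _); rewrite mulrCA.
Qed.

HB.instance Definition _ x y :=
  bilinear_isBilinear.Build _ _ _ _ _ _ (eval2 x y) (eval2_bilinear x y).

Lemma dual_comulP psi x y :
  sweedler (dual_comul psi) (eval2 x y) = psi (x * y).
Proof.
have nb : balanced (@no_rel dualA dualA) (eval2 x y) by [].
rewrite /dual_comul (big_morph (fun t => sweedler t (eval2 x y))
  (fun s t => sweedler_tadd s t nb) (sweedler_tzero nb)).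
under eq_bigr => i _ do rewrite (big_morph (fun t => sweedler t (eval2 x y))
  (fun s t => sweedler_tadd s t nb) (sweedler_tzero nb)).
rewrite [in RHS](coord_vbasis (memvf x)) [in RHS](coord_vbasis (memvf y)).
rewrite mulr_suml linear_sum; apply: eq_bigr => i _.
rewrite mulr_sumr linear_sum; apply: eq_bigr => j _.
rewrite [LHS]sweedler_tscale // sweedlerE //= /eval2 /dual_basis !lfunE /=.
rewrite -[in RHS]scalerAl -[in RHS]scalerAr [in RHS]scalerA [RHS]linearZ.
exact: mulrC.
Qed.

Definition dual_antip (psi : dualA) : dualA := (psi \o antip W)%VF.

Definition dual_ops : hopf_ops dualA :=
  HopfOps dual_mul (counit W) dual_comul dual_antip.

Definition lower_star (x : A) : A := star W (antip W x).

Definition antip_inv : 'End(A) := ((antip W)^-1)%VF.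

(* phi ⇀ a *)
Definition dual_actl (phi : dualA) (a : A) : A :=
  sweedler (comul W a) (fun a1 a2 => phi a2 *: a1).

Definition A_L (b : A) : Prop :=
  exists phi : dualA, b = sweedler (comul W 1) (fun x y => phi x *: y).

Definition positive_sqrt (g x : A) : Prop :=
  positive_elt (star W) g /\ g * g = x.

End WeakHopf.

Record moduleAlgebra (R : realType) (A : falgType R[i]) (W : weakCstarHopf A)
    (M : vonNeumannAlgebra R) := ModuleAlgebra {
  act :> A -> M -> M;
  act_linearl : forall c a b m, act (c *: a + b) m = c *: act a m + act b m;
  act_linearr : forall a c m n, act a (c *: m + n) = c *: act a m + act a n;
  act_mul : forall a b m, act (a * b) m = act a (act b m);
  act_one : forall m, act 1 m = m;
  act_prod : forall a m n,
    act a (m * n) = sweedler (comul W a) (fun a1 a2 => act a1 m * act a2 n);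
  act_star : forall a m, vn_star (act a m) = act (lower_star W a) (vn_star m);
  act_unit : forall a,
    act a 1 = act (sweedler (comul W a) (fun a1 a2 => a1 * antip W a2)) 1;
  act_continuous : forall a, weakly_continuous (act a)
}.

Section Crossed.
Variables (R : realType) (A : falgType R[i]) (W : weakCstarHopf A).
Variables (M : vonNeumannAlgebra R) (T : moduleAlgebra W M).
Local Notation dualA := 'Hom(A, R[i]^o).

Definition invariant_functional (h : A) (omega : M -> R[i]) : Prop :=
  forall m, omega (T h m) = omega m.

(* (m ⋊ b a) = (m (b ▷ 1) ⋊ a) for b in A_L *)
Definition crossed_rel (m : M) (a : A) (m' : M) (a' : A) : Prop :=
  exists2 b, A_L W b & a = b * a' /\ m' = m * T b 1.

Definition crossed := tensor crossed_rel.

Definition cr (m : M) (a : A) : crossed := tens crossed_rel m a.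

(* Like Lambda below, independent of the chosen decompositions, the map under  *)
(* the sums being balanced over A_L.                                           *)
Definition cr_mul (x y : crossed) : crossed :=
  sweedler x (fun m a => sweedler y (fun m' a' =>
    sweedler (comul W a) (fun a1 a2 => cr (m * T a1 m') (a2 * a')))).

Definition cr_one : crossed := cr 1 1.

Definition cr_star (x : crossed) : crossed :=
  sweedler x (fun m a => cr_mul (cr 1 (star W a)) (cr (vn_star m) 1)).

Definition MhM (h : A) (x : crossed) : Prop :=
  exists s : seq (M * M),
    x = \sum_(p <- s) cr_mul (cr_mul (cr p.1 1) (cr 1 h)) (cr p.2 1).

Definition two_sided_ideal (I : crossed -> Prop) : Prop :=
  [/\ I 0, forall c x y, I x -> I y -> I (c *: x + y),
      forall x y, I y -> I (cr_mul x y) & forall x y, I x -> I (cr_mul x y)].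

Variables (hhat : dualA) (omega : M -> R[i]) (G : gns omega).

(* The scalar product of H_omega ⊗ L^2(A, hhat). As A is finite dimensional    *)
(* the algebraic tensor product is already complete.                           *)
Definition tinner (s t : G ⊗ A) : R[i] :=
  sweedler s (fun xi a => sweedler t (fun eta b =>
    inner xi eta * hhat (star W a * b))).

Definition Lambda (x : crossed) (t : G ⊗ A) : G ⊗ A :=
  sweedler x (fun m a => sweedler t (fun xi b =>
    sweedler (comul W a) (fun a1 a2 => sweedler (comul W b) (fun b1 b2 =>
      gns_rep G (T (antip_inv W (a1 * b1)) m) xi ⊗ (a2 * b2))))).

Definition H_cros (t : G ⊗ A) : Prop := exists s, t = Lambda cr_one s.

Definition cket (m : M) (a : A) : G ⊗ A := Lambda (cr m a) (gns_vec G ⊗ 1).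

Definition isometry_to_H_cros (V : G -> G ⊗ A) : Prop :=
  [/\ linear V, forall xi, H_cros (V xi) &
      forall xi eta, tinner (V xi) (V eta) = inner xi eta].

(* Vs represents V^* : H_cros -> H_omega; its values off H_cros are irrelevant *)
Definition adjoint_on_H_cros (V : G -> G ⊗ A) (Vs : G ⊗ A -> G) : Prop :=
  forall t, H_cros t -> forall xi, inner (Vs t) xi = tinner t (V xi).

(* pi_omega(x) = V^* pi_cros(x) V *)
Definition pi_ext (V : G -> G ⊗ A) (Vs : G ⊗ A -> G) (x : crossed) (xi : G) : G :=
  Vs (Lambda x (V xi)).

Definition in_ker_pi_ext (V : G -> G ⊗ A) (Vs : G ⊗ A -> G) (x : crossed) : Prop :=
  forall xi, pi_ext V Vs x xi = 0.

End Crossed.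

Arguments cr_mul {R A W M} T x y.
Arguments cr_star {R A W M} T x.
Arguments MhM {R A W M} T h x.
Arguments Lambda {R A W M} T {omega G} x t.
Arguments pi_ext {R A W M} T {omega G} V Vs x xi.
Arguments in_ker_pi_ext {R A W M} T {omega G} V Vs x.

(* Main.v *)
(* Invariance of omega under h means omega ((a . m) n) = omega (m (S(a) . n)), so that
   |m> |-> |a . m> is a *-representation U of A on the GNS space, bounded because a^* a
   has a finite spectral decomposition in A. With l the left integral h g_L^-1, the maps
     V xi = U (S^-1 l_1) xi ⊗ l_2,   V^* (eta ⊗ b) = hhat (x_2 b) U (S x_1) eta,  x = l^*,
   are adjoint, and S x_1 S^-1 l_1 hhat (x_2 l_2) = 1 by the integral identity
   l_1 ⊗ a l_2 = S(a) l_1 ⊗ l_2 together with h_1 hhat (h_2) = g_L^2. The same identities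
   give Lambda (m a) V = V pi (m) U (a), from which (i) and (ii) follow; (iii) reduces to
   (n a)(m h) = n (a . m) h and h (m a) = h (S^-1(a) . m), the second one combined with the
   adjoint of an element of the kernel.

   That S^-1 exists comes from the star: S^-1 (x) = S (x^* )^*. Nondegeneracy of hhat is
   algebraic, since its radical is a left ideal and a left coideal on which the counit
   vanishes. Its positivity, needed for the uniqueness of V, is drawn from that of g_L: for
   the trace tau of the regular representation, q = tau (h_1) h_2 is positive and invertible
   and hhat (y q y^* ) = tau (S(y) g_L^2 S(y)^* ). *)

Require Import Defs.
From HB Require Import structures.
From mathcomp Require Import all_boot all_order all_algebra all_field.
From mathcomp Require Import sesquilinear complex reals boolp ring.

Set Implicit Arguments.
Unset Strict Implicit.
Unset Printing Implicit Defensive.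
Import Order.TTheory GRing.Theory Num.Theory.
Local Open Scope ring_scope.

(** * Linear maps and tensors *)

(** The hypotheses on [A] are the bare axioms, so what is usually quoted must be derived: that the
    antipode reverses products and coproducts, that [hhat] is symmetric, nondegenerate and positive,
    and that [gL] lies in [A_L]. The obstacle throughout is that Sweedler legs are not elements: a
    leg of [Δ(1)] has no membership property of its own, and a factor depending on a leg cannot be
    held fixed. Hence coproduct identities are stated against arbitrary multilinear maps into
    arbitrary modules, and a basis expansion ([coord_expand]) decouples a factor that a vanishing
    statement wants fixed. The operators U are needed because V is prescribed only on the dense
    vectors |m>, while its closed formula and its adjoint must make sense on all vectors. The factor
    g_L^-1 normalizes V: in V^* V the sum h_1 hhat (h_2) = g_L^2 occurs once and is cancelled by the
    inverses contained in l and in l^*. The root g_L inherits properties of its square because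
    positivity makes it a polynomial in that square. In the positivity of hhat, an arbitrary x x^*
    is reached from y q y^* by taking y = x q^{-1/2}. *)

Section Linearity.
Variable F : comNzRingType.

(** Linearity is kept as a predicate on bare functions: Sweedler sums are open lambda terms, for
    which no [{linear _ -> _}] structure can be inferred. *)
Definition lin (U Z : lmodType F) (f : U -> Z) : Prop :=
  forall c x y, f (c *: x + y) = c *: f x + f y.

Definition bil (U V Z : lmodType F) (f : U -> V -> Z) : Prop :=
  (forall v, lin (f^~ v)) /\ (forall u, lin (f u)).

Definition tril (U V X Z : lmodType F) (f : U -> V -> X -> Z) : Prop :=
  [/\ forall v x, lin (fun u => f u v x), forall u x, lin (fun v => f u v x) &
      forall u v, lin (f u v)].

Lemma tril1 (U V X Z : lmodType F) (f : U -> V -> X -> Z) :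
  tril f -> forall v x, lin (fun u => f u v x).
Proof. by case. Qed.
Lemma tril2 (U V X Z : lmodType F) (f : U -> V -> X -> Z) :
  tril f -> forall u x, lin (fun v => f u v x).
Proof. by case. Qed.
Lemma tril3 (U V X Z : lmodType F) (f : U -> V -> X -> Z) :
  tril f -> forall u v, lin (f u v).
Proof. by case. Qed.

Section Basics.
Variables U V Z Y : lmodType F.

Lemma lin0 (f : U -> Z) : lin f -> f 0 = 0.
Proof.
move=> fL; have := fL (-1) 0 0.
by rewrite scaler0 addr0 scaleN1r addNr.
Qed.

Lemma linD (f : U -> Z) : lin f -> {morph f : x y / x + y}.
Proof. by move=> fL x y; rewrite -[x]scale1r fL !scale1r. Qed.

Lemma linZ (f : U -> Z) : lin f -> forall c x, f (c *: x) = c *: f x.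
Proof. by move=> fL c x; rewrite -[c *: x]addr0 fL lin0 // addr0. Qed.

Lemma linN (f : U -> Z) : lin f -> {morph f : x / - x}.
Proof. by move=> fL x; rewrite -scaleN1r linZ // scaleN1r. Qed.

Lemma linB (f : U -> Z) : lin f -> {morph f : x y / x - y}.
Proof. by move=> fL x y; rewrite linD // linN. Qed.

Lemma lin_sum (f : U -> Z) : lin f -> forall I (r : seq I) (P : pred I) G,
  f (\sum_(i <- r | P i) G i) = \sum_(i <- r | P i) f (G i).
Proof. by move=> fL I r P G; rewrite (big_morph f (linD fL) (lin0 fL)). Qed.

Lemma lin_id : lin (fun x : U => x). Proof. by []. Qed.

Lemma lin_comp (g : V -> Z) (u : U -> V) :
  lin g -> lin u -> lin (fun x => g (u x)).
Proof. by move=> gL uL c x y; rewrite uL gL. Qed.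

Lemma lin_linear (f : {linear U -> Z}) : lin f.
Proof. by move=> c x y; rewrite linearP. Qed.

Lemma lin_add (f g : U -> Z) : lin f -> lin g -> lin (fun x => f x + g x).
Proof. by move=> fL gL c x y; rewrite fL gL scalerDr addrACA. Qed.

Lemma lin_scaler c (f : U -> Z) : lin f -> lin (fun x => c *: f x).
Proof. by move=> fL d x y; rewrite fL scalerDr !scalerA mulrC. Qed.

Lemma lin_scalel (v : Z) (f : U -> F^o) : lin f -> lin (fun x => f x *: v).
Proof. by move=> fL d x y; rewrite fL scalerDl scalerA. Qed.

Lemma lin_bigsum I (r : seq I) (P : pred I) (f : I -> U -> Z) :
  (forall i, lin (f i)) -> lin (fun x => \sum_(i <- r | P i) f i x).
Proof.
move=> fL c x y; rewrite scaler_sumr -big_split; apply: eq_bigr => i _.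
exact: fL.
Qed.

End Basics.

Lemma lin_mull (U : lmodType F) (B : algType F) v (f : U -> B) :
  lin f -> lin (fun x => f x * v).
Proof. by move=> fL c x y; rewrite fL mulrDl scalerAl. Qed.

Lemma lin_mulr (U : lmodType F) (B : algType F) v (f : U -> B) :
  lin f -> lin (fun x => v * f x).
Proof. by move=> fL c x y; rewrite fL mulrDr scalerAr. Qed.

Lemma lin_smull (U : lmodType F) (v : F) (f : U -> F^o) :
  lin f -> lin (fun x => f x * v : F^o).
Proof. by move=> fL c x y; rewrite fL mulrDl -scalerAl. Qed.

Lemma lin_smulr (U : lmodType F) (v : F) (f : U -> F^o) :
  lin f -> lin (fun x => v * f x : F^o).
Proof. by move=> fL c x y; rewrite fL mulrDr; congr (_ + _); rewrite mulrCA. Qed.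

Section Tensors.
Variables U V : lmodType F.
Variable E : U -> V -> U -> V -> Prop.

Definition bal (Z : Type) (f : U -> V -> Z) : Prop :=
  forall v w v' w', E v w v' w' -> f v w = f v' w'.

Lemma bil_bilinear (Z : lmodType F) (f : U -> V -> Z) :
  bil f -> exists g : {bilinear U -> V -> Z}, (g : U -> V -> Z) = f.
Proof.
case=> f1 f2.
have fB : bilinear_for *:%R *:%R f.
  by split=> [v c x y|u c x y]; [exact: f1 | exact: f2].
pose g : {bilinear U -> V -> Z} :=
  HB.pack f (bilinear_isBilinear.Build _ _ _ _ _ _ f fB).
by exists g.
Qed.

Lemma sw_tens (Z : lmodType F) (f : U -> V -> Z) u v :
  bil f -> bal f -> sweedler (tens E u v) f = f u v.
Proof. by move=> /bil_bilinear[g <-] gE; exact: sweedlerE. Qed.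

Lemma sw_lin (Z : lmodType F) (f : U -> V -> Z) :
  bil f -> bal f -> lin (fun t : tensor E => sweedler t f).
Proof. by move=> /bil_bilinear[g <-] gE c s t; exact: sweedler_linear. Qed.

Lemma lin_tensl v : lin (fun u => tens E u v).
Proof. by move=> c x y; rewrite tensDl tensZl. Qed.

Lemma lin_tensr u : lin (tens E u).
Proof. by move=> c x y; rewrite tensDr tensZr. Qed.

Lemma bil_tens : bil (tens E).
Proof. by split; [exact: lin_tensl | exact: lin_tensr]. Qed.

End Tensors.

Section Sweedler.
Variables (U V : lmodType F) (E : U -> V -> U -> V -> Prop).

Lemma eq_sw (Z : nmodType) (t : tensor E) (f g : U -> V -> Z) :
  (forall a b, f a b = g a b) -> sweedler t f = sweedler t g.
Proof. by move=> fg; apply: eq_bigr => p _; exact: fg. Qed.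

Lemma swap_sw (U' V' : lmodType F) (E' : U' -> V' -> U' -> V' -> Prop)
    (Z : nmodType) (s : tensor E) (t : tensor E') f :
  sweedler s (fun a b => sweedler t (fun c d => f a b c d)) =
  sweedler t (fun c d => sweedler s (fun a b => f a b c d)) :> Z.
Proof. exact: exchange_big. Qed.

Lemma sw_sumr (Z : nmodType) (t : tensor E) I (r : seq I) (P : pred I) f :
  sweedler t (fun a b => \sum_(i <- r | P i) f i a b) =
  \sum_(i <- r | P i) sweedler t (f i) :> Z.
Proof. exact: exchange_big. Qed.

Lemma lin_sw (Y Z : lmodType F) (g : Y -> Z) (t : tensor E) (f : U -> V -> Y) :
  lin g -> g (sweedler t f) = sweedler t (fun a b => g (f a b)).
Proof. by move=> gL; rewrite /sweedler lin_sum. Qed.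

Lemma lin_swr (Y Z : lmodType F) (t : tensor E) (f : U -> V -> Y -> Z) :
  (forall a b, lin (f a b)) -> lin (fun y => sweedler t (fun a b => f a b y)).
Proof. by move=> fL; apply: lin_bigsum => p; exact: fL. Qed.

Lemma lin_swl (Y Z : lmodType F) (u : Y -> tensor E) (f : U -> V -> Z) :
  bil f -> bal E f -> lin u -> lin (fun y => sweedler (u y) f).
Proof. by move=> fL fE uL c x y; rewrite uL (sw_lin fL fE). Qed.

Lemma sw_mull (B : algType F) (t : tensor E) (f : U -> V -> B) x :
  x * sweedler t f = sweedler t (fun a b => x * f a b).
Proof. exact: mulr_sumr. Qed.

Lemma sw_mulr (B : algType F) (t : tensor E) (f : U -> V -> B) x :
  sweedler t f * x = sweedler t (fun a b => f a b * x).
Proof. exact: mulr_suml. Qed.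

Lemma sw_scalel (Z : lmodType F) (t : tensor E) (f : U -> V -> F) (z : Z) :
  sweedler t f *: z = sweedler t (fun a b => f a b *: z).
Proof. exact: scaler_suml. Qed.

Lemma sw_scaler (Z : lmodType F) (t : tensor E) (f : U -> V -> Z) c :
  c *: sweedler t f = sweedler t (fun a b => c *: f a b).
Proof. exact: scaler_sumr. Qed.

End Sweedler.

Lemma bal_no_rel (U V : lmodType F) (Z : Type) (f : U -> V -> Z) :
  bal (@no_rel U V) f.
Proof. by []. Qed.

End Linearity.

(* Proves linearity of an explicit expression by recursion on its syntax, using *)
(* the hypotheses [lin g], [bil g] and [tril g] of the context; [bal] goals are  *)
(* left to the user.                                                             *)
Ltac lin_tac :=
  try assumption;
  lazymatch goal with
  | |- bil _ => split; let z := fresh "z" in intro z; cbn beta; lin_tac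
  | |- tril _ => split; let z := fresh "z" in let t := fresh "t" in
                 intros z t; cbn beta; lin_tac
  | |- bal (@no_rel _ _) _ => exact (@bal_no_rel _ _ _ _ _)
  | |- bal _ _ => idtac
  | |- forall _, _ => let z := fresh "z" in intro z; cbn beta; lin_tac
  | |- @lin _ _ _ _ => lin_core
  | _ => idtac
  end
with lin_core :=
  first
  [ match goal with
    | |- @lin ?K ?U ?Z (fun x => x) => exact (@lin_id K U)
    | |- lin (fun x => @?u x + @?v x) =>
        apply (@lin_add _ _ _ u v); lin_tac
    | |- lin (fun x => @?u x * ?v) =>
        first [ apply (@lin_mull _ _ _ v u) | apply (@lin_smull _ _ v u) ]; lin_tac
    | |- lin (fun x => ?v * @?u x) =>
        first [ apply (@lin_mulr _ _ _ v u) | apply (@lin_smulr _ _ v u) ]; lin_tac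
    | |- lin (fun x => @?u x *: ?v) => apply (@lin_scalel _ _ _ v u); lin_tac
    | |- lin (fun x => ?v *: @?u x) => apply (@lin_scaler _ _ _ v u); lin_tac
    | |- lin (fun x => tens ?E (@?u x) ?v) =>
        apply (@lin_comp _ _ _ _ (fun y => tens E y v) u (@lin_tensl _ _ _ E v));
        lin_tac
    | |- lin (fun x => tens ?E ?v (@?u x)) =>
        apply (@lin_comp _ _ _ _ (tens E v) u (@lin_tensr _ _ _ E v)); lin_tac
    | H : bil ?g |- lin (fun x => ?g (@?u x) ?v) =>
        apply (@lin_comp _ _ _ _ (fun y => g y v) u (proj1 H v)); lin_tac
    | H : bil ?g |- lin (fun x => ?g ?v (@?u x)) =>
        apply (@lin_comp _ _ _ _ (g v) u (proj2 H v)); lin_tac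
    | H : tril ?g |- lin (fun x => ?g (@?u x) ?v ?w) =>
        apply (@lin_comp _ _ _ _ (fun y => g y v w) u (tril1 H v w)); lin_tac
    | H : tril ?g |- lin (fun x => ?g ?v (@?u x) ?w) =>
        apply (@lin_comp _ _ _ _ (fun y => g v y w) u (tril2 H v w)); lin_tac
    | H : tril ?g |- lin (fun x => ?g ?v ?w (@?u x)) =>
        apply (@lin_comp _ _ _ _ (g v w) u (tril3 H v w)); lin_tac
    | |- lin (fun x => sweedler ?t (fun a b => @?f x a b)) =>
        apply (@lin_swr _ _ _ _ _ _ t (fun a b x => f x a b)); cbn beta; lin_tac
    | |- lin (fun x => sweedler (@?u x) ?f) =>
        apply (@lin_swl _ _ _ _ _ _ u f); cbn beta; lin_tac
    | |- lin (fun x => \sum_(i <- ?r | @?P i) @?f x i) =>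
        apply (@lin_bigsum _ _ _ _ r P (fun i x => f x i)); cbn beta; lin_tac
    end
  | match goal with
    | |- lin (fun x => ?g (@?u x)) =>
        apply (@lin_comp _ _ _ _ g u); [ lin_head | lin_tac ]
    | |- lin _ => lin_head
    end ]
with lin_head := first
  [ assumption
  | match goal with H : bil ?g |- lin (?g ?v) => exact (proj2 H v) end
  | solve [auto with lin]
  | apply lin_linear ].

Create HintDb lin.

(** * Weak Hopf algebras *)

Section Conjugation.
Variable R : realType.
Implicit Types x y : R[i].

Lemma cconjM x y : (x * y)^* = x^* * y^*.
Proof. exact: rmorphM. Qed.
Lemma cconjD x y : (x + y)^* = x^* + y^*.
Proof. exact: rmorphD. Qed.
Lemma cconjK x : x^*^* = x.
Proof. exact: conjCK. Qed.
Lemma cconj_sum I (r : seq I) (P : pred I) (F : I -> R[i]) :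
  (\sum_(i <- r | P i) F i)^* = \sum_(i <- r | P i) (F i)^*.
Proof. exact: rmorph_sum. Qed.

End Conjugation.

Section ConjugateModule.
Variables (R : realType) (Z : lmodType R[i]).

(* [Z] with scalars acting through conjugation: antilinear maps into [Z] are   *)
(* linear into [conj_mod], so that the tensor calculus applies to them.        *)
Definition conj_mod : Type := Z.
HB.instance Definition _ := GRing.Zmodule.on conj_mod.

Definition conj_scale (c : R[i]) (z : conj_mod) : conj_mod := c^* *: (z : Z).

Lemma conj_scaleA a b z : conj_scale a (conj_scale b z) = conj_scale (a * b) z.
Proof. by rewrite /conj_scale scalerA rmorphM. Qed.
Lemma conj_scale1 : left_id 1 conj_scale.
Proof. by move=> z; rewrite /conj_scale rmorph1 scale1r. Qed.
Lemma conj_scaleDr : right_distributive conj_scale +%R.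
Proof. by move=> a x y; rewrite /conj_scale [LHS]scalerDr. Qed.
Lemma conj_scaleDl z : {morph conj_scale^~ z : a b / a + b}.
Proof. by move=> a b; rewrite /conj_scale rmorphD [LHS]scalerDl. Qed.

HB.instance Definition _ := GRing.Zmodule_isLmodule.Build R[i] conj_mod
  conj_scaleA conj_scale1 conj_scaleDr conj_scaleDl.

Definition alin (U : lmodType R[i]) (f : U -> Z) : Prop :=
  @lin _ U conj_mod f.

Lemma alinZ (U : lmodType R[i]) (f : U -> Z) :
  alin f -> forall c x, f (c *: x) = c^* *: f x.
Proof. by move=> fL c x; exact: (linZ fL). Qed.

Lemma alin0 (U : lmodType R[i]) (f : U -> Z) : alin f -> f 0 = 0.
Proof. exact: lin0. Qed.

Lemma alin_sum (U : lmodType R[i]) (f : U -> Z) : alin f ->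
  forall I (r : seq I) (P : pred I) G,
  f (\sum_(i <- r | P i) G i) = \sum_(i <- r | P i) f (G i).
Proof. exact: lin_sum. Qed.

End ConjugateModule.

Section WeakHopfTheory.
Variables (R : realType) (A : falgType R[i]) (W : weakCstarHopf A).
Local Notation S := (antip W).
Local Notation eps := (counit W).
Local Notation st := (star W).
Local Notation "'\D_' ( a , b <- x ) F" := (sweedler (comul W x) (fun a b => F))
  (at level 41, F at level 41, a name, b name, x at level 35,
   format "'[' \D_ ( a ,  b  <-  x ) '/  '  F ']'").

Section Rules.
Variable Z : lmodType R[i].
Implicit Types f : A -> A -> Z.

Lemma D_lin f : bil f -> lin (fun x => \D_(a, b <- x) f a b).
Proof. by move=> fL; lin_tac. Qed.

Lemma D_mul f x y : bil f ->
  \D_(a, b <- x * y) f a b = \D_(a, b <- x) \D_(c, d <- y) f (a * c) (b * d).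
Proof.
move=> fL; have [f1 f2] := fL.
have tL : lin (fun t : A ⊗ A => sweedler t f) by apply: sw_lin.
rewrite comulM /tmul (lin_sw _ _ tL); apply: eq_sw => a b.
rewrite (lin_sw _ _ tL); apply: eq_sw => c d.
by rewrite sw_tens.
Qed.

Lemma D_star f x : bil f ->
  \D_(a, b <- st x) f a b = \D_(a, b <- x) f (st a) (st b).
Proof.
move=> fL; have tL : lin (fun t : A ⊗ A => sweedler t f) by apply: sw_lin.
rewrite comul_star /tstar (lin_sw _ _ tL); apply: eq_sw => a b.
by rewrite sw_tens.
Qed.

(** [g] and [k] are the maps that [f] induces on [(A ⊗ A) ⊗ A] and on [A ⊗ (A ⊗ A)]; [nat] says that
    [tassoc] carries one to the other, so that the axiom [comulA] applies. *)
Lemma D_assoc (f : A -> A -> A -> Z) x : tril f ->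
  \D_(a, b <- x) \D_(c, d <- a) f c d b = \D_(a, b <- x) \D_(c, d <- b) f a c d.
Proof.
move=> fL; have [f1 f2 f3] := fL.
pose g (u : A ⊗ A) b := sweedler u (fun c d => f c d b).
have gL : bil g by split=> z; rewrite /g; lin_tac; apply: f3.
have tL : lin (fun t : (A ⊗ A) ⊗ A => sweedler t g) by apply: sw_lin.
transitivity (sweedler (\D_(a, b <- x) (comul W a ⊗ b)) g).
  rewrite (lin_sw _ _ tL); apply: eq_sw => a b.
  by rewrite sw_tens.
rewrite comulA /tassoc.
pose k a (u : A ⊗ A) := sweedler u (fun b c => f a b c).
have kB : bil k by split=> z; rewrite /k; lin_tac.
have nat t : sweedler (sweedler t (fun a (u : A ⊗ A) =>
    sweedler u (fun b c => (a ⊗ b) ⊗ c))) g = sweedler t k.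
  rewrite (lin_sw _ _ tL); apply: eq_sw => a u.
  rewrite (lin_sw _ _ tL); apply: eq_sw => b c.
  by rewrite sw_tens // /g sw_tens.
rewrite nat (lin_sw (g := fun t : A ⊗ (A ⊗ A) => sweedler t k)); last exact: sw_lin.
by apply: eq_sw => a b; rewrite sw_tens.
Qed.

Lemma D_unit (f : A -> A -> A -> Z) : tril f ->
  \D_(a, b <- 1) \D_(c, d <- 1) f a (b * c) d =
  \D_(a, b <- 1) \D_(c, d <- a) f c d b.
Proof.
move=> fL; have [f1 f2 f3] := fL.
pose g (u : A ⊗ A) b := sweedler u (fun c d => f c d b).
have gL : bil g by split=> z; rewrite /g; lin_tac; apply: f3.
have tL : lin (fun t : (A ⊗ A) ⊗ A => sweedler t g) by apply: sw_lin.
transitivity (sweedler (\D_(a, b <- 1) (comul W a ⊗ b)) g); last first.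
  rewrite (lin_sw _ _ tL); apply: eq_sw => a b.
  by rewrite sw_tens.
rewrite -comul1 (lin_sw _ _ tL); apply: eq_sw => a b.
rewrite (lin_sw _ _ tL); apply: eq_sw => c d.
by rewrite sw_tens // /g sw_tens.
Qed.

Lemma D_counitl (f : A -> Z) x : lin f -> \D_(a, b <- x) (eps a *: f b) = f x.
Proof.
move=> fL; rewrite -[in RHS](counitl W x) (lin_sw _ _ fL).
by apply: eq_sw => a b; rewrite linZ.
Qed.

Lemma D_counitr (f : A -> Z) x : lin f -> \D_(a, b <- x) (eps b *: f a) = f x.
Proof.
move=> fL; rewrite -[in RHS](counitr W x) (lin_sw _ _ fL).
by apply: eq_sw => a b; rewrite linZ.
Qed.

End Rules.

Lemma lin_counit : lin eps. Proof. exact: lin_linear. Qed.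
Lemma lin_antip : lin S. Proof. exact: lin_linear. Qed.

Lemma star1 : st 1 = 1.
Proof.
rewrite -[RHS](star_invol (starP W)) -{2}[st 1]mul1r (star_mul (starP W)).
by rewrite (star_invol (starP W)) mul1r.
Qed.

Lemma starK : involutive st.
Proof. exact: (star_invol (starP W)). Qed.

Lemma starM x y : st (x * y) = st y * st x.
Proof. exact: (star_mul (starP W)). Qed.

Lemma alin_star : alin (st : A -> A).
Proof. exact: (star_semilinear (starP W)). Qed.

Lemma starD : {morph st : x y / x + y}.
Proof. exact: (linD alin_star). Qed.

Lemma starZ c x : st (c *: x) = c^* *: st x.
Proof. exact: (linZ alin_star). Qed.

Lemma star0 : st 0 = 0.
Proof. exact: (lin0 alin_star). Qed.

Lemma star_sum I (r : seq I) (P : pred I) G :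
  st (\sum_(i <- r | P i) G i) = \sum_(i <- r | P i) st (G i).
Proof. exact: (lin_sum alin_star). Qed.

Lemma star_sw (t : A ⊗ A) f :
  st (sweedler t f) = sweedler t (fun a b => st (f a b)).
Proof. exact: star_sum. Qed.

Lemma lin_conj_star (Z : lmodType R[i]) (f : A -> Z) :
  lin f -> @lin _ A (conj_mod Z) (fun x => f (st x)).
Proof. by move=> fL c x y; rewrite starD starZ fL. Qed.

(** Apply the involution to [D_unit]: it fixes [Δ(1)] and reverses the middle product. As [f]
    composed with [st] is antilinear, the identity is used with values in [conj_mod Z]. *)
Lemma D_unit_star (Z : lmodType R[i]) (f : A -> A -> A -> Z) : tril f ->
  \D_(a, b <- 1) \D_(c, d <- 1) f a (c * b) d =
  \D_(a, b <- 1) \D_(c, d <- a) f c d b.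
Proof.
move=> fL; have [f1 f2 f3] := fL.
pose g a b c : conj_mod Z := f (st a) (st b) (st c).
have gL : tril g.
  by split=> y z; [apply: (lin_conj_star (f1 _ _)) | apply: (lin_conj_star (f2 _ _))
    | apply: (lin_conj_star (f3 _ _))].
transitivity (\D_(a, b <- 1) \D_(c, d <- 1) g a (b * c) d).
  rewrite -[in LHS]star1 D_star; last by lin_tac.
  apply: eq_sw => a b; rewrite D_star; last by lin_tac.
  by apply: eq_sw => c d; rewrite /g starM.
rewrite (D_unit gL) -[in RHS]star1 [RHS]D_star; last by lin_tac.
by apply: eq_sw => a b; rewrite [RHS]D_star; last by lin_tac.
Qed.

Lemma D_unit_comm (Z : lmodType R[i]) (f : A -> A -> A -> Z) : tril f ->
  \D_(a, b <- 1) \D_(c, d <- 1) f a (c * b) d =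
  \D_(a, b <- 1) \D_(c, d <- 1) f a (b * c) d.
Proof. by move=> fL; rewrite D_unit_star // D_unit. Qed.

(** A left counit and a right counit coincide: [e] is a left counit, and the sum of
    [e(x_1) eps(x_2)] is [eps x] as well as [e x]. *)
Lemma counit_star x : eps (st x) = (eps x)^*.
Proof.
pose e y : R[i]^o := (eps (st y))^*.
have eL : lin e.
  by move=> c y z; rewrite /e starD starZ linearP cconjD cconjM cconjK.
have e_id y : \D_(a, b <- y) (e a *: b) = y.
  rewrite -[RHS]starK -[st y](counitl W) D_star; last by lin_tac.
  by rewrite star_sw; apply: eq_sw => a b; rewrite starZ starK.
suff -> : eps x = e x by rewrite /e cconjK.
rewrite -{1}[x]e_id (lin_sw _ _ (lin_linear eps)) -[in RHS](counitr W x).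
rewrite (lin_sw _ _ eL); apply: eq_sw => a b.
by rewrite linearZ (linZ eL) [LHS]mulrC.
Qed.

(** The adjoint of the axiom [counitM]: the involution reverses the triple product, which exchanges
    the legs of [y]. *)
Lemma counit_mul_rev x y z :
  eps (x * y * z) = \D_(a, b <- y) (eps (x * b) * eps (a * z)).
Proof.
have cK u : eps u = (eps (st u))^* by rewrite -counit_star starK.
rewrite [LHS]cK !starM mulrA (counitM W) (_ : sweedler _ _ =
   \D_(a, b <- y) ((eps (st z * st a) : R[i]^o) * eps (st b * st x))); last first.
  by rewrite (@D_star R[i]^o (fun a b => eps (st z * a) * eps (b * st x)));
    last by lin_tac.
rewrite /sweedler cconj_sum; apply: eq_bigr => p _.
by rewrite cconjM -!counit_star !starM !starK mulrC.
Qed.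

Lemma counit_mul1_rev x z :
  eps (x * z) = \D_(a, b <- 1) (eps (x * b) * eps (a * z)).
Proof. by rewrite -[x in LHS]mulr1 counit_mul_rev. Qed.

Fact Pi_key : unit. Proof. by []. Qed.

(* Locked, so that matching does not unfold them to sums. *)
Definition PiL x : A := locked_with Pi_key (\D_(a, b <- x) (a * S b)).
Definition PiR x : A := locked_with Pi_key (\D_(a, b <- x) (S a * b)).

Lemma PiL_def x : PiL x = \D_(a, b <- x) (a * S b).
Proof. by rewrite /PiL unlock. Qed.
Lemma PiR_def x : PiR x = \D_(a, b <- x) (S a * b).
Proof. by rewrite /PiR unlock. Qed.

Lemma PiLE x : PiL x = \D_(a, b <- 1) (eps (a * x) *: b).
Proof. by rewrite PiL_def antipr. Qed.
Lemma PiRE x : PiR x = \D_(a, b <- 1) (eps (x * b) *: a).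
Proof. by rewrite PiR_def antipl. Qed.

Lemma lin_PiL : lin PiL.
Proof.
by move=> c x y; rewrite !PiL_def (D_lin (f := fun a b => a * S b)) //; lin_tac.
Qed.
Lemma lin_PiR : lin PiR.
Proof.
by move=> c x y; rewrite !PiR_def (D_lin (f := fun a b => S a * b)) //; lin_tac.
Qed.
Hint Resolve lin_PiL lin_PiR : lin.

Lemma lin_hom (f : A -> R[i]^o) :
  lin f -> exists phi : 'Hom(A, R[i]^o), forall x, phi x = f x.
Proof.
move=> fL; pose g : {linear A -> R[i]^o} := HB.pack f (GRing.isLinear.Build _ _ _ _ f fL).
by exists (linfun g) => x; rewrite (lfunE g).
Qed.

(** The second counital subalgebra. [Δ(1)] lies in [A_R ⊗ A_L], [PiR] and [PiL] project onto the two
    factors, and these commute with each other ([A_L_A_R_comm]). *)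
Definition A_R (r : A) : Prop :=
  exists phi : 'Hom(A, R[i]^o), r = \D_(x, y <- 1) (phi y *: x).

Lemma A_L_intro (f : A -> R[i]^o) : lin f -> A_L W (\D_(a, b <- 1) (f a *: b)).
Proof.
by move=> /lin_hom[phi phiE]; exists phi; apply: eq_sw => a b; rewrite phiE.
Qed.

Lemma A_R_intro (f : A -> R[i]^o) : lin f -> A_R (\D_(a, b <- 1) (f b *: a)).
Proof.
by move=> /lin_hom[phi phiE]; exists phi; apply: eq_sw => a b; rewrite phiE.
Qed.

Lemma A_L_PiL x : A_L W (PiL x).
Proof. by rewrite PiLE; apply: (@A_L_intro (fun a => eps (a * x))); lin_tac. Qed.

Lemma A_R_PiR x : A_R (PiR x).
Proof. by rewrite PiRE; apply: (@A_R_intro (fun a => eps (x * a))); lin_tac. Qed.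

Section UnitDecomposition.
Variable Z : lmodType R[i].
Implicit Types f : A -> A -> Z.

(** With [b = phi(1_1) 1_2], coassociativity turns [Δ(b)] into [phi(1_1) 1_2 ⊗ 1_3], and the unit
    axiom splits the three legs into two copies of [Δ(1)]. The variants below change the order of
    the middle product or the side. *)
Lemma D_A_L b f : A_L W b -> bil f ->
  \D_(c, d <- b) f c d = \D_(c, d <- 1) f (b * c) d.
Proof.
case=> phi -> fL; have [f1 f2] := fL.
rewrite (lin_sw (g := fun x => \D_(c, d <- x) f c d)); last by lin_tac.
under [RHS]eq_sw => c d do rewrite sw_mulr (lin_sw _ _ (f1 d)).
rewrite swap_sw.
transitivity (\D_(a, x <- 1) \D_(c, d <- x) (phi a *: f c d)).
  apply: eq_sw => x y; rewrite (linZ (f := fun x => \D_(c, d <- x) f c d)) ?sw_scaler //.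
  by lin_tac.
rewrite -(@D_assoc _ (fun a c d => phi a *: f c d)); last by lin_tac.
rewrite -(@D_unit _ (fun a c d => phi a *: f c d)); last by lin_tac.
by apply: eq_sw => x y; apply: eq_sw => c d; rewrite -scalerAl (linZ (f1 d)).
Qed.

Lemma D_A_L_comm b f : A_L W b -> bil f ->
  \D_(c, d <- b) f c d = \D_(c, d <- 1) f (c * b) d.
Proof.
move=> bL fL; rewrite D_A_L //; have [f1 f2] := fL; case: bL => phi ->.
under [LHS]eq_sw => c d do rewrite sw_mulr (lin_sw _ _ (f1 d)).
under [RHS]eq_sw => c d do rewrite sw_mull (lin_sw _ _ (f1 d)).
rewrite swap_sw [RHS]swap_sw.
under [LHS]eq_sw => u v do under eq_sw => c d do rewrite -scalerAl (linZ (f1 d)).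
under [RHS]eq_sw => u v do under eq_sw => c d do rewrite -scalerAr (linZ (f1 d)).
by rewrite (@D_unit_comm _ (fun a c d => phi a *: f c d)); last by lin_tac.
Qed.

Lemma D_A_R r f : A_R r -> bil f ->
  \D_(c, d <- r) f c d = \D_(c, d <- 1) f c (d * r).
Proof.
case=> phi -> fL; have [f1 f2] := fL.
rewrite (lin_sw (g := fun x => \D_(c, d <- x) f c d)); last by lin_tac.
under [RHS]eq_sw => c d do rewrite sw_mull (lin_sw _ _ (f2 c)).
transitivity (\D_(a, x <- 1) \D_(c, d <- a) (phi x *: f c d)).
  apply: eq_sw => x y; rewrite (linZ (f := fun x => \D_(c, d <- x) f c d)) ?sw_scaler //.
  by lin_tac.
rewrite -(@D_unit _ (fun a c d => phi d *: f a c)); last by lin_tac.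
by apply: eq_sw => x y; apply: eq_sw => c d; rewrite -scalerAr (linZ (f2 x)).
Qed.

Lemma D_A_R_comm r f : A_R r -> bil f ->
  \D_(c, d <- r) f c d = \D_(c, d <- 1) f c (r * d).
Proof.
move=> rR fL; rewrite D_A_R //; have [f1 f2] := fL; case: rR => phi ->.
under [LHS]eq_sw => c d do rewrite sw_mull (lin_sw _ _ (f2 c)).
under [RHS]eq_sw => c d do rewrite sw_mulr (lin_sw _ _ (f2 c)).
under [LHS]eq_sw => u v do under eq_sw => c d do rewrite -scalerAr (linZ (f2 u)).
under [RHS]eq_sw => u v do under eq_sw => c d do rewrite -scalerAl (linZ (f2 u)).
by rewrite -(@D_unit_comm _ (fun a c d => phi d *: f a c)); last by lin_tac.
Qed.

End UnitDecomposition.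

Lemma PiL_1 : PiL 1 = 1.
Proof. by rewrite PiLE; under eq_sw => a b do rewrite mulr1; rewrite counitl. Qed.

Lemma PiR_1 : PiR 1 = 1.
Proof. by rewrite PiRE; under eq_sw => a b do rewrite mul1r; rewrite counitr. Qed.

Lemma PiL_A_L b : A_L W b -> PiL b = b.
Proof.
move=> bL; rewrite PiL_def D_A_L //; last by lin_tac.
by under eq_sw => c d do rewrite -mulrA; rewrite -sw_mull -PiL_def PiL_1 mulr1.
Qed.

Lemma PiR_A_R r : A_R r -> PiR r = r.
Proof.
move=> rR; rewrite PiR_def D_A_R //; last by lin_tac.
by under eq_sw => c d do rewrite mulrA; rewrite -sw_mulr -PiR_def PiR_1 mul1r.
Qed.

Section MoreRules.
Variable Z : lmodType R[i].
Implicit Types f : A -> A -> Z.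

Lemma D_1l f x : bil f ->
  \D_(a, b <- 1) \D_(c, d <- x) f (a * c) (b * d) = \D_(c, d <- x) f c d.
Proof. by move=> fL; rewrite -D_mul // mul1r. Qed.

Lemma D_1r f x : bil f ->
  \D_(c, d <- x) \D_(a, b <- 1) f (c * a) (d * b) = \D_(c, d <- x) f c d.
Proof. by move=> fL; rewrite -D_mul // mulr1. Qed.

Lemma D_PiL f x : bil f ->
  \D_(a, b <- x) f a (PiL b) = \D_(c, d <- 1) f (c * x) d.
Proof.
move=> fL; have [f1 f2] := fL.
pose G a b c := \D_(p, q <- x) (eps (b * q) *: f (a * p) c).
have GL : tril G.
  by split=> u v; rewrite /G; lin_tac.
transitivity (\D_(a, b <- 1) \D_(c, d <- 1) G a (c * b) d); last first.
  rewrite D_unit_star //; apply: eq_sw => c d.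
  rewrite /G -(@D_mul Z (fun p q => eps q *: f p d)); last by lin_tac.
  by rewrite (@D_counitr _ (fun p => f p d)).
rewrite swap_sw.
transitivity (\D_(c, d <- 1) \D_(p, q <- x) (eps (c * q) *: f p d)).
  rewrite swap_sw; apply: eq_sw => a b.
  rewrite PiLE (lin_sw _ _ (f2 a)); apply: eq_sw => c d.
  by rewrite (linZ (f2 a)).
apply: eq_sw => c d; rewrite /G.
rewrite -(@D_1l (fun p q => eps (c * q) *: f p d)); last by lin_tac.
by apply: eq_sw => a b; apply: eq_sw => p q; rewrite mulrA.
Qed.

Lemma D_PiR f x : bil f ->
  \D_(a, b <- x) f (PiR a) b = \D_(c, d <- 1) f c (x * d).
Proof.
move=> fL; have [f1 f2] := fL.
pose G a b c := \D_(p, q <- x) (eps (p * b) *: f a (q * c)).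
have GL : tril G.
  by split=> u v; rewrite /G; lin_tac.
transitivity (\D_(a, b <- 1) \D_(c, d <- 1) G a (c * b) d); last first.
  rewrite D_unit_star // D_assoc //; apply: eq_sw => c d.
  rewrite /G swap_sw.
  transitivity (\D_(p, q <- x * d) (eps p *: f c q)).
    by rewrite D_mul; last by lin_tac.
  by rewrite (@D_counitl _ (f c)).
transitivity (\D_(a, b <- 1) \D_(p, q <- x) (eps (p * b) *: f a q)).
  rewrite swap_sw; apply: eq_sw => a b.
  rewrite PiRE (lin_sw _ _ (f1 b)); apply: eq_sw => c d.
  by rewrite (linZ (f1 b)).
apply: eq_sw => a b; rewrite /G swap_sw.
rewrite -(@D_1r (fun p q => eps (p * b) *: f a q)); last by lin_tac.
by apply: eq_sw => c d; apply: eq_sw => p q; rewrite mulrA.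
Qed.

(** [Δ(1)] is fixed by [PiR ⊗ PiL], so its legs may be treated as elements of [A_R] and [A_L],
    although those of the chosen decomposition need not lie there. *)
Lemma D_1_eq f g : bil f -> bil g ->
  (forall r b, A_R r -> A_L W b -> f r b = g r b) ->
  \D_(a, b <- 1) f a b = \D_(a, b <- 1) g a b.
Proof.
have norm (k : A -> A -> Z) : bil k ->
  \D_(a, b <- 1) k a b = \D_(a, b <- 1) k (PiR a) (PiL b).
  move=> kL; have [k1 k2] := kL.
  rewrite (@D_PiL (fun a b => k (PiR a) b)); last by lin_tac.
  transitivity (\D_(a, b <- 1) k (PiR a) b); last first.
    by apply: eq_sw => a b; rewrite mulr1.
  by rewrite D_PiR //; apply: eq_sw => a b; rewrite mul1r.
move=> fL gL fg; rewrite norm // [RHS]norm //; apply: eq_sw => a b.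
by apply: fg; [exact: A_R_PiR | exact: A_L_PiL].
Qed.

(** [Δ(b)] is a multiple of [Δ(1)] in its first leg, and [Δ(1)] is absorbed by [Δ(x)]. In the same
    way factors from [A_R] pass into the second leg. *)
Lemma D_mulLl b x f : A_L W b -> bil f ->
  \D_(c, d <- b * x) f c d = \D_(c, d <- x) f (b * c) d.
Proof.
move=> bL fL; have [f1 f2] := fL; rewrite D_mul // (D_A_L bL); last by lin_tac.
rewrite -(@D_1l (fun c d => f (b * c) d)); last by lin_tac.
by apply: eq_sw => p q; apply: eq_sw => c d; rewrite mulrA.
Qed.

Lemma D_mulLr b x f : A_L W b -> bil f ->
  \D_(c, d <- x * b) f c d = \D_(c, d <- x) f (c * b) d.
Proof.
move=> bL fL; have [f1 f2] := fL; rewrite D_mul // swap_sw (D_A_L_comm bL);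
  last by lin_tac.
rewrite -(@D_1r (fun c d => f (c * b) d)); last by lin_tac.
rewrite [RHS]swap_sw.
by apply: eq_sw => p q; apply: eq_sw => c d; rewrite mulrA.
Qed.

Lemma D_mulRl r x f : A_R r -> bil f ->
  \D_(c, d <- r * x) f c d = \D_(c, d <- x) f c (r * d).
Proof.
move=> rR fL; have [f1 f2] := fL; rewrite D_mul // (D_A_R_comm rR); last by lin_tac.
rewrite -(@D_1l (fun c d => f c (r * d))); last by lin_tac.
by apply: eq_sw => p q; apply: eq_sw => c d; rewrite mulrA.
Qed.

Lemma D_mulRr r x f : A_R r -> bil f ->
  \D_(c, d <- x * r) f c d = \D_(c, d <- x) f c (d * r).
Proof.
move=> rR fL; have [f1 f2] := fL; rewrite D_mul // swap_sw (D_A_R rR);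
  last by lin_tac.
rewrite -(@D_1r (fun c d => f c (d * r))); last by lin_tac.
rewrite [RHS]swap_sw.
by apply: eq_sw => p q; apply: eq_sw => c d; rewrite mulrA.
Qed.

End MoreRules.

End WeakHopfTheory.

(** * The antipode *)

Section Antipode.
Variables (R : realType) (A : falgType R[i]) (W : weakCstarHopf A).
Local Notation S := (antip W).
Local Notation eps := (counit W).
Local Notation PiL := (PiL W).
Local Notation PiR := (PiR W).
Local Notation A_L := (A_L W).
Local Notation A_R := (A_R W).
Local Notation "'\D_' ( a , b <- x ) F" := (sweedler (comul W x) (fun a b => F))
  (at level 41, F at level 41, a name, b name, x at level 35,
   format "'[' \D_ ( a ,  b  <-  x ) '/  '  F ']'").
Hint Resolve lin_PiL lin_PiR : lin.

Lemma PiL_mull x : \D_(a, b <- x) (PiL a * b) = x.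
Proof.
under eq_sw => a b do rewrite PiLE sw_mulr.
rewrite swap_sw -[RHS](counitl W x) -(@D_1l _ _ _ _ (fun a b => eps a *: b));
  last by lin_tac.
by apply: eq_sw => c d; apply: eq_sw => a b; rewrite -scalerAl.
Qed.

Lemma PiR_S x : \D_(a, b <- x) (PiR a * S b) = S x.
Proof.
by rewrite -[RHS](antipS W); apply: eq_sw => a b; rewrite PiR_def sw_mulr.
Qed.

Lemma S_PiL x : \D_(a, b <- x) (S a * PiL b) = S x.
Proof.
rewrite -[RHS](antipS W) (@D_assoc _ _ _ _ (fun c d b => S c * d * S b));
  last by lin_tac.
by apply: eq_sw => a b; rewrite PiL_def sw_mull; apply: eq_sw => c d; rewrite mulrA.
Qed.

Lemma counit_PiL z y : eps (z * PiL y) = eps (z * y).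
Proof.
rewrite [RHS](counit_mul1_rev W) PiLE sw_mull (lin_sw _ _ (lin_counit W)).
by apply: eq_sw => a b; rewrite -scalerAr linearZ [LHS]mulrC.
Qed.

Lemma counit_PiR z y : eps (PiR z * y) = eps (z * y).
Proof.
rewrite [RHS](counit_mul1_rev W) PiRE sw_mulr (lin_sw _ _ (lin_counit W)).
by apply: eq_sw => a b; rewrite -scalerAl linearZ.
Qed.

(** Both products are slices of the same threefold expression, whose two middle orders agree by
    [D_unit_comm]. *)
Lemma A_L_A_R_comm b r : A_L b -> A_R r -> b * r = r * b.
Proof.
case=> phi -> [psi ->].
rewrite sw_mulr [RHS]sw_mull.
under [LHS]eq_sw => u v do rewrite sw_mull.
under [RHS]eq_sw => u v do rewrite sw_mulr.
have := @D_unit_comm _ _ W _ (fun u v w => (phi u * psi w) *: v).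
move=> H; transitivity (\D_(a, b <- 1) \D_(c, d <- 1) ((phi a * psi d) *: (b * c))).
  by apply: eq_sw => u v; apply: eq_sw => c d; rewrite -scalerAl -scalerAr scalerA.
rewrite -H; last by lin_tac.
by apply: eq_sw => u v; apply: eq_sw => c d; rewrite -scalerAl -scalerAr scalerA mulrC.
Qed.

Lemma PiL_mulPiL x y : PiL (x * PiL y) = PiL (x * y).
Proof.
by rewrite PiLE [RHS]PiLE; apply: eq_sw => a b; rewrite mulrA counit_PiL mulrA.
Qed.

Lemma PiR_mulPiR x y : PiR (PiR x * y) = PiR (x * y).
Proof.
by rewrite PiRE [RHS]PiRE; apply: eq_sw => a b; rewrite -[PiR x * y * b]mulrA counit_PiR mulrA.
Qed.

(** This exhibits [S y * S x] as a right convolution inverse of the product, up to [PiL]. The inner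
    sum is [PiL y], which [D_mulLr] absorbs into the first leg of [x]; [PiL_mulPiL] then drops the
    inner projection. *)
Lemma antip_convl x y :
  \D_(a, b <- x) \D_(c, d <- y) (a * c * (S d * S b)) = PiL (x * y).
Proof.
rewrite -PiL_mulPiL [RHS]PiL_def (D_mulLr _ (A_L_PiL W y)); last by lin_tac.
apply: eq_sw => a b; rewrite PiL_def sw_mull sw_mulr; apply: eq_sw => c d.
by rewrite !mulrA.
Qed.

Lemma antip_convr x y :
  \D_(a, b <- x) \D_(c, d <- y) (S c * S a * (b * d)) = PiR (x * y).
Proof.
rewrite -PiR_mulPiR swap_sw [RHS]PiR_def [RHS](D_mulRl _ (A_R_PiR W x));
  last by lin_tac.
apply: eq_sw => a b; rewrite PiR_def sw_mulr sw_mull; apply: eq_sw => c d.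
by rewrite !mulrA.
Qed.

(* Both [x, y |-> S (x y)] and [x, y |-> S y S x] are generalized inverses of  *)
(* the product for convolution, with the same left and right supports.        *)
Lemma antipM x y : S (x * y) = S y * S x.
Proof.
rewrite -S_PiL D_mul; last by lin_tac.
transitivity (\D_(a, b <- x) \D_(c, d <- y) (PiR (a * c) * (S d * S b))).
  transitivity (\D_(a, b <- x) \D_(p, q <- b) \D_(c, d <- y) \D_(s, t <- d)
                  (S (a * c) * (p * s * (S t * S q)))).
    apply: eq_sw => a b; rewrite [RHS]swap_sw; apply: eq_sw => c d.
    rewrite -antip_convl sw_mull; apply: eq_sw => p q.
    by rewrite sw_mull.
  rewrite -(@D_assoc _ _ _ _ (fun a p q => \D_(c, d <- y) \D_(s, t <- d)
                  (S (a * c) * (p * s * (S t * S q))))); last by lin_tac.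
  apply: eq_sw => a b.
  transitivity (\D_(p, q <- a) \D_(c, d <- y) \D_(s, t <- c)
                  (S (p * s) * (q * t * (S d * S b)))).
    apply: eq_sw => p q.
    by rewrite -(@D_assoc _ _ _ _ (fun c s t =>
         S (p * c) * (q * s * (S t * S b)))); last by lin_tac.
  rewrite swap_sw; apply: eq_sw => c d.
  rewrite [in RHS]PiR_def D_mul; last by lin_tac.
  rewrite sw_mulr; apply: eq_sw => p q; rewrite sw_mulr; apply: eq_sw => s t.
  by rewrite !mulrA.
transitivity (\D_(a, b <- x) \D_(c, d <- y) \D_(s, t <- c)
    (S s * PiR a * (t * (S d * S b)))).
  apply: eq_sw => a b; apply: eq_sw => c d.
  rewrite -antip_convr swap_sw sw_mulr; apply: eq_sw => s t.
  rewrite sw_mulr [in RHS]PiR_def sw_mull sw_mulr; apply: eq_sw => p q.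
  by rewrite !mulrA.
transitivity (\D_(a, b <- x) \D_(c, d <- y) (S c * PiL d * (PiR a * S b))).
  apply: eq_sw => a b.
  rewrite (@D_assoc _ _ _ _ (fun s t d => S s * PiR a * (t * (S d * S b))));
    last by lin_tac.
  apply: eq_sw => c d.
  (* Exchanging the commuting factors [PiL d] and [PiR a] is what separates the legs of [x] from
     those of [y]. *)
  have -> : S c * PiL d * (PiR a * S b) = S c * PiR a * (PiL d * S b).
    rewrite mulrA -[S c * _ * PiR a]mulrA.
    by rewrite (A_L_A_R_comm (A_L_PiL W d) (A_R_PiR W a)) !mulrA.
  by rewrite [in RHS]PiL_def [X in _ = _ * X]sw_mulr sw_mull; apply: eq_sw => p q; rewrite !mulrA.
rewrite swap_sw -(S_PiL y) sw_mulr; apply: eq_sw => c d.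
by rewrite -sw_mull PiR_S.
Qed.

(** [Δ(r)] is [1_1 ⊗ r 1_2], so [PiL r] is [1_1 S(1_2) S(r)], where the first two factors sum to
    1. *)
Lemma antip_A_R r : A_R r -> S r = PiL r.
Proof.
move=> rR; rewrite PiL_def (D_A_R_comm rR); last by lin_tac.
under eq_sw => c d do rewrite antipM mulrA.
by rewrite -sw_mulr -PiL_def PiL_1 mul1r.
Qed.

Lemma antip_A_L b : A_L b -> S b = PiR b.
Proof.
move=> bL; rewrite PiR_def (D_A_L_comm bL); last by lin_tac.
under eq_sw => c d do rewrite antipM -mulrA.
by rewrite -sw_mull -PiR_def PiR_1 mulr1.
Qed.

Lemma A_R_antip b : A_L b -> A_R (S b).
Proof. by move=> bL; rewrite antip_A_L //; exact: A_R_PiR. Qed.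

Lemma A_L_antip r : A_R r -> A_L (S r).
Proof. by move=> rR; rewrite antip_A_R //; exact: A_L_PiL. Qed.

(** On the legs of [Δ(1)] the antipode acts as [PiR] and [PiL]. Expanding these gives three copies
    of [Δ(1)], two of which are joined by [counitM]. *)
Lemma D_antip1 (Z : lmodType R[i]) (f : A -> A -> Z) : bil f ->
  \D_(a, b <- 1) f (S b) (S a) = \D_(a, b <- 1) f a b.
Proof.
move=> fL; have [f1 f2] := fL.
transitivity (\D_(a, b <- 1) f (PiR b) (PiL a)).
  apply: D_1_eq => [||r b rR bL]; [by lin_tac | by lin_tac |].
  by rewrite (antip_A_L bL) (antip_A_R rR).
transitivity (\D_(p, q <- 1) \D_(s, t <- 1) \D_(a, b <- 1)
    ((eps (s * a) * eps (b * q)) *: f p t)).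
  under [LHS]eq_sw => a b.
    rewrite PiRE (lin_sw _ _ (f1 _)).
    under eq_sw => p q do rewrite (linZ (f1 _)) PiLE (lin_sw _ _ (f2 _)) sw_scaler.
    over.
  rewrite [LHS]swap_sw; apply: eq_sw => p q.
  rewrite [LHS]swap_sw; apply: eq_sw => s t.
  by apply: eq_sw => a b; rewrite (linZ (f2 _)) scalerA mulrC.
transitivity (\D_(p, q <- 1) f p (PiL q)).
  apply: eq_sw => p q; rewrite PiLE (lin_sw _ _ (f2 _)); apply: eq_sw => s t.
  by rewrite (linZ (f2 _)) -sw_scalel -(counitM W) mulr1.
by rewrite D_PiL //; apply: eq_sw => a b; rewrite mulr1.
Qed.

(** The flipped [(S ⊗ S)Δ] is a right convolution inverse of [Δ] up to [Δ ∘ PiL]. Coassociativity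
    brings [v] and [S w] together into [PiL], which [D_PiL] trades for a copy of [Δ(1)]. *)
Lemma D_PiL_comul (Z : lmodType R[i]) (g : A -> A -> Z) x : bil g ->
  \D_(a, b <- x) \D_(u, v <- a) \D_(w, z <- b) g (u * S z) (v * S w) =
  \D_(a, b <- PiL x) g a b.
Proof.
move=> gL; have [g1 g2] := gL.
rewrite (D_A_L_comm (A_L_PiL W x) gL).
rewrite (@D_assoc _ _ _ _ (fun u v b => \D_(w, z <- b) g (u * S z) (v * S w)));
  last by lin_tac.
transitivity (\D_(u, b <- x) \D_(m, z <- b) g (u * S z) (PiL m)).
  apply: eq_sw => u b.
  rewrite -(@D_assoc _ _ _ _ (fun v w z => g (u * S z) (v * S w))); last by lin_tac.
  by apply: eq_sw => m z; rewrite PiL_def (lin_sw _ _ (g2 _)).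
rewrite -(@D_assoc _ _ _ _ (fun u m z => g (u * S z) (PiL m))); last by lin_tac.
transitivity (\D_(n, z <- x) \D_(c, d <- 1) g (c * n * S z) d).
  apply: eq_sw => n z.
  by rewrite (@D_PiL _ _ _ _ (fun u d => g (u * S z) d)); last by lin_tac.
rewrite swap_sw; apply: eq_sw => c d.
rewrite PiL_def sw_mull (lin_sw _ _ (g1 _)); apply: eq_sw => a b.
by rewrite mulrA.
Qed.

(** The coproduct version of the argument for [antipM]. Write [S x] as [S(x_1) PiL(x_2)], expand
    [Δ(PiL x_2)] by [D_PiL_comul], and contract [Δ(S(x_1) x_2)] to [Δ(PiR _)], which changes only
    the second leg of [Δ(1)]; then [PiR_S] and [D_antip1] finish. *)
Lemma D_antip (Z : lmodType R[i]) (f : A -> A -> Z) x : bil f ->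
  \D_(a, b <- S x) f a b = \D_(a, b <- x) f (S b) (S a).
Proof.
move=> fL; have [f1 f2] := fL.
rewrite -{1}[S x]S_PiL (lin_sw _ _ (D_lin W fL)).
transitivity (\D_(a, b <- x) \D_(u, v <- b) \D_(w, z <- v) \D_(p, q <- S a) \D_(s, t <- u)
    f (p * (s * S z)) (q * (t * S w))).
  apply: eq_sw => a b; rewrite D_mul //.
  transitivity (\D_(p, q <- S a) \D_(u, v <- b) \D_(w, z <- v) \D_(s, t <- u)
    f (p * (s * S z)) (q * (t * S w))).
    apply: eq_sw => p q.
    rewrite -(@D_PiL_comul _ (fun c d => f (p * c) (q * d))); last by lin_tac.
    by apply: eq_sw => u v; rewrite [LHS]swap_sw.
  rewrite [LHS]swap_sw; apply: eq_sw => u v; rewrite [LHS]swap_sw; exact: eq_sw.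
rewrite -(@D_assoc _ _ _ _ (fun a u v => \D_(w, z <- v) \D_(p, q <- S a) \D_(s, t <- u)
    f (p * (s * S z)) (q * (t * S w)))); last by lin_tac.
transitivity (\D_(a, b <- x) \D_(w, z <- b) \D_(p, q <- 1) f (p * S z) (q * PiR a * S w)).
  apply: eq_sw => a b; rewrite [LHS]swap_sw; apply: eq_sw => w z.
  rewrite -(@D_A_R _ _ _ _ (PiR a) (fun p q => f (p * S z) (q * S w)) (A_R_PiR W a));
    last by lin_tac.
  rewrite [in RHS]PiR_def (lin_sw (g := fun x => \D_(c, d <- x) f (c * S z) (d * S w)));
    last by lin_tac.
  apply: eq_sw => c d; rewrite D_mul; last by lin_tac.
  by apply: eq_sw => p q; apply: eq_sw => s t; rewrite !mulrA.
rewrite -(@D_assoc _ _ _ _ (fun a w z =>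
   \D_(p, q <- 1) f (p * S z) (q * PiR a * S w))); last by lin_tac.
transitivity (\D_(n, z <- x) \D_(p, q <- 1) f (p * S z) (q * S n)).
  apply: eq_sw => n z; rewrite [LHS]swap_sw; apply: eq_sw => p q.
  rewrite -(PiR_S n) sw_mull (lin_sw _ _ (f2 _)); apply: eq_sw => a w.
  by rewrite mulrA.
rewrite -(@D_1r _ _ _ _ (fun n z => f (S z) (S n))); last by lin_tac.
apply: eq_sw => n z.
rewrite -(@D_antip1 _ (fun p q => f (p * S z) (q * S n))); last by lin_tac.
by apply: eq_sw => p q; rewrite !antipM.
Qed.

Lemma counit_antip x : eps (S x) = eps x.
Proof.
rewrite -S_PiL (lin_sw _ _ (lin_counit W)).
under eq_sw => a b do rewrite counit_PiL.
rewrite -(lin_sw _ _ (lin_counit W)) -PiR_def -[PiR x]mulr1 counit_PiR.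
by rewrite mulr1.
Qed.

End Antipode.

(** * The inverse of the antipode *)

Section InverseAntipode.
Variables (R : realType) (A : falgType R[i]) (W : weakCstarHopf A).
Local Notation S := (antip W).
Local Notation eps := (counit W).
Local Notation st := (star W).
Local Notation PiL := (PiL W).
Local Notation PiR := (PiR W).
Local Notation A_L := (A_L W).
Local Notation A_R := (A_R W).
Local Notation "'\D_' ( a , b <- x ) F" := (sweedler (comul W x) (fun a b => F))
  (at level 41, F at level 41, a name, b name, x at level 35,
   format "'[' \D_ ( a ,  b  <-  x ) '/  '  F ']'").
Hint Resolve lin_PiL lin_PiR : lin.

Lemma A_L_linear c x y : A_L x -> A_L y -> A_L (c *: x + y).
Proof.
case=> phi -> [psi ->]; exists (c *: phi + psi).
rewrite sw_scaler /sweedler -big_split; apply: eq_bigr => p _ /=.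
by rewrite add_lfunE scale_lfunE scalerDl scalerA.
Qed.

Lemma A_L_1 : A_L 1.
Proof. by rewrite -(PiL_1 W); exact: A_L_PiL. Qed.

(** [Δ(x y)] is [x y 1_1 ⊗ 1_2], and applying the counit to the first leg displays [x * y] as a
    slice of [Δ(1)]. *)
Lemma A_L_mul x y : A_L x -> A_L y -> A_L (x * y).
Proof.
move=> xL yL; rewrite -[x * y](counitl W) (D_mulLl _ xL); last by lin_tac.
rewrite (D_A_L yL); last by lin_tac.
by apply: (@A_L_intro _ _ _ (fun a => eps (x * (y * a)))); lin_tac.
Qed.

Lemma lin_conj_comp (f : A -> R[i]^o) :
  lin f -> lin (fun a => (f (st a))^* : R[i]^o).
Proof. by move=> fL c x y; rewrite starD starZ fL cconjD cconjM cconjK. Qed.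

Lemma A_L_star x : A_L x -> A_L (st x).
Proof.
case=> phi ->; rewrite star_sw.
have pL : lin phi by exact: lin_linear.
have := A_L_intro W (lin_conj_comp pL).
rewrite -[in X in X -> _](star1 W) D_star; last by have := lin_conj_comp pL; lin_tac.
congr (A_L _); apply: eq_sw => a b.
by rewrite starZ starK.
Qed.

Lemma A_R_star x : A_R x -> A_R (st x).
Proof.
case=> phi ->; rewrite star_sw.
have pL : lin phi by exact: lin_linear.
have := A_R_intro W (lin_conj_comp pL).
rewrite -[in X in X -> _](star1 W) D_star; last by have := lin_conj_comp pL; lin_tac.
congr (A_R _); apply: eq_sw => a b.
by rewrite starZ starK.
Qed.

Definition antipi (x : A) : A := st (S (st x)).
Local Notation Si := antipi.

Lemma lin_antipi : lin Si.
Proof. by move=> c x y; rewrite /antipi !(starD, starZ, linearP) cconjK. Qed.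
Hint Resolve lin_antipi : lin.

Lemma antipiM x y : Si (x * y) = Si y * Si x.
Proof. by rewrite /antipi starM antipM starM. Qed.

Lemma D_star_star (f : A -> A -> A) x : bil f ->
  \D_(a, b <- x) st (f (st a) (st b)) = st (\D_(a, b <- st x) f a b).
Proof. by move=> fL; rewrite D_star // star_sw. Qed.

Lemma antipi_convl x : \D_(a, b <- x) (b * Si a) = \D_(a, b <- 1) (eps (b * x) *: a).
Proof.
transitivity (st (PiR (st x))).
  rewrite PiR_def -D_star_star; last by lin_tac.
  by apply: eq_sw => a b; rewrite starM starK.
rewrite PiRE -{1}(star1 W) D_star; last by lin_tac.
rewrite star_sw; apply: eq_sw => a b.
by rewrite starZ -counit_star starM !starK.
Qed.

Lemma antipi_convr x : \D_(a, b <- x) (Si b * a) = \D_(a, b <- 1) (eps (x * a) *: b).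
Proof.
transitivity (st (PiL (st x))).
  rewrite PiL_def -D_star_star; last by lin_tac.
  by apply: eq_sw => a b; rewrite starM starK.
rewrite PiLE -{1}(star1 W) D_star; last by lin_tac.
rewrite star_sw; apply: eq_sw => a b.
by rewrite starZ -counit_star starM !starK.
Qed.

(** Reversal of the coproduct by [S] reduces the sum to [antipi_convl] at [S x]. Replacing the legs
    of [Δ(1)] by their antipodes lets [counit_antip] remove [S] from the argument of the counit. *)
Lemma antip_antipi_convl x : \D_(a, b <- x) (S a * Si (S b)) = PiR x.
Proof.
rewrite -(@D_antip _ _ W _ (fun p q => q * Si p)); last by lin_tac.
rewrite antipi_convl -(D_antip1 W); last by lin_tac.
transitivity (\D_(a, b <- 1) (eps (x * a) *: PiR b)).
  apply: D_1_eq => [||r b rR bL]; [by lin_tac | by lin_tac |].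
  by rewrite -antipM counit_antip (antip_A_L bL).
rewrite PiRE; under eq_sw => a b do rewrite PiRE sw_scaler.
rewrite [LHS]swap_sw; apply: eq_sw => p q.
under eq_sw => a b do rewrite scalerA.
by rewrite -sw_scalel -(counitM W) mulr1.
Qed.

Lemma antip_antipi_convr x : \D_(a, b <- x) (Si (S a) * S b) = PiL x.
Proof.
rewrite -(@D_antip _ _ W _ (fun p q => Si q * p)); last by lin_tac.
rewrite antipi_convr -(D_antip1 W); last by lin_tac.
transitivity (\D_(a, b <- 1) (eps (b * x) *: PiL a)).
  apply: D_1_eq => [||r b rR bL]; [by lin_tac | by lin_tac |].
  by rewrite -antipM counit_antip (antip_A_R rR).
rewrite PiLE; under eq_sw => a b do rewrite PiLE sw_scaler.
rewrite [LHS]swap_sw; apply: eq_sw => p q.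
under eq_sw => a b do rewrite scalerA mulrC.
by rewrite -sw_scalel -(counitM W) mulr1.
Qed.

(** [Si (S x)] expands to [Si(S(x_1)) S(x_2) x_3]. The first two factors form [PiL], and
    [PiL(x_1) x_2] is [x]. *)
Lemma antipK : cancel S Si.
Proof.
move=> x.
transitivity (\D_(a, b <- S x) (Si b * st (PiR (st a)))).
  rewrite /antipi -(PiR_S W (st (S x))) D_star; last by lin_tac.
  by rewrite star_sw; apply: eq_sw => a b; rewrite starM.
have PiR'E y : st (PiR (st y)) = \D_(a, b <- y) (b * Si a).
  rewrite PiR_def -D_star_star; last by lin_tac.
  by apply: eq_sw => a b; rewrite starM starK.
under eq_sw => a b do rewrite PiR'E.
rewrite (@D_antip _ _ W _ (fun a b => Si b * \D_(c, d <- a) (d * Si c)));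
  last by lin_tac.
transitivity (\D_(a, b <- x) \D_(c, d <- b) (Si (S a) * S c * d)).
  apply: eq_sw => a b; rewrite (@D_antip _ _ W _ (fun p q => q * Si p));
    last by lin_tac.
  by rewrite antip_antipi_convl PiR_def sw_mull; apply: eq_sw => c d; rewrite mulrA.
rewrite -(@D_assoc _ _ _ _ (fun a c d => Si (S a) * S c * d)); last by lin_tac.
rewrite -[RHS](PiL_mull W); apply: eq_sw => a b.
by rewrite -antip_antipi_convr sw_mulr.
Qed.

Lemma antipiK : cancel Si S.
Proof. by move=> x; apply: (can_inj (starK W)); rewrite -[LHS]/(Si _) antipK. Qed.

Lemma antip_invE x : antip_inv W x = Si x.
Proof.
have S0 : lker S == 0%VS.
  by apply/lker0P; exact: can_inj antipK.
by rewrite /antip_inv -{1}[x]antipiK lker0_lfunK.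
Qed.

Lemma antip1 : S 1 = 1.
Proof. by rewrite -[LHS]mulr1 -{2}[1]antipiK -antipM mulr1 antipiK. Qed.

Lemma antipi1 : Si 1 = 1.
Proof. by rewrite -{1}antip1 antipK. Qed.

Lemma star_antip x : st (S x) = Si (st x).
Proof. by rewrite /antipi starK. Qed.

Lemma D_antipi (Z : lmodType R[i]) (f : A -> A -> Z) x : bil f ->
  \D_(a, b <- Si x) f a b = \D_(a, b <- x) f (Si b) (Si a).
Proof.
move=> fL; rewrite -{2}[x]antipiK [RHS]D_antip; last by lin_tac.
by apply: eq_sw => a b; rewrite !antipK.
Qed.

Lemma A_L_antipi r : A_R r -> A_L (Si r).
Proof. by move=> /A_R_star /A_L_antip /A_L_star. Qed.

Lemma A_R_antipi b : A_L b -> A_R (Si b).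
Proof. by move=> /A_L_star /A_R_antip /A_R_star. Qed.

Lemma antip_PiR x : S (PiR x) = PiL (S x).
Proof.
rewrite PiL_def D_antip; last by lin_tac.
by rewrite PiR_def (lin_sw _ _ (lin_antip W)); apply: eq_sw => a b; rewrite antipM.
Qed.

Lemma antip_PiL x : S (PiL x) = PiR (S x).
Proof.
rewrite PiR_def D_antip; last by lin_tac.
by rewrite PiL_def (lin_sw _ _ (lin_antip W)); apply: eq_sw => a b; rewrite antipM.
Qed.

Lemma antipi_PiL x : Si (PiL x) = \D_(a, b <- x) (b * Si a).
Proof.
rewrite PiL_def (lin_sw _ _ lin_antipi).
by apply: eq_sw => a b; rewrite antipiM antipK.
Qed.

Lemma antipi_PiR x : Si (PiR x) = \D_(a, b <- x) (Si b * a).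
Proof.
rewrite PiR_def (lin_sw _ _ lin_antipi).
by apply: eq_sw => a b; rewrite antipiM antipK.
Qed.

Lemma star_PiR x : st (PiR (st x)) = Si (PiL x).
Proof.
rewrite antipi_PiL PiR_def -D_star_star; last by lin_tac.
by apply: eq_sw => a b; rewrite starM starK.
Qed.

Lemma star_PiL x : st (PiL (st x)) = Si (PiR x).
Proof.
rewrite antipi_PiR PiL_def -D_star_star; last by lin_tac.
by apply: eq_sw => a b; rewrite starM starK.
Qed.

End InverseAntipode.

(** * Haar integrals *)

Section Integrals.
Variables (R : realType) (A : falgType R[i]) (W : weakCstarHopf A).
Local Notation S := (antip W).
Local Notation eps := (counit W).
Local Notation st := (star W).
Local Notation PiL := (PiL W).
Local Notation PiR := (PiR W).
Local Notation A_L := (A_L W).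
Local Notation A_R := (A_R W).
Local Notation Si := (antipi W).
Local Notation "'\D_' ( a , b <- x ) F" := (sweedler (comul W x) (fun a b => F))
  (at level 41, F at level 41, a name, b name, x at level 35,
   format "'[' \D_ ( a ,  b  <-  x ) '/  '  F ']'").
Hint Resolve lin_PiL lin_PiR lin_antipi : lin.

Lemma left_integralE l : left_integral (alg_ops W) l <-> forall a, a * l = PiL a * l.
Proof. by split=> H a; have := H a; rewrite /= PiL_def. Qed.

Lemma right_integralE r : right_integral (alg_ops W) r <-> forall a, r * a = r * PiR a.
Proof. by split=> H a; have := H a; rewrite /= PiR_def. Qed.

Lemma haar_integralE h : haar_integral (alg_ops W) h <->
  [/\ forall a, a * h = PiL a * h, forall a, h * a = h * PiR a, PiR h = 1 & PiL h = 1].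
Proof.
split=> [[/left_integralE hl /right_integralE hr h1 h2]|[hl hr h1 h2]].
  by rewrite PiL_def PiR_def.
split; [exact/left_integralE | exact/right_integralE | |].
  by move: h1; rewrite PiR_def.
by move: h2; rewrite PiL_def.
Qed.

(** Insert [Δ(1)] before [Δ(l)]; then [1_1 ⊗ x 1_2] becomes [S(x_1) x_2 ⊗ x_3], whose last two legs
    act on [Δ(l)] as [Δ(x_2 l) = Δ(PiL(x_2) l)]. [D_PiL] turns the projection into a copy of [Δ(1)],
    which contracts to [PiR 1]. [D_right_integral] is the mirror image. *)
Lemma D_left_integral (Z : lmodType R[i]) (f : A -> A -> Z) l x :
  left_integral (alg_ops W) l -> bil f ->
  \D_(a, b <- l) f a (x * b) = \D_(a, b <- l) f (S x * a) b.
Proof.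
move=> /left_integralE lI fL; have [f1 f2] := fL.
rewrite -(@D_1l _ _ W _ (fun a b => f a (x * b))); last by lin_tac.
transitivity (\D_(p, y <- x) \D_(a, b <- y * l) f (S p * a) b).
  under [LHS]eq_sw => c d do under eq_sw => a b do rewrite mulrA.
  rewrite -(@D_PiR _ _ W _ (fun c y => \D_(a, b <- l) f (c * a) (y * b)));
    last by lin_tac.
  transitivity (\D_(y, z <- x) \D_(p, q <- y) \D_(a, b <- l) f (S p * (q * a)) (z * b)).
    apply: eq_sw => y z; rewrite PiR_def.
    rewrite (lin_sw (g := fun c => \D_(a, b <- l) f (c * a) (z * b)));
      last by lin_tac.
    by apply: eq_sw => p q; apply: eq_sw => a b; rewrite mulrA.
  rewrite (@D_assoc _ _ W _ (fun p q z =>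
    \D_(a, b <- l) f (S p * (q * a)) (z * b))); last by lin_tac.
  by apply: eq_sw => p y; rewrite D_mul; last by lin_tac.
under eq_sw => p y do rewrite lI.
rewrite (@D_PiL _ _ W _ (fun p y => \D_(a, b <- y * l) f (S p * a) b));
  last by lin_tac.
transitivity (\D_(c, d <- 1) \D_(a, b <- l) f (S x * (S c * d) * a) b).
  apply: D_1_eq => [||r b rR bL]; [by lin_tac | by lin_tac |].
  rewrite (D_mulLl _ bL); last by lin_tac.
  by apply: eq_sw => a c; rewrite antipM !mulrA.
rewrite [LHS]swap_sw; apply: eq_sw => a b.
rewrite -(lin_sw (g := fun z => f (S x * z * a) b)); last by lin_tac.
by rewrite -PiR_def PiR_1 mulr1.
Qed.

Lemma D_right_integral (Z : lmodType R[i]) (f : A -> A -> Z) r x :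
  right_integral (alg_ops W) r -> bil f ->
  \D_(a, b <- r) f (a * x) b = \D_(a, b <- r) f a (b * S x).
Proof.
move=> /right_integralE rI fL; have [f1 f2] := fL.
rewrite -(@D_1r _ _ W _ (fun a b => f (a * x) b)); last by lin_tac.
transitivity (\D_(y, t <- x) \D_(a, b <- r * y) f a (b * S t)).
  transitivity (\D_(p, q <- x) \D_(a, b <- r) f (a * p) (b * PiL q)).
    rewrite (@D_PiL _ _ W _ (fun u v => \D_(a, b <- r) f (a * u) (b * v)));
      last by lin_tac.
    rewrite [LHS]swap_sw; apply: eq_sw => c d; apply: eq_sw => a b.
    by rewrite mulrA.
  transitivity (\D_(p, q <- x) \D_(s, t <- q) \D_(a, b <- r) f (a * p) (b * s * S t)).
    apply: eq_sw => p q; rewrite PiL_def.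
    rewrite (lin_sw (g := fun c => \D_(a, b <- r) f (a * p) (b * c)));
      last by lin_tac.
    by apply: eq_sw => s t; apply: eq_sw => a b; rewrite mulrA.
  rewrite -(@D_assoc _ _ W _ (fun p s t =>
    \D_(a, b <- r) f (a * p) (b * s * S t))); last by lin_tac.
  apply: eq_sw => y t; rewrite [RHS]D_mul; last by lin_tac.
  by rewrite [LHS]swap_sw.
under eq_sw => y t do rewrite rI.
rewrite (@D_PiR _ _ W _ (fun y t => \D_(a, b <- r * y) f a (b * S t)));
  last by lin_tac.
transitivity (\D_(c, d <- 1) \D_(a, b <- r) f a (b * (c * S d) * S x)).
  apply: D_1_eq => [||c d cR dL]; [by lin_tac | by lin_tac |].
  rewrite (D_mulRr _ cR); last by lin_tac.
  by apply: eq_sw => a b; rewrite antipM !mulrA.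
rewrite [LHS]swap_sw; apply: eq_sw => a b.
rewrite -(lin_sw (g := fun z => f a (b * z * S x))); last by lin_tac.
by rewrite -PiL_def PiL_1 mulr1.
Qed.

Section Haar.
Variable h : A.
Hypothesis h_haar : haar_integral (alg_ops W) h.

Lemma haar_idem : h * h = h.
Proof. by have /haar_integralE[hl _ _ h1] := h_haar; rewrite hl h1 mul1r. Qed.

(** The product [h * h'] is [h'] because [PiL h] is 1, and [h] because [PiR h'] is 1. Invariance of
    [h] under the star and the antipode is deduced from this. *)
Lemma haar_unique h' : haar_integral (alg_ops W) h' -> h' = h.
Proof.
move=> /haar_integralE[hl' _ h1' _].
have /haar_integralE[_ hr _ h2] := h_haar.
by rewrite -[LHS]mul1r -h2 -hl' hr h1' mulr1.
Qed.

Lemma haar_star : st h = h.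
Proof.
have /haar_integralE[hl hr h1 h2] := h_haar.
have hl' a : a * st h = Si (PiL a) * st h.
  by rewrite -[a in LHS](starK W) -starM hr starM star_PiR.
have hr' a : st h * a = st h * Si (PiR a).
  by rewrite -[a in LHS](starK W) -starM hl starM star_PiL.
apply: haar_unique; apply/haar_integralE; split=> [a|a||].
- by rewrite [LHS]hl' [RHS]hl' (PiL_A_L (A_L_PiL W a)).
- by rewrite [LHS]hr' [RHS]hr' (PiR_A_R (A_R_PiR W a)).
- by rewrite -[LHS](starK W) star_PiR h2 antipi1 star1.
- by rewrite -[LHS](starK W) star_PiL h1 antipi1 star1.
Qed.

Lemma haar_antip : S h = h.
Proof.
have /haar_integralE[hl hr h1 h2] := h_haar.
apply: haar_unique; apply/haar_integralE; split=> [a|a||].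
- by rewrite -[a in LHS](antipiK W) -antipM hr antipM antip_PiR antipiK.
- by rewrite -[a in LHS](antipiK W) -antipM hl antipM antip_PiL antipiK.
- by rewrite -antip_PiL h2 antip1.
- by rewrite -antip_PiR h1 antip1.
Qed.

End Haar.

(* The Haar integral of the dual, through its values on [A]. *)
Definition haar_functional (H : A -> R[i]^o) : Prop :=
  [/\ lin H,
      forall x, \D_(a, b <- x) (H b *: a) = \D_(a, b <- x) (H b *: PiL a),
      forall x, \D_(a, b <- x) (H a *: b) = \D_(a, b <- x) (H a *: PiR b) &
      forall x, H (PiR x) = eps x /\ H (PiL x) = eps x].

Lemma hom_eq (x y : A) : (forall phi : 'Hom(A, R[i]^o), phi x = phi y) -> x = y.
Proof.
move=> xy; rewrite (coord_vbasis (memvf x)) (coord_vbasis (memvf y)).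
apply: eq_bigr => i _; congr (_ *: _).
by have := xy (dual_basis i); rewrite !lfunE.
Qed.

Lemma dual_mulE (psi phi : 'Hom(A, R[i]^o)) x :
  dual_mul W psi phi x = \D_(a, b <- x) (psi a * phi b).
Proof. exact: dual_mulP. Qed.

(** The decomposition of [dual_comul psi] is never computed: once [f] is evaluated at [x], only
    pairings with two elements of [A] remain, and these are given by [dual_comulP]. *)
Lemma sweedler_dual (psi : 'Hom(A, R[i]^o))
    (f : 'Hom(A, R[i]^o) -> 'Hom(A, R[i]^o) -> 'Hom(A, R[i]^o)) x (u v : A -> A -> A) :
  (forall p q, f p q x = \D_(a, b <- x) (p (u a b) * q (v a b))) ->
  sweedler (dual_comul psi) f x = \D_(a, b <- x) psi (u a b * v a b).
Proof.
move=> fE; rewrite /sweedler sum_lfunE.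
under eq_bigr => p _ do rewrite fE.
rewrite [LHS]exchange_big; apply: eq_bigr => q _ /=.
exact: dual_comulP.
Qed.

(** In the dual, the product of a leg of [phi] with the antipode of the next one is [phi ∘ PiL] or
    [phi ∘ PiR]. The integral axioms thus pair an arbitrary [phi] with an identity in [A], which
    [hom_eq] extracts. *)
Lemma haar_integral_dualE (H : 'Hom(A, R[i]^o)) :
  haar_integral (dual_ops W) H -> haar_functional H.
Proof.
have HL : lin H by exact: lin_linear.
case=> /= Hl Hr H1 H2; split=> // x.
- apply: hom_eq => phi; have pL : lin phi by exact: lin_linear.
  have := congr1 (fun g : 'Hom(A, R[i]^o) => g x) (Hl phi).
  rewrite !dual_mulE !(lin_sw _ _ pL) => e.
  transitivity (\D_(a, b <- x) (phi a * H b)).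
    by apply: eq_sw => a b; rewrite (linZ pL) [LHS]mulrC.
  rewrite e; apply: eq_sw => a b.
  rewrite (@sweedler_dual _ _ _ (fun a b => a) (fun a b => S b)).
    by rewrite (linZ pL) PiL_def (lin_sw _ _ pL) [LHS]mulrC.
  by move=> p q; rewrite dual_mulE; apply: eq_sw => c d; rewrite comp_lfunE.
- apply: hom_eq => phi; have pL : lin phi by exact: lin_linear.
  have := congr1 (fun g : 'Hom(A, R[i]^o) => g x) (Hr phi).
  rewrite !dual_mulE !(lin_sw _ _ pL) => e.
  transitivity (\D_(a, b <- x) (H a * phi b)).
    by apply: eq_sw => a b; rewrite (linZ pL).
  rewrite e; apply: eq_sw => a b.
  rewrite (@sweedler_dual _ _ _ (fun a b => S a) (fun a b => b)).
    by rewrite (linZ pL) PiR_def (lin_sw _ _ pL).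
  by move=> p q; rewrite dual_mulE; apply: eq_sw => c d; rewrite comp_lfunE.
- split.
    rewrite -H1 (@sweedler_dual _ _ _ (fun a b => S a) (fun a b => b)).
      by rewrite PiR_def (lin_sw _ _ HL).
    by move=> p q; rewrite dual_mulE; apply: eq_sw => c d; rewrite comp_lfunE.
  rewrite -H2 (@sweedler_dual _ _ _ (fun a b => a) (fun a b => S b)).
    by rewrite PiL_def (lin_sw _ _ HL).
  by move=> p q; rewrite dual_mulE; apply: eq_sw => c d; rewrite comp_lfunE.
Qed.

Section DualHaar.
Variable H : A -> R[i]^o.
Hypothesis H_haar : haar_functional H.

Lemma lin_haar : lin H. Proof. by case: H_haar. Qed.
Hint Resolve lin_haar : lin.

Lemma haar_convl (H' : A -> R[i]^o) : lin H' -> (forall x, H' (PiL x) = eps x) ->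
  forall x, \D_(a, b <- x) (H b *: H' a) = H x.
Proof.
move=> HL' H1' x; case: H_haar => HL Hl _ _.
transitivity (H' (\D_(a, b <- x) (H b *: a))).
  by rewrite (lin_sw _ _ HL'); apply: eq_sw => a b; rewrite (linZ HL').
rewrite Hl (lin_sw _ _ HL') -[x in RHS](counitl W) (lin_sw _ _ HL).
by apply: eq_sw => a b; rewrite (linZ HL') H1' (linZ HL) [LHS]mulrC.
Qed.

Lemma haar_convr (H' : A -> R[i]^o) : lin H' -> (forall x, H' (PiR x) = eps x) ->
  forall x, \D_(a, b <- x) (H a *: H' b) = H x.
Proof.
move=> HL' H1' x; case: H_haar => HL _ Hr _.
transitivity (H' (\D_(a, b <- x) (H a *: b))).
  by rewrite (lin_sw _ _ HL'); apply: eq_sw => a b; rewrite (linZ HL').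
rewrite Hr (lin_sw _ _ HL') -[x in RHS](counitr W) (lin_sw _ _ HL).
by apply: eq_sw => a b; rewrite (linZ HL') H1' (linZ HL) [LHS]mulrC.
Qed.

End DualHaar.

(** The dual form of [haar_unique]: the convolution with values [H'(x_1) H(x_2)] equals both
    functionals. *)
Lemma haar_functional_unique H H' : haar_functional H -> haar_functional H' -> H' =1 H.
Proof.
move=> HH HH' x; have HL := lin_haar HH; have HL' := lin_haar HH'.
have [_ _ _ e] := HH; have [_ _ _ e'] := HH'.
rewrite -[LHS](haar_convr (H := H') HH' HL) => [|y]; last by have [] := e y.
rewrite -[RHS](haar_convl (H := H) HH HL') => [|y]; last by have [] := e' y.
by apply: eq_sw => a b; exact: mulrC.
Qed.

(** By uniqueness, since [H ∘ S] is again a Haar functional: [S] exchanges the legs, hence left and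
    right invariance. Writing a leg as [Si (S a)] makes [Si] common to the whole sum. *)
Lemma haar_functional_antip H : haar_functional H -> forall x, H (S x) = H x.
Proof.
move=> HH; apply: (haar_functional_unique HH); case: (HH) => HL Hl Hr H1.
split=> [|x|x|x]; first by lin_tac.
- have H0 y (k : A -> A) : lin k ->
    \D_(a, b <- y) (H (S b) *: k (S a)) = k (\D_(p, q <- S y) (H p *: q)).
    move=> kL; rewrite D_antip ?(lin_sw _ _ kL); last by lin_tac.
    by apply: eq_sw => a b; rewrite (linZ kL).
  transitivity (\D_(a, b <- x) (H (S b) *: Si (S a))).
    by apply: eq_sw => a b; rewrite antipK.
  rewrite (H0 x Si (@lin_antipi _ _ W)) Hr D_antip; last by lin_tac.
  rewrite (lin_sw _ _ (@lin_antipi _ _ W)); apply: eq_sw => a b.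
  by rewrite (linZ (@lin_antipi _ _ W)) -antip_PiL antipK.
- have H0 y (k : A -> A) : lin k ->
    \D_(a, b <- y) (H (S a) *: k (S b)) = k (\D_(p, q <- S y) (H q *: p)).
    move=> kL; rewrite D_antip ?(lin_sw _ _ kL); last by lin_tac.
    by apply: eq_sw => a b; rewrite (linZ kL).
  transitivity (\D_(a, b <- x) (H (S a) *: Si (S b))).
    by apply: eq_sw => a b; rewrite antipK.
  rewrite (H0 x Si (@lin_antipi _ _ W)) Hl D_antip; last by lin_tac.
  rewrite (lin_sw _ _ (@lin_antipi _ _ W)); apply: eq_sw => a b.
  by rewrite (linZ (@lin_antipi _ _ W)) -antip_PiR antipK.
- by rewrite antip_PiR antip_PiL; have [-> ->] := H1 (S x); rewrite counit_antip.
Qed.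

(** Again by uniqueness. The star turns [PiL] into [Si ∘ PiR], so [el] shows at first only that the
    invariant sum lies in [A_L]; but then [PiL] fixes it. [er] does the same in [A_R]. *)
Lemma haar_functional_star H : haar_functional H -> forall x, H (st x) = (H x)^*.
Proof.
move=> HH x; rewrite -[x in RHS](starK W).
pose H' y : R[i]^o := (H (st y))^*.
suff H'H : haar_functional H' by rewrite -[RHS]/(H' (st x)) (haar_functional_unique HH).
case: (HH) => HL Hl Hr H1.
have HL' : lin H' by exact: lin_conj_comp.
have el y : \D_(a, b <- y) (H' b *: a) = \D_(a, b <- y) (H' b *: Si (PiR a)).
  transitivity (st (\D_(a, b <- st y) (H b *: a))).
    rewrite D_star ?star_sw; last by lin_tac.
    by apply: eq_sw => a b; rewrite starZ starK.
  rewrite Hl D_star ?star_sw; last by lin_tac.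
  by apply: eq_sw => a b; rewrite starZ star_PiL.
have er y : \D_(a, b <- y) (H' a *: b) = \D_(a, b <- y) (H' a *: Si (PiL b)).
  transitivity (st (\D_(a, b <- st y) (H a *: b))).
    rewrite D_star ?star_sw; last by lin_tac.
    by apply: eq_sw => a b; rewrite starZ starK.
  rewrite Hr D_star ?star_sw; last by lin_tac.
  by apply: eq_sw => a b; rewrite starZ star_PiR.
have H1' y : H (Si y) = H y by rewrite -[LHS](haar_functional_antip HH) antipiK.
split=> // [y|y|y].
- have yL : A_L (\D_(a, b <- y) (H' b *: a)).
    rewrite el; have -> : \D_(a, b <- y) (H' b *: Si (PiR a)) =
        Si (PiR (\D_(a, b <- y) (H' b *: a))).
      rewrite (lin_sw (g := fun z => Si (PiR z))); last by lin_tac.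
      by apply: eq_sw => a b; rewrite !(linZ (@lin_PiR _ _ W), linZ (@lin_antipi _ _ W)).
    exact/A_L_antipi/A_R_PiR.
  rewrite -(PiL_A_L yL) (lin_sw _ _ (@lin_PiL _ _ W)).
  by apply: eq_sw => a b; rewrite (linZ (@lin_PiL _ _ W)).
- have yR : A_R (\D_(a, b <- y) (H' a *: b)).
    rewrite er; have -> : \D_(a, b <- y) (H' a *: Si (PiL b)) =
        Si (PiL (\D_(a, b <- y) (H' a *: b))).
      rewrite (lin_sw (g := fun z => Si (PiL z))); last by lin_tac.
      by apply: eq_sw => a b; rewrite !(linZ (@lin_PiL _ _ W), linZ (@lin_antipi _ _ W)).
    exact/A_R_antipi/A_L_PiL.
  rewrite -(PiR_A_R yR) (lin_sw _ _ (@lin_PiR _ _ W)).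
  by apply: eq_sw => a b; rewrite (linZ (@lin_PiR _ _ W)).
- rewrite /H' -[y](starK W) star_PiR star_PiL !H1'; have [-> ->] := H1 (st y).
  by rewrite starK -counit_star starK.
Qed.

(** * The conditional expectation onto [A_L] and nondegeneracy of the Haar functional *)

Section Expectation.
Variable H : A -> R[i]^o.
Hypothesis H_haar : haar_functional H.
Let HL : lin H := lin_haar H_haar.

(* [expect x] is H ⇀ x; it is the conditional expectation of A onto A_L. *)
Definition expect x : A := \D_(a, b <- x) (H b *: a).
Local Notation E := expect.

Lemma A_L_expect x : A_L (E x).
Proof.
case: H_haar => _ Hl _ _; suff -> : E x = PiL (E x) by exact: A_L_PiL.
rewrite /expect {1}Hl (lin_sw _ _ (@lin_PiL _ _ W)).
by apply: eq_sw => a b; rewrite (linZ (@lin_PiL _ _ W)).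
Qed.

Lemma expect_mull b x : A_L b -> E (b * x) = b * E x.
Proof.
move=> bL; rewrite /expect (D_mulLl _ bL) ?sw_mull; last by lin_tac.
by apply: eq_sw => c d; rewrite -scalerAr.
Qed.

Lemma expect_mulr b x : A_L b -> E (x * b) = E x * b.
Proof.
move=> bL; rewrite /expect (D_mulLr _ bL) ?sw_mulr; last by lin_tac.
by apply: eq_sw => c d; rewrite -scalerAl.
Qed.

Lemma counit_expect x : eps (E x) = H x.
Proof.
rewrite /expect (lin_sw _ _ (lin_counit W)) -[x in RHS](counitl W) (lin_sw _ _ HL).
by apply: eq_sw => a b; rewrite (linZ (lin_counit W)) (linZ HL) [LHS]mulrC.
Qed.

(** As for integrals: [D_PiR] creates [PiR(y_1) = S(y_1) y_2], and the remaining legs of [y] unite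
    with those of [x] in [Δ(y_2 x)]. *)
Lemma expect_convl x y :
  \D_(a, b <- x) (H (y * b) *: a) = \D_(c, d <- y) (S c * E (d * x)).
Proof.
rewrite -(@D_1l _ _ W _ (fun a b => H (y * b) *: a)); last by lin_tac.
transitivity (\D_(m, q <- y) \D_(a, b <- x) (H (q * b) *: (PiR m * a))).
  rewrite (@D_PiR _ _ W _ (fun m q => \D_(a, b <- x) (H (q * b) *: (m * a))));
    last by lin_tac.
  by apply: eq_sw => c d; apply: eq_sw => a b; rewrite mulrA.
transitivity (\D_(m, q <- y) \D_(c, p <- m) \D_(a, b <- x) (H (q * b) *: (S c * p * a))).
  apply: eq_sw => m q; rewrite PiR_def [RHS]swap_sw; apply: eq_sw => a b.
  by rewrite sw_mulr sw_scaler.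
rewrite (@D_assoc _ _ W _ (fun c p q =>
  \D_(a, b <- x) (H (q * b) *: (S c * p * a)))); last by lin_tac.
apply: eq_sw => c d; rewrite /expect D_mul ?sw_mull; last by lin_tac.
apply: eq_sw => p q; rewrite sw_mull; apply: eq_sw => a b.
by rewrite -scalerAr mulrA.
Qed.

(** [PiL] rebuilds [e] from the numbers [eps(1_1 e)], and [counitM] writes [eps(z e)] as the sum of
    [eps(z 1_1) eps(1_2 e)], where the vectors [eps(z 1_1) 1_2] sum to an element of [A_L]. *)
Lemma counit_A_L_nondeg e : A_L e -> (forall b, A_L b -> eps (b * e) = 0) -> e = 0.
Proof.
move=> eL e0; rewrite -(PiL_A_L eL) PiLE; apply: big1 => p _.
suff -> : eps (p.1 * e) = 0 by rewrite scale0r.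
rewrite -[p.1]mulr1 (counitM W).
have := e0 _ (@A_L_intro _ _ W (fun a => eps (p.1 * a)) _).
rewrite sw_mulr (lin_sw _ _ (lin_counit W)) => <-; last by lin_tac.
by apply: eq_sw => a b; rewrite -scalerAl (linZ (lin_counit W)).
Qed.

Lemma coord_expand (Z : lmodType R[i]) (f : A -> Z) x : lin f ->
  f x = \sum_(i < \dim {:A}) coord (vbasis {:A}) i x *: f (vbasis {:A})`_i.
Proof.
move=> fL; rewrite {1}(coord_vbasis (memvf x)) (lin_sum fL).
by apply: eq_bigr => i _; rewrite (linZ fL).
Qed.

Lemma lin_coord i : lin (coord (vbasis {:A}) i : A -> R[i]^o).
Proof. exact: lin_linear. Qed.

Lemma haar_nondeg x : (forall a, H (a * x) = 0) -> x = 0.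
Proof.
move=> x0.
have Ex0 a : E (a * x) = 0.
  apply: counit_A_L_nondeg; first exact: A_L_expect.
  by move=> b bL; rewrite -expect_mull // counit_expect mulrA x0.
have D0 y : \D_(a, b <- x) (H (y * b) *: a) = 0.
  by rewrite expect_convl; apply: big1 => p _; rewrite Ex0 mulr0.
(* [D0] holds for a fixed left factor, whereas [S p] involves a leg of [x]. Expanding [S p] in the
   basis moves this dependence into the coefficients, collected by [K i]. *)
pose K i c := \D_(a, p <- c) (coord (vbasis {:A}) i (S p) *: a).
have KL i : lin (K i).
  by apply: D_lin; have := lin_coord i; lin_tac.
rewrite -[x](counitr W).
transitivity (\D_(a, b <- x) \D_(p, q <- b) (H (S p * q) *: a)).
  apply: eq_sw => a b; case: H_haar => _ _ _ H1; have [<- _] := H1 b.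
  by rewrite PiR_def (lin_sw _ _ HL) sw_scalel.
rewrite -(@D_assoc _ _ W _ (fun a p q => H (S p * q) *: a)); last by lin_tac.
transitivity (\D_(c, q <- x) \sum_(i < \dim {:A}) K i (H ((vbasis {:A})`_i * q) *: c)).
  apply: eq_sw => c q.
  under [RHS]eq_bigr => i _ do rewrite (linZ (KL i)) /K sw_scaler.
  rewrite -sw_sumr; apply: eq_sw => a p.
  rewrite (coord_expand (f := fun z => H (z * q) *: a)); last by lin_tac.
  by apply: eq_bigr => i _; rewrite !scalerA mulrC.
rewrite sw_sumr big1 // => i _.
by rewrite -(lin_sw _ _ (KL i)) D0 (lin0 (KL i)).
Qed.

Section ExpectHaar.
Variable h : A.
Hypothesis h_haar : haar_integral (alg_ops W) h.
Let hl : left_integral (alg_ops W) h. Proof. by case: h_haar. Qed.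
Let hr : right_integral (alg_ops W) h. Proof. by case: h_haar. Qed.

(** The right-integral identity rewrites [E h * y = 0] as the vanishing of [h_1 H(h_2 S(y))], and
    the left-integral identity inserts any factor before [h_2]. As [S(h_1) h_2] is 1, [H(c S(y))]
    vanishes for every [c], and nondegeneracy applies. *)
Lemma expect_haar_lreg y : E h * y = 0 -> y = 0.
Proof.
move=> y0; rewrite -[y](antipK W) (_ : S y = 0) ?(lin0 (@lin_antipi _ _ W)) //.
apply: haar_nondeg => c.
have D0 : \D_(a, b <- h) (H (b * S y) *: a) = 0.
  rewrite -(@D_right_integral _ (fun a b => H b *: a)) //; last by lin_tac.
  rewrite -[RHS]y0 /expect sw_mulr; apply: eq_sw => a b.
  by rewrite -scalerAl.
have D1 d : \D_(a, b <- h) (H (d * (b * S y)) *: a) = 0.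
  transitivity (\D_(a, b <- h) (H ((d * b) * S y) *: a)).
    by apply: eq_sw => a b; rewrite mulrA.
  rewrite (@D_left_integral _ (fun a b => H (b * S y) *: a)) //; last by lin_tac.
  transitivity (S d * \D_(a, b <- h) (H (b * S y) *: a)); last by rewrite D0 mulr0.
  by rewrite sw_mull; apply: eq_sw => a b; rewrite -scalerAr.
have /haar_integralE[_ _ h1 _] := h_haar.
rewrite -[S y]mul1r -h1 PiR_def sw_mulr sw_mull (lin_sw _ _ HL).
transitivity (\D_(a, b <- h) \sum_(i < \dim {:A})
    (coord (vbasis {:A}) i (c * S (H ((vbasis {:A})`_i * (b * S y)) *: a)) : R[i]^o)).
  apply: eq_sw => a b; rewrite !mulrA -mulrA.
  rewrite (coord_expand (f := fun z => H (z * (b * S y)))); last by lin_tac.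
  apply: eq_bigr => i _; rewrite (linZ (lin_antip W)) -scalerAr (linZ (lin_coord i)).
  by rewrite [LHS]mulrC.
rewrite sw_sumr big1 // => i _.
have gL : lin (fun z => coord (vbasis {:A}) i (c * S z) : R[i]^o).
  by have := lin_coord i; lin_tac.
by rewrite -(lin_sw _ _ gL) D1 (lin0 gL).
Qed.

(** [h] and [H] are both fixed by the antipode, so [S] exchanges [h_1 H(h_2)] and [H(h_1) h_2]. *)
Lemma antip2_expect_haar : S (S (E h)) = E h.
Proof.
have HS := haar_functional_antip H_haar.
rewrite /expect !(lin_sw _ _ (lin_antip W)).
transitivity (S (\D_(a, b <- h) (H a *: b))).
  rewrite -{2}(haar_antip h_haar) D_antip; last by lin_tac.
  rewrite (lin_sw _ _ (lin_antip W)); apply: eq_sw => a b.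
  by rewrite HS !(linZ (lin_antip W)).
rewrite -[in RHS](haar_antip h_haar) [RHS]D_antip; last by lin_tac.
rewrite (lin_sw _ _ (lin_antip W)); apply: eq_sw => a b.
by rewrite HS !(linZ (lin_antip W)).
Qed.

End ExpectHaar.
End Expectation.
End Integrals.

(** * Finite-dimensional star algebras *)

Section Spectral.
Variables (R : realType) (A : falgType R[i]) (st : A -> A).
Hypothesis stP : star_axioms st.

Lemma st_semi c x y : st (c *: x + y) = c^* *: st x + st y.
Proof. exact: (star_semilinear stP). Qed.
Lemma stM x y : st (x * y) = st y * st x.
Proof. exact: (star_mul stP). Qed.
Lemma stK : involutive st.
Proof. exact: (star_invol stP). Qed.
Lemma st_alin : alin (st : A -> A). Proof. exact: st_semi. Qed.
Lemma stD : {morph st : x y / x + y}. Proof. exact: (linD st_alin). Qed.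
Lemma stZ c x : st (c *: x) = c^* *: st x. Proof. exact: (linZ st_alin). Qed.
Lemma stB : {morph st : x y / x - y}. Proof. exact: (linB st_alin). Qed.
Lemma st_sum I (r : seq I) (P : pred I) G :
  st (\sum_(i <- r | P i) G i) = \sum_(i <- r | P i) st (G i).
Proof. exact: (lin_sum st_alin). Qed.
Lemma st1 : st 1 = 1.
Proof. by rewrite -[RHS]stK -{2}[st 1]mul1r stM stK mul1r. Qed.

(** Properness of the involution is the form in which the C*-norm enters the spectral theory: it
    excludes nilpotent parts. *)
Lemma cstar_proper nrm : cstar_norm st nrm -> forall x, st x * x = 0 -> x = 0.
Proof.
move=> nP x x0; apply: (nrm_eq0 nP).
have n0 : nrm 0 = 0 by rewrite -(scale0r (1 : A)) (nrm_scale nP) normr0 mul0r.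
by apply/eqP; rewrite -sqrf_eq0 -(nrm_cstar nP) x0 n0.
Qed.

Hypothesis st_proper : forall x, st x * x = 0 -> x = 0.

(* [e r] is the eigenprojection of [r]; its values off [s] are irrelevant. *)
Record spectral (a : A) (s : seq R[i]) (e : R[i] -> A) : Prop := {
  spec_uniq : uniq s;
  spec_real : forall r, r \in s -> r \is Num.real;
  spec_neq0 : forall r, r \in s -> e r != 0;
  spec_star : forall r, r \in s -> st (e r) = e r;
  spec_idem : forall r, r \in s -> e r * e r = e r;
  spec_orth : forall r q, r \in s -> q \in s -> r != q -> e r * e q = 0;
  spec_sum : \sum_(r <- s) e r = 1;
  spec_eig : forall r, r \in s -> a * e r = r *: e r;
  spec_poly : forall r, r \in s -> exists p : {poly R[i]}, e r = horner_alg a p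
}.

Section Existence.
Variable a : A.
Hypothesis a_sa : st a = a.
Local Notation ev := (horner_alg a).

(** [s] lists the roots, with multiplicity, of a split monic polynomial that annihilates [a]. *)
Definition annih (s : seq R[i]) := ev (\prod_(r <- s) ('X - r%:P)) = 0.

Lemma ev_factor r : ev ('X - r%:P) = a - r%:A.
Proof. by rewrite rmorphB /= horner_algX horner_algC. Qed.

Lemma annih_exists : exists s, annih s.
Proof.
pose n := \dim {:A}.
pose X := [tuple a ^+ i | i < n.+1].
have nfX : ~~ free X.
  apply/negP => /eqP fX; have := dimvS (subvf <<X>>%VS).
  by rewrite fX size_tuple ltnn.
have [k [k0 [i ki]]] : exists k : 'I_n.+1 -> R[i],
    \sum_(i < n.+1) k i *: X`_i = 0 /\ exists i, k i != 0.
  apply/not_existsP => H; case/negP: nfX; apply/freeP => k k0 i.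
  by apply/eqP/negPn/negP => ki; case: (H k); split=> //; exists i.
pose p : {poly R[i]} := \poly_(j < n.+1) (k (inord j)).
have p0 : ev p = 0.
  rewrite /p poly_def rmorph_sum -[RHS]k0; apply: eq_bigr => j _ /=.
  rewrite -mul_polyC rmorphM /= horner_algC rmorphXn /= horner_algX.
  by rewrite -scalerAl mul1r inord_val (nth_map ord0) ?size_enum_ord // nth_ord_enum.
have pn0 : p != 0.
  apply/eqP => /(congr1 (fun q : {poly R[i]} => q`_i)).
  by rewrite coef_poly ltn_ord inord_val coef0; apply/eqP.
have [s ps] := closed_field_poly_normal p.
exists s; move: p0; rewrite ps -mul_polyC rmorphM /= horner_algC -scalerAl mul1r.
by move=> /eqP; rewrite scaler_eq0 lead_coef_eq0 (negPf pn0) => /eqP.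
Qed.

Lemma annih_min : exists2 s, annih s & forall s', annih s' -> (size s <= size s')%N.
Proof.
have ex : exists n, `[< exists2 s, size s = n & annih s >].
  by have [s sP] := annih_exists; exists (size s); apply/asboolP; exists s.
case: (ex_minnP ex) => n /asboolP[s <- sP] nmin; exists s => // s' s'P.
by apply: nmin; apply/asboolP; exists s'.
Qed.

Lemma annih_rem r s : r \in s -> annih s ->
  (a - r%:A) * ev (\prod_(q <- rem r s) ('X - q%:P)) = 0.
Proof.
move=> rs; rewrite /annih (perm_big _ (perm_to_rem rs)) big_cons rmorphM /=.
by rewrite ev_factor.
Qed.

Lemma eig_real r y : a * y = r *: y -> y != 0 -> r \is Num.real.
Proof.
move=> ay y0; rewrite CrealE; apply/eqP.
have : (r^* - r) *: (st y * y) = 0.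
  rewrite scalerBl scalerAl -stZ -ay stM a_sa.
  by rewrite -mulrA ay scalerAr subrr.
move/eqP; rewrite scaler_eq0 subr_eq0 => /orP[/eqP//|/eqP yy].
by rewrite (st_proper yy) eqxx in y0.
Qed.

Lemma ev_eig r y p : a * y = r *: y -> ev p * y = p.[r] *: y.
Proof.
move=> ay; elim/poly_ind: p => [|p c IH].
  by rewrite rmorph0 horner0 mul0r scale0r.
rewrite rmorphD rmorphM /= horner_algX horner_algC mulrDl -mulrA ay -scalerAr IH.
by rewrite -scalerAl mul1r hornerMXaddC scalerDl scalerA mulrC.
Qed.

Lemma ev_eigr r y p : y * a = r *: y -> y * ev p = p.[r] *: y.
Proof.
move=> ay; elim/poly_ind: p => [|p c IH].
  by rewrite rmorph0 horner0 mulr0 scale0r.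
rewrite rmorphD rmorphM /= horner_algX horner_algC mulrDr mulrA IH -scalerAl ay.
by rewrite -scalerAr mulr1 hornerMXaddC scalerDl scalerA.
Qed.

(** Take an annihilating list [s] of least length. Removing one root leaves a nonzero product, by
    minimality, and this is an eigenvector; so the roots are real. A repeated root [r] would give
    [y] killed by the square of the selfadjoint [a - r] but not by [a - r], against properness. *)
Lemma spectral_exists : exists s e, spectral a s e.
Proof.
have [s sP smin] := annih_min.
have neq0 r : r \in s -> ev (\prod_(q <- rem r s) ('X - q%:P)) != 0.
  move=> rs; apply/eqP => r0; have := smin _ r0.
  by rewrite size_rem //; case: (s) rs => // x t _ /=; rewrite ltnn.
have eig r : r \in s -> a * ev (\prod_(q <- rem r s) ('X - q%:P)) =
    r *: ev (\prod_(q <- rem r s) ('X - q%:P)).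
  move=> rs; have /eqP := annih_rem rs sP.
  by rewrite mulrBl -scalerAl mul1r subr_eq0 => /eqP.
have sreal r : r \in s -> r \is Num.real.
  by move=> rs; apply: (eig_real (eig r rs) (neq0 r rs)).
have rem_notin r : r \in s -> r \notin rem r s.
  move=> rs; apply/negP => rrs.
  have /CrealP rr := sreal r rs.
  pose y := ev (\prod_(q <- rem r (rem r s)) ('X - q%:P)).
  have yE : ev (\prod_(q <- rem r s) ('X - q%:P)) = (a - r%:A) * y.
    by rewrite (perm_big _ (perm_to_rem rrs)) big_cons rmorphM /= ev_factor.
  have /eqP := neq0 r rs; apply; apply: st_proper.
  have sr : st (a - r%:A) = a - r%:A by rewrite stB a_sa stZ st1 rr.
  by rewrite {1}yE stM sr -mulrA annih_rem // mulr0.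
have us : uniq s.
  apply: count_mem_uniq => r; case: (boolP (r \in s)) => [rs|/count_memPn //].
  rewrite (permP (perm_to_rem rs)) /= eqxx; have /count_memPn -> // := rem_notin r rs.
pose c r := \prod_(q <- rem r s) (r - q).
have c0 r : r \in s -> c r != 0.
  move=> rs; rewrite prodf_seq_neq0; apply/allP => q qs /=.
  rewrite subr_eq0; apply/eqP => rq; have := rem_notin r rs.
  by rewrite {1}rq qs.
(* Lagrange interpolation at the simple roots. The [L r] sum to 1, the difference having degree less
   than [size s] and vanishing on all of [s]. *)
pose L r : {poly R[i]} := (c r)^-1 *: \prod_(q <- rem r s) ('X - q%:P).
have LE r q : r \in s -> q \in s -> (L r).[q] = (r == q)%:R.
  move=> rs qs; rewrite /L hornerZ horner_prod.
  case: eqP => [<-|/eqP rq].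
    under eq_bigr => i _ do rewrite !hornerE.
    by rewrite mulVf // c0.
  suff -> : \prod_(i <- rem r s) ('X - i%:P).[q] = 0 by rewrite mulr0.
  have qr : q \in rem r s by rewrite mem_rem_uniq // inE eq_sym rq.
  by rewrite (perm_big _ (perm_to_rem qr)) big_cons hornerXsubC subrr /= mul0r.
pose e r := ev (L r).
have eE r : e r = (c r)^-1 *: ev (\prod_(q <- rem r s) ('X - q%:P)).
  by rewrite /e /L -mul_polyC rmorphM /= horner_algC -scalerAl mul1r.
have ae r : r \in s -> a * e r = r *: e r.
  by move=> rs; rewrite eE -scalerAr eig // !scalerA mulrC.
have esum : \sum_(r <- s) e r = 1.
  rewrite /e -rmorph_sum -[RHS](rmorph1 ev); congr (ev _).
  apply/eqP; rewrite -subr_eq0; apply/eqP.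
  apply: (@roots_geq_poly_eq0 _ _ s) => //.
    apply/allP => q qs; rewrite rootE !hornerE horner_sum (bigD1_seq q) //=.
    rewrite LE // eqxx big_seq_cond big1 ?addr0 ?subrr // => r /andP[rs rq].
    by rewrite LE // (negPf rq).
  have s_gt0 : (0 < size s)%N.
    case: (s) sP => //; rewrite /annih big_nil rmorph1 => /eqP.
    by rewrite oner_eq0.
  apply: (leq_trans (size_polyD _ _)); rewrite size_polyN size_poly1 geq_max s_gt0 andbT.
  rewrite big_seq_cond.
  apply: (big_ind (fun p : {poly R[i]} => (size p <= size s)%N)).
  - by rewrite size_poly0.
  - by move=> p q ps qs; apply: (leq_trans (size_polyD _ _)); rewrite geq_max ps.
  - move=> r /andP[rs _]; apply: (leq_trans (size_scale_leq _ _)).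
    by rewrite size_prod_XsubC size_rem // prednK.
have estar r : r \in s -> st (e r) = e r.
  move=> rs; have /CrealP rr := sreal r rs.
  have sa : st (e r) * a = r *: st (e r) by rewrite -[X in _ * X]a_sa -stM ae // stZ rr.
  have e1 : st (e r) = st (e r) * e r.
    by rewrite {2}/e (ev_eigr _ sa) LE // eqxx scale1r.
  by rewrite -[RHS]stK [X in _ = st X]e1 stM stK.
exists s, e; split=> // [r rs|r rs|r q rs qs rq|r rs].
- by rewrite eE scaler_eq0 invr_eq0 (negPf (c0 r rs)) neq0.
- by rewrite {1}/e (ev_eig _ (ae r rs)) LE // eqxx scale1r.
- by rewrite {1}/e (ev_eig _ (ae q qs)) LE // (negPf rq) scale0r.
- by exists (L r).
Qed.
End Existence.

Section SpectralCalculus.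
Variables (a : A) (s : seq R[i]) (e : R[i] -> A).
Hypothesis sp : spectral a s e.

Lemma spectral_decomp : a = \sum_(r <- s) r *: e r.
Proof.
rewrite -[LHS]mulr1 -(spec_sum sp) mulr_sumr big_seq [RHS]big_seq.
by apply: eq_bigr => r rs; rewrite (spec_eig sp).
Qed.

Lemma spectral_mul (f g : R[i] -> R[i]) :
  (\sum_(r <- s) f r *: e r) * (\sum_(r <- s) g r *: e r) =
  \sum_(r <- s) (f r * g r) *: e r.
Proof.
rewrite mulr_suml big_seq [RHS]big_seq; apply: eq_bigr => r rs.
rewrite mulr_sumr (bigD1_seq r) ?(spec_uniq sp) //= big_seq_cond big1 ?addr0.
  by rewrite -scalerAl -scalerAr scalerA (spec_idem sp).
move=> q /andP[qs qr]; rewrite -scalerAl -scalerAr (spec_orth sp) ?scaler0 //.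
by rewrite eq_sym.
Qed.

Lemma spectral_inv_sqrt : (forall r, r \in s -> 0 < r) ->
  exists z, st z = z /\ z * a * z = 1.
Proof.
move=> s0; pose z := \sum_(r <- s) (sqrtC r)^-1 *: e r; exists z; split.
  rewrite /z st_sum big_seq [RHS]big_seq; apply: eq_bigr => r rs.
  rewrite stZ (spec_star sp) //; congr (_ *: _).
  apply/CrealP; rewrite realV ger0_real // sqrtC_ge0 ltW // s0 //.
rewrite [X in _ * X * _]spectral_decomp /z !spectral_mul -(spec_sum sp).
rewrite big_seq [RHS]big_seq; apply: eq_bigr => r rs.
rewrite -[in X in _ * X * _](sqrtCK r) expr2 mulrA mulVf ?mul1r ?mulfV ?scale1r //.
  by rewrite sqrtC_eq0 gt_eqF // s0.
by rewrite sqrtC_eq0 gt_eqF // s0.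
Qed.

End SpectralCalculus.

Lemma horner_alg_closed (P : A -> Prop) b p :
  P 1 -> (forall c x y, P x -> P y -> P (c *: x + y)) ->
  (forall x y, P x -> P y -> P (x * y)) -> P b -> P (horner_alg b p).
Proof.
move=> P1 PL PM Pb.
have P0 : P 0 by rewrite -(addNr 1) -scaleN1r; exact: PL.
elim/poly_ind: p => [|p c IH]; first by rewrite rmorph0.
rewrite rmorphD rmorphM /= horner_algX horner_algC addrC.
by apply: PL => //; exact: PM.
Qed.

(** Row [i] holds the coordinates of [x] times basis vector [i]. Acting on row vectors, left
    multiplications compose in reverse order, which the trace does not see. *)
Definition left_mx (x : A) : 'M[R[i]]_(\dim {:A}) :=
  \matrix_(i, j) coord (vbasis {:A}) j (x * (vbasis {:A})`_i).

Definition tau (x : A) : R[i]^o := \tr (left_mx x).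

Lemma left_mxM x y : left_mx (x * y) = left_mx y *m left_mx x.
Proof.
apply/matrixP => i j; rewrite !mxE.
rewrite -mulrA [y * _](coord_vbasis (memvf _)) mulr_sumr linear_sum.
by apply: eq_bigr => k _; rewrite !mxE -scalerAr linearZ.
Qed.

Lemma lin_tau : lin tau.
Proof.
move=> c x y; rewrite /tau -linearP; congr (\tr _).
by apply/matrixP => i j; rewrite !mxE mulrDl -scalerAl linearP.
Qed.

Lemma tauC x y : tau (x * y) = tau (y * x).
Proof. by rewrite /tau !left_mxM mxtrace_mulC. Qed.

Lemma left_mx_eq0 x : left_mx x = 0 -> x = 0.
Proof.
move=> x0; rewrite -[x]mulr1 [1](coord_vbasis (memvf _)) mulr_sumr big1 // => i _.
rewrite -scalerAr [x * _](coord_vbasis (memvf _)) big1 ?scaler0 // => j _.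
by have := congr1 (fun M : 'M__ => M i j) x0; rewrite !mxE => ->; rewrite scale0r.
Qed.

(** In a full-rank factorization of an idempotent, the two factors multiply in the other order to an
    identity matrix of size the rank. *)
Lemma mxtrace_idem n (M : 'M[R[i]]_n) : M *m M = M -> \tr M = (\rank M)%:R.
Proof.
move=> MM; have e : row_base M *m col_base M = 1%:M.
  apply: (row_full_inj (col_base_full M)); apply: (row_free_inj (row_base_free M)).
  by rewrite /= mulmx1 mulmxA -mulmxA mulmx_base MM.
by rewrite -{1}(mulmx_base M) mxtrace_mulC e mxtrace1.
Qed.

Lemma tau_idem_gt0 x : x * x = x -> x != 0 -> 0 < tau x.
Proof.
move=> xx x0; rewrite /tau mxtrace_idem -?left_mxM ?xx // ltr0n lt0n mxrank_eq0.
by apply: contra x0 => /eqP /left_mx_eq0 ->.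
Qed.

Lemma tau_sa_ge0 x : st x = x -> 0 <= tau (x * x).
Proof.
move=> xx; have [s [e sp]] := spectral_exists xx.
rewrite [x in x * _](spectral_decomp sp) [X in _ * X](spectral_decomp sp) (spectral_mul sp).
rewrite (lin_sum lin_tau) big_seq; apply: sumr_ge0 => r rs.
rewrite (linZ lin_tau) mulr_ge0 //.
  by have := spec_real sp rs; rewrite -expr2 -realEsqr.
by rewrite ltW // tau_idem_gt0 ?(spec_idem sp) ?(spec_neq0 sp).
Qed.

Lemma square_diff (B : pzRingType) (z u : B) :
  (z + u) * (z + u) - (z - u) * (z - u) = (u * z + z * u) *+ 2.
Proof.
have sq v : (z + v) * (z + v) = (z * z + v * v) + (v * z + z * v).
  rewrite mulrDl !mulrDr -!addrA; congr (_ + _).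
  by rewrite [RHS]addrC [v * z + z * v]addrC addrA.
rewrite !sq mulrNN mulNr mulrN -[- (u * z) - _]opprD.
by rewrite opprB addrC addrA subrK mulr2n.
Qed.

(* If r < 0 were an eigenvalue of x* x, with z = x e_r we would have z* z = r e_r *)
(* of negative trace, while z* z + z z* is a sum of two squares of selfadjoint  *)
(* elements.                                                                   *)
Lemma spectral_ge0 x s e : spectral (st x * x) s e -> forall r, r \in s -> 0 <= r.
Proof.
move=> sp r rs; rewrite real_leNgt ?real0 ?(spec_real sp rs) //.
apply/negP => r0; pose z := x * e r.
have zz : st z * z = r *: e r.
  rewrite /z stM (spec_star sp) // mulrA -[e r * _ * _]mulrA -mulrA (spec_eig sp) //.
  by rewrite -scalerAr (spec_idem sp).
pose b := z + st z; pose c := 'i *: (z - st z).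
have bb : st b = b by rewrite /b stD stK addrC.
have cc : st c = c.
  by rewrite /c stZ stB stK conjCi scaleNr -scalerN opprB.
have e4 : tau (b * b) + tau (c * c) = (4%:R * r) *: tau (e r).
  rewrite -(linD lin_tau).
  have -> : b * b + c * c = 2%:R *: (st z * z + z * st z).
    have ii : ('i : R[i]) * 'i = -1 by rewrite -expr2 sqrCi.
    by rewrite /c -scalerAl -scalerAr scalerA ii scaleN1r square_diff scaler_nat.
  rewrite (linZ lin_tau) (linD lin_tau) [tau (z * _)]tauC zz (linZ lin_tau).
  rewrite -[RHS]/((4%:R * r) * _) -[r *: _]/(r * _).
  by rewrite -[LHS]/(2%:R * (r * tau (e r) + r * tau (e r))); ring.
have ge0 : 0 <= tau (b * b) + tau (c * c) by rewrite addr_ge0 // tau_sa_ge0.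
have lt0 : (4%:R * r) * tau (e r) < 0.
  rewrite nmulr_rlt0 ?pmulr_rlt0 ?ltr0n //.
  by rewrite tau_idem_gt0 ?(spec_idem sp) ?(spec_neq0 sp).
by rewrite e4 in ge0; have := le_lt_trans ge0 lt0; rewrite ltxx.
Qed.

Lemma tau_ge0 x : 0 <= tau (st x * x).
Proof.
have xx : st (st x * x) = st x * x by rewrite stM stK.
have [s [e sp]] := spectral_exists xx.
rewrite (spectral_decomp sp) (lin_sum lin_tau) big_seq; apply: sumr_ge0 => r rs.
rewrite (linZ lin_tau) mulr_ge0 ?(spectral_ge0 sp rs) //.
by rewrite ltW // tau_idem_gt0 ?(spec_idem sp) ?(spec_neq0 sp).
Qed.

Lemma tau_faithful x : tau (st x * x) = 0 -> x = 0.
Proof.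
have xx : st (st x * x) = st x * x by rewrite stM stK.
have [s [e sp]] := spectral_exists xx.
rewrite [X in tau X](spectral_decomp sp) (lin_sum lin_tau) big_seq => /eqP.
have ge0 r : r \in s -> 0 <= tau (r *: e r).
  move=> rs; rewrite (linZ lin_tau) mulr_ge0 ?(spectral_ge0 sp rs) //.
  by rewrite ltW // tau_idem_gt0 ?(spec_idem sp) ?(spec_neq0 sp).
rewrite psumr_eq0 // => /allP x0.
apply: st_proper; rewrite (spectral_decomp sp) big_seq big1 // => r rs.
have := x0 r rs; rewrite rs /= (linZ lin_tau) mulf_eq0 => /orP[/eqP->|].
  by rewrite scale0r.
by rewrite gt_eqF // tau_idem_gt0 ?(spec_idem sp) ?(spec_neq0 sp).
Qed.

(** Positivity on [c *: x + 1] makes [f (c *: x) + f (st (c *: x))] real; the choices 1 and ['i] of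
    [c] determine [f (st x)]. *)
Lemma positive_star (f : A -> R[i]^o) : lin f -> (forall x, 0 <= f (st x * x)) ->
  forall x, f (st x) = (f x)^*.
Proof.
move=> fL f0 x.
have re c : (f (c *: x) + f (st (c *: x)))^* = f (c *: x) + f (st (c *: x)).
  have e : f (st (c *: x + 1) * (c *: x + 1)) =
      f (st (c *: x) * (c *: x)) + (f (c *: x) + f (st (c *: x))) + f (st 1 * 1).
    rewrite -!(linD fL); congr (f _).
    by rewrite stD mulrDr !mulrDl st1 !mul1r !mulr1 !addrA addrAC.
  have r0 y : (f (st y * y))^* = f (st y * y).
    by apply/CrealP; rewrite ger0_real.
  by have := r0 (c *: x + 1); rewrite e !cconjD !r0 => /addIr /addrI.
have := re 1; have := re 'i.
rewrite !stZ !(linZ fL) conjC1 conjCi !cconjD.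
have ci : (- 'i)^* = 'i :> R[i] by rewrite -conjCi cconjK.
have ii : ('i : R[i]) * 'i = -1 by rewrite -expr2 sqrCi.
rewrite -![_ *: _]/(_ * _) !cconjM conjC1 ci conjCi !mul1r.
set a := f x; set b := f (st x); set a' := a^*; set b' := b^* => e1 e2.
have e3 : a' - b' = b - a.
  transitivity ((- ('i * 'i)) * (a' - b') : R[i]); first by rewrite ii opprK mul1r.
  transitivity ('i * (- 'i * a' + 'i * b') : R[i]); first by ring.
  rewrite e1; transitivity (('i * 'i) * (a - b) : R[i]); first by ring.
  by rewrite ii; ring.
have e4 : 2%:R * a' = 2%:R * b :> R[i].
  transitivity ((a' + b') + (a' - b') : R[i]); first by ring.
  by rewrite e2 e3; ring.
by apply: esym; apply: (mulfI _ e4); rewrite pnatr_eq0.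
Qed.

Lemma tau_star x : tau (st x) = (tau x)^*.
Proof. exact: (positive_star lin_tau tau_ge0). Qed.

(** It suffices that [g] acts as [t = sqrtC r] on each eigenprojection [f r] of [g * g]. The defect
    [w] satisfies [g w = - t w], so [tau (st w * g * w)] and [t * tau (st w * w)] are nonnegative
    with sum 0. *)
Lemma sqrt_horner g : positive_elt st g ->
  exists p, g = horner_alg (g * g) p.
Proof.
case=> y gy; have gg : st g = g by rewrite gy stM stK.
have bb : st (g * g) = g * g by rewrite stM gg.
have [s [f sp]] := spectral_exists bb.
have s0 r : r \in s -> 0 <= r.
  by move: sp; rewrite -{1}gg => sp; exact: spectral_ge0 sp r.
have gf r : r \in s -> g * f r = sqrtC r *: f r.
  move=> rs; pose t := sqrtC r; pose w := g * f r - t *: f r.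
  have t0 : 0 <= t by rewrite sqrtC_ge0 s0.
  have gw : g * w = - t *: w.
    rewrite /w mulrBr mulrA (spec_eig sp) // -scalerAr scalerBr.
    by rewrite !scaleNr opprK scalerA -expr2 sqrtCK addrC.
  have : tau (st w * (g * w)) + t * tau (st w * w) = 0.
    by rewrite gw -scalerAr (linZ lin_tau) scaleNr addNr.
  move/eqP; rewrite [in tau (st w * (g * w))]gy [st w * _]mulrA [st w * _]mulrA -stM -mulrA.
  rewrite paddr_eq0 ?mulr_ge0 ?tau_ge0 // => /andP[/eqP/tau_faithful yw].
  (* For nonzero [t] the second term forces [w] to vanish. For [t = 0] it says nothing, and
     [w = g * f r] is killed by properness instead. *)
  rewrite mulf_eq0 => /orP[/eqP t00|/eqP/tau_faithful w0]; last first.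
    by apply/eqP; rewrite -subr_eq0; apply/eqP; exact: w0.
  have gw0 : g * (g * f r) = 0.
    by have := gw; rewrite t00 /w t00 scale0r subr0 oppr0 scale0r.
  rewrite -/t t00 scale0r; apply: st_proper.
  by rewrite stM gg (spec_star sp) // -mulrA gw0 mulr0.
have : g = \sum_(r <- s) sqrtC r *: f r.
  rewrite -[LHS]mulr1 -(spec_sum sp) mulr_sumr big_seq [RHS]big_seq.
  by apply: eq_bigr => r rs; rewrite gf.
suff H t : {subset t <= s} ->
    exists p, \sum_(j <- t) sqrtC j *: f j = horner_alg (g * g) p.
  by have [p pE] := H s (fun _ => id) => gE; exists p; rewrite -pE.
elim: t => [|r t IH] ts; first by exists 0; rewrite rmorph0 big_nil.
have [p pE] : exists p, \sum_(j <- t) sqrtC j *: f j = horner_alg (g * g) p.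
  by apply: IH => q qt; apply: ts; rewrite inE qt orbT.
have rs : r \in s by apply: ts; rewrite mem_head.
have [q qE] := spec_poly sp rs; exists (sqrtC r *: q + p).
by rewrite big_cons qE pE rmorphD /= -mul_polyC rmorphM /= horner_algC -scalerAl mul1r.
Qed.

End Spectral.

(** * Orthonormal expansions and Gram sums *)

Section Gram.
Variables (R : realType) (A : vectType R[i]) (B : A -> A -> R[i]).
Hypothesis B_lin : forall x, lin (B x : A -> R[i]^o).
Hypothesis B_herm : forall x y, B y x = (B x y)^*.
Hypothesis B_ge0 : forall x, 0 <= B x x.
Hypothesis B_def : forall x, B x x = 0 -> x = 0.

Let B_alin y c x x' : B (c *: x + x') y = c^* * B x y + B x' y.
Proof. by rewrite B_herm B_lin cconjD cconjM -!B_herm. Qed.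

Let proj (u : seq A) x := \sum_(v <- u) B v x *: v.

Let lin_proj u : lin (proj u).
Proof. by rewrite /proj; lin_tac; exact: B_lin. Qed.

(** Orthonormality of [u] is recorded only through [proj u] fixing [u], which is what the induction
    and the expansion of arbitrary vectors rely on. *)
Lemma gram_schmidt (s : seq A) : exists u : seq A,
  (forall v, v \in u -> proj u v = v) /\ (forall v, v \in s -> proj u v = v).
Proof.
elim: s => [|v s [u [uP sP]]]; first by exists [::].
pose r := v - proj u v; have [r0|r0] := eqVneq r 0.
  exists u; split=> // w; rewrite inE => /orP[/eqP->|/sP //].
  by move/eqP: r0; rewrite subr_eq0 eq_sym => /eqP.
have Bsum z y : B z (proj u y) = \sum_(w <- u) B w y * B z w.
  by rewrite /proj (lin_sum (B_lin z)); apply: eq_bigr => w _; rewrite (linZ (B_lin z)).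
have Br z : z \in u -> B z r = 0.
  move=> zu; rewrite (linB (B_lin z)) Bsum [B z v]B_herm -[z in B v z]uP // Bsum.
  rewrite cconj_sum -sumrB big1 // => w _.
  by rewrite cconjM -!B_herm mulrC subrr.
have Brr : B r r != 0 by apply: contra r0 => /eqP /B_def ->.
pose c := (sqrtC (B r r))^-1; pose w := c *: r.
have cc : c^* = c by apply/CrealP; rewrite realV ger0_real // sqrtC_ge0.
have Buw z : z \in u -> B z w = 0 by move=> zu; rewrite (linZ (B_lin z)) Br // scaler0.
have Bwu z : z \in u -> B w z = 0 by move=> zu; rewrite B_herm Buw // conjC0.
have projr0 x : (forall z, z \in u -> B z x = 0) -> proj u x = 0.
  by move=> x0; rewrite /proj big_seq big1 // => z zu; rewrite x0 // scale0r.
have Bww : B w w = 1.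
  rewrite (linZ (B_lin w)) -[w]addr0 B_alin (_ : B 0 r = 0); last first.
    by rewrite B_herm (lin0 (B_lin r)) conjC0.
  rewrite addr0 cc -[_ *: _]/(_ * _) mulrA mulrC /c -invfM -expr2 sqrtCK.
  by rewrite mulfV.
have pw x : proj (w :: u) x = B w x *: w + proj u x by rewrite /proj big_cons.
have w1 : proj (w :: u) w = w by rewrite pw Bww scale1r projr0 ?addr0.
have u1 z : z \in u -> proj (w :: u) z = z.
  by move=> zu; rewrite pw Bwu // scale0r add0r uP.
exists (w :: u); split=> z; rewrite inE => /orP[/eqP->//|zs]; first exact: u1.
- have vE : v = sqrtC (B r r) *: w + proj u v.
    rewrite scalerA mulfV ?sqrtC_eq0 // scale1r /r addrC addrA.
    by rewrite addrC addrA addNr add0r.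
  rewrite {1}vE (linD (lin_proj _)) (linZ (lin_proj _)) w1.
  rewrite [X in _ + X](_ : _ = proj u v) -?vE //.
  rewrite {2 3}/proj (lin_sum (lin_proj _)) big_seq [RHS]big_seq.
  by apply: eq_bigr => y yu; rewrite (linZ (lin_proj _)) u1.
- rewrite pw sP // (_ : B w z = 0) ?scale0r ?add0r //.
  rewrite -(sP z zs) Bsum big_seq big1 // => y yu.
  by rewrite Bwu // mulr0.
Qed.

Lemma orthonormal_exists : exists u : seq A, forall x, x = \sum_(v <- u) B v x *: v.
Proof.
have [u [_ uP]] := gram_schmidt (vbasis {:A}).
exists u => x; rewrite -/(proj u x) [x in RHS](coord_vbasis (memvf x)).
rewrite (lin_sum (lin_proj u)) {1}(coord_vbasis (memvf x)).
by apply: eq_bigr => i _; rewrite (linZ (lin_proj u)) uP // mem_nth // size_tuple.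
Qed.

(** Expanding the [b i] along [u] diagonalizes their Gram matrix. This serves both for [q] and for
    the scalar product of [Hs ⊗ A]. *)
Lemma gram_sum (Z Y : lmodType R[i]) (K : Z -> Z -> Y) u I (r : seq I)
    (z : I -> Z) (b : I -> A) :
  (forall x, x = \sum_(v <- u) B v x *: v) ->
  (forall z, lin (K z)) -> (forall y, alin (K^~ y)) ->
  \sum_(i <- r) \sum_(j <- r) B (b i) (b j) *: K (z i) (z j) =
  \sum_(v <- u) K (\sum_(i <- r) B v (b i) *: z i) (\sum_(i <- r) B v (b i) *: z i).
Proof.
move=> uP K1 K2.
transitivity (\sum_(i <- r) \sum_(j <- r) \sum_(v <- u)
    ((B v (b i))^* * B v (b j)) *: K (z i) (z j)).
  apply: eq_bigr => i _; apply: eq_bigr => j _.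
  rewrite -scaler_suml [b j in LHS]uP (lin_sum (B_lin _)); congr (_ *: _).
  apply: eq_bigr => v _; rewrite (linZ (B_lin _)) -[_ *: _]/(_ * _) mulrC.
  by rewrite -B_herm.
under eq_bigr => i _ do rewrite exchange_big /=.
rewrite exchange_big; apply: eq_bigr => v _ /=.
rewrite (lin_sum (K2 _)); apply: eq_bigr => i _.
rewrite (alinZ (K2 _)) (lin_sum (K1 _)) scaler_sumr.
by apply: eq_bigr => j _; rewrite (linZ (K1 _)) scalerA.
Qed.

End Gram.

(** * Positivity of the dual Haar integral *)

Section HaarPositivity.
Variables (R : realType) (A : falgType R[i]) (W : weakCstarHopf A).
Local Notation S := (antip W).
Local Notation st := (star W).
Local Notation PiL := (PiL W).
Local Notation A_L := (A_L W).
Local Notation Si := (antipi W).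
Local Notation "'\D_' ( a , b <- x ) F" := (sweedler (comul W x) (fun a b => F))
  (at level 41, F at level 41, a name, b name, x at level 35,
   format "'[' \D_ ( a ,  b  <-  x ) '/  '  F ']'").
Hint Resolve lin_PiL lin_PiR lin_antipi : lin.

Lemma lreg_unit (x : A) : (forall y, x * y = 0 -> y = 0) -> x \is a GRing.unit.
Proof.
move=> x0; have xL : linear (fun y : A => x * y) by apply: lin_mulr; exact: lin_id.
pose f0 : {linear A -> A} := HB.pack (fun y : A => x * y)
  (GRing.isLinear.Build _ _ _ _ (fun y : A => x * y) xL).
pose f := linfun f0; have fE y : f y = x * y by rewrite (lfunE f0).
have fk : lker f == 0%VS.
  apply/lker0P => y z; rewrite !fE => xyz; apply/eqP; rewrite -subr_eq0; apply/eqP.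
  by apply: x0; rewrite mulrBr xyz subrr.
have xy1 : x * (f^-1)%VF 1 = 1 by rewrite -fE lker0_lfunVK.
apply/unitrP; exists ((f^-1)%VF 1); split=> //.
apply/eqP; rewrite -subr_eq0; apply/eqP/x0.
by rewrite mulrBr mulrA xy1 mul1r mulr1 subrr.
Qed.

Lemma star_proper x : st x * x = 0 -> x = 0.
Proof. by have [nrm nP] := cstarP W; exact: cstar_proper nP x. Qed.

(** [PiL] is left [A_L]-linear, so [b * PiL b^-1] is [PiL 1 = 1]. *)
Lemma A_L_inv b : b \is a GRing.unit -> A_L b -> A_L b^-1.
Proof.
move=> bU bL; suff -> : b^-1 = PiL b^-1 by exact: A_L_PiL.
rewrite -[RHS](mulKr bU).
have -> : b * PiL b^-1 = PiL (b * b^-1).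
  rewrite !PiL_def (D_mulLl _ bL) ?sw_mull; last by lin_tac.
  by apply: eq_sw => c d; rewrite mulrA.
by rewrite mulrV // PiL_1 mulr1.
Qed.

Variables (h : A) (H : A -> R[i]^o) (gL : A).
Hypothesis h_haar : haar_integral (alg_ops W) h.
Hypothesis H_haar : haar_functional W H.
Hypothesis gL_pos : positive_elt st gL.
Hypothesis gL_sq : gL * gL = expect W H h.

Lemma star_gL : st gL = gL.
Proof. by case: gL_pos => y ->; rewrite starM starK. Qed.

(** An arbitrary square root could leave [A_L]; a polynomial in [expect W H h] stays in it, and
    stays fixed by the square of the antipode. *)
Let gL_poly : exists p, gL = horner_alg (expect W H h) p.
Proof.
by have [p pE] := sqrt_horner (starP W) star_proper gL_pos; exists p; rewrite -gL_sq.
Qed.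

Lemma A_L_gL : A_L gL.
Proof.
have [p ->] := gL_poly; apply: horner_alg_closed.
- exact: A_L_1.
- exact: A_L_linear.
- exact: A_L_mul.
- exact: A_L_expect.
Qed.

Lemma antip2_gL : S (S gL) = gL.
Proof.
have [p ->] := gL_poly; apply: (@horner_alg_closed _ _ (fun x => S (S x) = x)).
- by rewrite !antip1.
- by move=> c x y xx yy; rewrite !(lin_antip W) xx yy.
- by move=> x y xx yy; rewrite !antipM xx yy.
- exact: (antip2_expect_haar H_haar h_haar).
Qed.

Lemma gL_unit : gL \is a GRing.unit.
Proof.
apply: lreg_unit => y y0; apply: (expect_haar_lreg H_haar h_haar).
by rewrite -gL_sq -mulrA y0 mulr0.
Qed.

Lemma A_L_gLV : A_L gL^-1.
Proof. exact: A_L_inv gL_unit A_L_gL. Qed.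

Lemma star_gLV : st gL^-1 = gL^-1.
Proof.
apply: (mulIr gL_unit); rewrite -{2}star_gL -starM mulrV ?gL_unit //.
by rewrite mulVr ?gL_unit // star1.
Qed.

Lemma antip_gLV : S gL^-1 * S gL = 1.
Proof. by rewrite -antipM mulrV ?gL_unit // antip1. Qed.

Lemma antipi_gL : Si gL = S gL.
Proof. by rewrite -{1}antip2_gL antipK. Qed.

Local Notation tau := (@tau _ A).

Let B x y : R[i] := tau (y * st x).
Let B_lin x : lin (B x : A -> R[i]^o).
Proof. by have := @lin_tau _ A; rewrite /B => tL; lin_tac. Qed.
Let B_herm x y : B y x = (B x y)^*.
Proof. by rewrite /B -(tau_star (starP W) star_proper) starM starK. Qed.
Let B_ge0 x : 0 <= B x x.
Proof. by rewrite /B tauC (tau_ge0 (starP W) star_proper). Qed.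
Let B_def x : B x x = 0 -> x = 0.
Proof. by rewrite /B tauC => /(tau_faithful (starP W) star_proper). Qed.

Let q : A := \D_(a, b <- h) (tau a *: b).

Let tauL : lin tau := @lin_tau _ A.

Let D_haar_sq (Z : lmodType R[i]) (f : A -> A -> Z) : bil f ->
  \D_(a, b <- h) f a b = \D_(a, b <- h) \D_(c, d <- h) f (a * st c) (b * st d).
Proof.
move=> fL; rewrite -{1}(haar_idem h_haar) -{2}(haar_star h_haar) D_mul //.
by apply: eq_sw => a b; rewrite D_star; last by lin_tac.
Qed.

(** Since [h = h * st h], [q] is the Gram sum of [tau (a * st c)] against [b * st d], hence a sum of
    elements [zeta * st zeta]. *)
Let q_gram u : (forall x, x = \sum_(v <- u) B v x *: v) ->
  q = \sum_(v <- u) ((\D_(a, b <- h) (B v a *: b)) * st (\D_(a, b <- h) (B v a *: b))).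
Proof.
move=> uP; rewrite /q (D_haar_sq (f := fun a b => tau a *: b)); last by lin_tac.
rewrite -(@gram_sum _ _ B B_lin B_herm A A (fun x y : A => y * st x) u _
  (repr (comul W h)) snd fst uP).
- by rewrite [RHS]exchange_big.
- by move=> z; lin_tac.
- by move=> y c x x'; rewrite starD starZ mulrDr -scalerAr.
Qed.

Let star_q : st q = q.
Proof.
have [u uP] := orthonormal_exists B_lin B_herm B_ge0 B_def.
rewrite (q_gram uP) star_sum; apply: eq_bigr => v _.
by rewrite starM starK.
Qed.

(** The Gram form makes the eigenvalues of [q] nonnegative; a zero eigenvalue would make its
    eigenprojection annihilate every [zeta v]. *)
Let q_inv_sqrt : exists z, st z = z /\ z * q * z = 1.
Proof.
have [u uP] := orthonormal_exists B_lin B_herm B_ge0 B_def.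
pose zeta v := \D_(a, b <- h) (B v a *: b).
have qE : q = \sum_(v <- u) (zeta v * st (zeta v)) by exact: q_gram.
have [s [e sp]] := spectral_exists (starP W) star_proper star_q.
apply: (spectral_inv_sqrt (starP W) sp) => r rs.
have tE : r * tau (e r) = \sum_(v <- u) tau (st (st (zeta v) * e r) * (st (zeta v) * e r)).
  rewrite -[LHS]/(r *: tau (e r)) -(linZ tauL) -(spec_eig sp rs) -[in LHS](spec_idem sp rs).
  rewrite mulrA tauC mulrA qE mulr_sumr mulr_suml (lin_sum tauL).
  by apply: eq_bigr => v _; rewrite starM starK (spec_star sp rs) !mulrA.
have te : 0 < tau (e r) by rewrite tau_idem_gt0 ?(spec_idem sp) ?(spec_neq0 sp).
have ge0 v : 0 <= tau (st (st (zeta v) * e r) * (st (zeta v) * e r)).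
  exact: (tau_ge0 (starP W) star_proper).
have r_ge0 : 0 <= r by rewrite -(pmulr_lge0 _ te) tE sumr_ge0.
rewrite lt0r r_ge0 andbT; apply/eqP => r0.
have tE0 : \sum_(v <- u) tau (st (st (zeta v) * e r) * (st (zeta v) * e r)) = 0.
  by rewrite -tE r0 mul0r.
have z0 := introT eqP tE0; rewrite psumr_eq0 // in z0; have {}z0 := allP z0.
have ez v : v \in u -> e r * zeta v = 0.
  move=> /z0 /= /eqP /(tau_faithful (starP W) star_proper) z00.
  by rewrite -(starK W (e r * _)) starM (spec_star sp rs) z00 star0.
have /eqP := spec_neq0 sp rs; apply.
(* From [PiL h = 1] comes [h_2 Si(h_1) = 1]. Expanding [h_1] along [u] writes [e r] as a sum of the
   products [e r * zeta v * Si v], all zero. *)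
have /haar_integralE[_ _ _ h2] := h_haar.
rewrite -[LHS]mulr1 -(antipi1 W) -h2 antipi_PiL sw_mull.
transitivity (\D_(a, b <- h) \sum_(v <- u) (e r * (B v a *: b)) * Si v).
  apply: eq_sw => a b; rewrite {1}[a]uP (lin_sum (@lin_antipi _ _ W)) !mulr_sumr.
  apply: eq_bigr => v _; rewrite (linZ (@lin_antipi _ _ W)).
  by rewrite -!scalerAr -scalerAl mulrA.
rewrite sw_sumr big_seq big1 // => v vu.
by rewrite -sw_mulr -sw_mull ez // mul0r.
Qed.

(** The left-integral identity carries [y] to the first leg as [S y], and the right one carries
    [st y] there as [Si (st y) = st (S y)]; what stays between them is [h_1 H(h_2)]. *)
Let haar_q y : H (y * q * st y) = tau (st (st (S y * gL)) * st (S y * gL)).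
Proof.
have HL := lin_haar H_haar.
have [hl hr _ _] := h_haar.
rewrite /q sw_mull sw_mulr (lin_sw _ _ HL).
transitivity (\D_(a, b <- h) (tau a *: H (y * b * st y))).
  by apply: eq_sw => a b; rewrite -scalerAr -scalerAl (linZ HL).
rewrite (D_left_integral y (f := fun a b => tau a *: H (b * st y)) hl);
  last by lin_tac.
rewrite -{1}(antipiK W (st y)).
rewrite -(D_right_integral (Si (st y)) (f := fun a b => tau (S y * a) *: H b) hr);
  last by lin_tac.
transitivity (tau (S y * expect W H h * Si (st y))).
  rewrite /expect sw_mull sw_mulr (lin_sw _ _ tauL); apply: eq_sw => a b.
  by rewrite -scalerAr -scalerAl (linZ tauL) mulrA [LHS]mulrC.
by rewrite -gL_sq starK starM star_gL star_antip !mulrA.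
Qed.

Lemma haar_positive x : 0 <= H (x * st x).
Proof.
have [z [zz zqz]] := q_inv_sqrt.
(* [z] is the inverse square root of [q]. *)
have -> : x * st x = (x * z) * q * st (x * z).
  by rewrite starM zz -!mulrA [q * _]mulrA (mulrA z (q * z)) [z * (q * z)]mulrA zqz mul1r.
by rewrite haar_q (tau_ge0 (starP W) star_proper).
Qed.

Lemma haar_faithful x : H (x * st x) = 0 -> x = 0.
Proof.
have [z [zz zqz]] := q_inv_sqrt.
have -> : x * st x = (x * z) * q * st (x * z).
  by rewrite starM zz -!mulrA [q * _]mulrA (mulrA z (q * z)) [z * (q * z)]mulrA zqz mul1r.
rewrite haar_q => /(tau_faithful (starP W) star_proper) /(congr1 st).
rewrite starK star0 => SgL.
have S0 : S (x * z) = 0 by rewrite -[LHS](mulrK gL_unit) SgL mul0r.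
have xz : x * z = 0 by rewrite -[LHS](antipK W) S0 (lin0 (@lin_antipi _ _ W)).
by rewrite -[x]mulr1 -zqz !mulrA xz !mul0r.
Qed.

End HaarPositivity.

(** * Hilbert spaces *)

Section HilbertSpace.
Variables (R : realType) (Hs : hilbertSpace R).
Implicit Types x y z : Hs.

Lemma inner_lin x : lin (inner x : Hs -> R[i]^o).
Proof. by move=> c y z; rewrite /inner linearDl linearZl_LR. Qed.

Lemma inner_herm x y : inner y x = (inner x y)^*.
Proof. by rewrite /inner hermC expr0 mul1r. Qed.

Lemma inner_alin y c x x' : inner (c *: x + x') y = c^* * inner x y + inner x' y.
Proof. by rewrite inner_herm inner_lin cconjD cconjM -!inner_herm. Qed.

Lemma inner_ge0 x : 0 <= inner x x.
Proof. exact: dnorm_ge0. Qed.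

Lemma inner_def x : inner x x = 0 -> x = 0.
Proof. by move=> /eqP; rewrite /inner dnorm_eq0 => /eqP. Qed.

Lemma innerDr x y z : inner x (y + z) = inner x y + inner x z.
Proof. exact: (linD (inner_lin x)). Qed.
Lemma innerBr x y z : inner x (y - z) = inner x y - inner x z.
Proof. exact: (linB (inner_lin x)). Qed.
Lemma innerZr c x y : inner x (c *: y) = c * inner x y.
Proof. exact: (linZ (inner_lin x)). Qed.
Lemma inner0r x : inner x 0 = 0.
Proof. exact: (lin0 (inner_lin x)). Qed.
Lemma innerDl x y z : inner (x + y) z = inner x z + inner y z.
Proof. by rewrite inner_herm innerDr cconjD -!inner_herm. Qed.
Lemma innerBl x y z : inner (x - y) z = inner x z - inner y z.
Proof. by rewrite inner_herm innerBr rmorphB /= -!inner_herm. Qed.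
Lemma innerZl c x y : inner (c *: x) y = c^* * inner x y.
Proof. by rewrite inner_herm innerZr cconjM -inner_herm. Qed.

Lemma inner_sumr x I (r : seq I) (P : pred I) F :
  inner x (\sum_(i <- r | P i) F i) = \sum_(i <- r | P i) inner x (F i).
Proof. exact: (lin_sum (inner_lin x)). Qed.
Lemma inner_suml x I (r : seq I) (P : pred I) F :
  inner (\sum_(i <- r | P i) F i) x = \sum_(i <- r | P i) inner (F i) x.
Proof.
rewrite inner_herm inner_sumr cconj_sum; apply: eq_bigr => i _.
by rewrite -inner_herm.
Qed.

Lemma inner_eqP x y : (forall z, inner z x = inner z y) -> x = y.
Proof.
move=> xy; apply/eqP; rewrite -subr_eq0; apply/eqP/inner_def.
by rewrite innerBr xy subrr.
Qed.

Lemma hnorm_ge0 x : 0 <= hnorm x.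
Proof. by rewrite sqrtC_ge0 inner_ge0. Qed.

Lemma hnorm_sqr x : hnorm x ^+ 2 = inner x x.
Proof. exact: sqrtCK. Qed.

Lemma hnorm_eq0 x : hnorm x = 0 -> x = 0.
Proof. by move=> x0; apply: inner_def; rewrite -hnorm_sqr x0 expr0n. Qed.

Lemma hnorm_scale c x : hnorm (c *: x) = `|c| * hnorm x.
Proof.
apply: (@pexpIrn _ 2) => //; rewrite ?nnegrE ?mulr_ge0 ?hnorm_ge0 //.
by rewrite exprMn !hnorm_sqr innerZl innerZr mulrA normCKC.
Qed.

Lemma hnorm_opp x : hnorm (- x) = hnorm x.
Proof. by rewrite -scaleN1r hnorm_scale normrN1 mul1r. Qed.

Lemma hnorm_sub x y : hnorm (x - y) = hnorm (y - x).
Proof. by rewrite -hnorm_opp opprB. Qed.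

Lemma cauchy_schwarz x y : `|inner x y| <= hnorm x * hnorm y.
Proof.
rewrite -(@ler_pXn2r _ 2) ?nnegrE ?mulr_ge0 ?hnorm_ge0 // exprMn !hnorm_sqr.
have [y0|y0] := eqVneq (inner y y) 0.
  by rewrite (inner_def y0) !inner0r normr0 expr0n mulr0.
have yp : 0 < inner y y by rewrite lt0r y0 inner_ge0.
pose c := inner y x / inner y y.
have cy : c * inner y y = inner y x by rewrite mulfVK.
have : 0 <= inner (x - c *: y) (x - c *: y) * inner y y by rewrite mulr_ge0 ?inner_ge0.
suff -> : inner (x - c *: y) (x - c *: y) * inner y y =
    inner x x * inner y y - `|inner x y| ^+ 2 by rewrite subr_ge0.
have yx0 : inner (x - c *: y) y = 0.
  by rewrite inner_herm innerBr innerZr cy subrr conjC0.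
rewrite innerBr innerZr yx0 mulr0 subr0 innerBl innerZl mulrBl; congr (_ - _).
rewrite mulrAC -[inner y y](CrealP (ger0_real (inner_ge0 y))) -cconjM cy.
by rewrite [in RHS]inner_herm norm_conjC normCKC.
Qed.

Lemma hnorm_triangle x y : hnorm (x + y) <= hnorm x + hnorm y.
Proof.
rewrite -(@ler_pXn2r _ 2) ?nnegrE ?addr_ge0 ?hnorm_ge0 // sqrrD !hnorm_sqr.
rewrite innerDl !innerDr addrA -[inner x x + _ + _]addrA lerD2r lerD2l (inner_herm x y).
apply: le_trans (_ : (`|inner x y| *+ 2 <= _)); last by rewrite lerMn2r cauchy_schwarz.
rewrite -{1}[inner x y]cconjK addrC; set d := (inner x y)^*.
have dr : d^* + d \is Num.real by apply/CrealP; rewrite cconjD cconjK addrC.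
rewrite addrC; apply: le_trans (real_ler_norm dr) _.
by apply: le_trans (ler_normD _ _) _; rewrite /d !norm_conjC mulr2n.
Qed.

End HilbertSpace.

Lemma subrACA4 (Z : zmodType) (a b c d : Z) : (a - b) - (c - d) = (a - c) - (b - d).
Proof.
by rewrite !opprB -!addrA; congr (_ + _); rewrite addrCA [RHS]addrCA [- b - c]addrC.
Qed.

Section ComplexEpsilon.
Variable R : realType.

Lemma inv_nat_lt (e : R[i]) : 0 < e -> exists N, (N.+1%:R)^-1 < e.
Proof.
case: e => a b; rewrite ltcE /= => /andP[/eqP -> a0].
have ai0 : 0 <= a^-1 by rewrite invr_ge0 ltW.
exists (Num.bound a^-1).
have -> : ((Num.bound a^-1).+1%:R : R[i])^-1 = ((Num.bound a^-1).+1%:R^-1 : R)%:C%C.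
  by rewrite fmorphV rmorph_nat.
rewrite -[(a +i* 0)%C]/(a%:C%C) ltcR invf_plt ?posrE ?ltr0n //.
by apply: lt_trans (archi_boundP ai0) _; rewrite ltr_nat.
Qed.

(** The order of [R[i]] is partial, so arguing by contradiction requires both sides to be real. *)
Lemma le_eps (x y k : R[i]) : x \is Num.real -> y \is Num.real -> 0 <= k ->
  (forall e, 0 < e -> x <= y + k * e) -> x <= y.
Proof.
move=> xr yr k0 H; rewrite real_leNgt //; apply/negP => yx.
have d0 : 0 < x - y by rewrite subr_gt0.
have k1 : 0 < k + 1 by rewrite ltr_wpDl.
have := H ((x - y) / (k + 1)) (divr_gt0 d0 k1); rewrite -lerBlDl => le.
have lt : k * ((x - y) / (k + 1)) < x - y.
  by rewrite mulrCA gtr_pMr // ltr_pdivrMr // mul1r ltrDl ltr01.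
by have := le_lt_trans le lt; rewrite ltxx.
Qed.

End ComplexEpsilon.

(** * Bounded operators and arguments by density *)

Section BoundedOperators.
Variables (R : realType) (Hs : hilbertSpace R).
Implicit Types T U : Hs -> Hs.

Lemma bounded_lin T : bounded_operator T -> lin T.
Proof. by case. Qed.

Lemma bounded_const T : bounded_operator T ->
  exists2 c : R[i], 0 <= c & forall x, hnorm (T x) <= c * hnorm x.
Proof.
case=> _ [c cP]; exists `|c| => // x; apply: le_trans (cP x) _.
have c0 : 0 <= c * hnorm x by apply: le_trans (cP x); exact: hnorm_ge0.
by rewrite -[c * _](ger0_norm c0) normrM [`|hnorm x|]ger0_norm ?hnorm_ge0.
Qed.

Lemma bounded_id : bounded_operator (fun x : Hs => x).
Proof. by split=> //; exists 1 => x; rewrite mul1r. Qed.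

Lemma bounded_zero : bounded_operator (fun _ : Hs => 0 : Hs).
Proof.
split=> [c x y|]; first by rewrite scaler0 addr0.
exists 0 => x; rewrite mul0r -(scale0r (0 : Hs)) hnorm_scale normr0 mul0r //.
Qed.

Lemma bounded_comp T U : bounded_operator T -> bounded_operator U ->
  bounded_operator (fun x => T (U x)).
Proof.
move=> TB UB; split; first exact: lin_comp (bounded_lin TB) (bounded_lin UB).
have [c c0 cP] := bounded_const TB; have [d _ dP] := bounded_const UB.
exists (c * d) => x; apply: le_trans (cP _) _.
by rewrite -mulrA ler_wpM2l.
Qed.

Lemma bounded_add T U : bounded_operator T -> bounded_operator U ->
  bounded_operator (fun x => T x + U x).
Proof.
move=> TB UB; split; first exact: lin_add (bounded_lin TB) (bounded_lin UB).
have [c _ cP] := bounded_const TB; have [d _ dP] := bounded_const UB.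
exists (c + d) => x; apply: le_trans (hnorm_triangle _ _) _.
by rewrite mulrDl lerD.
Qed.

Lemma bounded_scale c T : bounded_operator T -> bounded_operator (fun x => c *: T x).
Proof.
move=> TB; split; first exact: lin_scaler (bounded_lin TB).
have [d _ dP] := bounded_const TB.
by exists (`|c| * d) => x; rewrite hnorm_scale -mulrA ler_wpM2l.
Qed.

Lemma bounded_sum I (r : seq I) (T : I -> Hs -> Hs) :
  (forall i, bounded_operator (T i)) -> bounded_operator (fun x => \sum_(i <- r) T i x).
Proof.
move=> TB; elim: r => [|i r IH].
  have -> : (fun x => \sum_(i <- [::]) T i x) = (fun _ => 0).
    by apply: funext => x; rewrite big_nil.
  exact: bounded_zero.
have -> : (fun x => \sum_(j <- i :: r) T j x) = (fun x => T i x + \sum_(j <- r) T j x).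
  by apply: funext => x; rewrite big_cons.
exact: bounded_add.
Qed.

Section Dense.
Variables (V : lmodType R[i]) (D : V -> Hs).
Hypothesis D_lin : lin D.
Hypothesis D_dense : forall x e, 0 < e -> exists m, hnorm (x - D m) < e.

Lemma dense_zero (f : Hs -> R[i]) k : (forall x y, f (x - y) = f x - f y) ->
  0 <= k -> (forall x, `|f x| <= k * hnorm x) -> (forall m, f (D m) = 0) ->
  forall x, f x = 0.
Proof.
move=> fB k0 fk fD x; apply/eqP; rewrite -normr_le0.
apply: (le_eps (k := k)); rewrite ?normr_real ?real0 // => e e0.
have [m xm] := D_dense x e0.
have -> : f x = f (x - D m) by rewrite fB fD subr0.
by rewrite add0r; apply: le_trans (fk _) _; rewrite ler_wpM2l // ltW.
Qed.

Lemma dense_eq T U : bounded_operator T -> bounded_operator U ->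
  (forall m, T (D m) = U (D m)) -> forall x, T x = U x.
Proof.
move=> TB UB TU x; apply: inner_eqP => z.
apply/eqP; rewrite -subr_eq0 -innerBr; apply/eqP.
have NB : bounded_operator (fun x => T x + (-1) *: U x).
  exact: bounded_add TB (bounded_scale _ UB).
have [c c0 cP] := bounded_const NB.
pose f y := inner z (T y - U y).
apply: (@dense_zero f (hnorm z * c)).
- move=> y y'; rewrite /f (linB (bounded_lin TB)) (linB (bounded_lin UB)) -innerBr.
  by rewrite subrACA4.
- by rewrite mulr_ge0 ?hnorm_ge0.
- move=> y; apply: le_trans (cauchy_schwarz _ _) _.
  by rewrite -mulrA ler_wpM2l ?hnorm_ge0 // -scaleN1r.
- by move=> m; rewrite /f TU subrr inner0r.
Qed.

(** Density is used once in each argument, with the common bound [bnd]. *)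
Lemma dense_adjoint T U : bounded_operator T -> bounded_operator U ->
  (forall m n, inner (T (D m)) (D n) = inner (D m) (U (D n))) ->
  forall x y, inner (T x) y = inner x (U y).
Proof.
move=> TB UB TU x y.
have [c c0 cP] := bounded_const TB; have [d d0 dP] := bounded_const UB.
have TL := bounded_lin TB; have UL := bounded_lin UB.
have bnd u v : `|inner (T u) v - inner u (U v)| <= (c + d) * (hnorm u * hnorm v).
  apply: le_trans (ler_normB _ _) _; rewrite mulrDl; apply: lerD.
    apply: le_trans (cauchy_schwarz _ _) _.
    by rewrite mulrA ler_wpM2r ?hnorm_ge0.
  apply: le_trans (cauchy_schwarz _ _) _.
  by rewrite mulrCA ler_wpM2l ?hnorm_ge0.
apply/eqP; rewrite -subr_eq0; apply/eqP.
pose f u := inner (T u) y - inner u (U y).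
apply: (@dense_zero f ((c + d) * hnorm y)) => [u v||u|m].
- by rewrite /f (linB TL) !innerBl subrACA4.
- by rewrite mulr_ge0 ?hnorm_ge0 // addr_ge0.
- by apply: le_trans (bnd _ _) _; rewrite [hnorm u * _]mulrC mulrA.
- pose g v := inner (T (D m)) v - inner (D m) (U v).
  apply: (@dense_zero g ((c + d) * hnorm (D m))) => [u v||u|n].
  + by rewrite /g (linB UL) !innerBr subrACA4.
  + by rewrite mulr_ge0 ?hnorm_ge0 // addr_ge0.
  + by apply: le_trans (bnd _ _) _; rewrite mulrA.
  + by rewrite /g TU subrr.
Qed.

(** The extension is the closure [rel] of the graph of [D m |-> g m]. Completeness makes it total,
    and the bound on [g] survives in the closure and makes it single-valued. [D] may fail to be
    injective: the bound covers this too. *)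
Lemma bounded_extension (g : V -> Hs) k : lin g -> 0 <= k ->
  (forall m, hnorm (g m) <= k * hnorm (D m)) ->
  exists T, bounded_operator T /\ forall m, T (D m) = g m.
Proof.
move=> gL k0 gk.
pose rel x y := forall e, 0 < e -> exists m, hnorm (x - D m) < e /\ hnorm (y - g m) < e.
have relE x : exists y, rel x y.
  have /choice[u uP] : forall n : nat, exists m, hnorm (x - D m) < (n.+1%:R)^-1.
    by move=> n; apply: D_dense; rewrite invr_gt0 ltr0n.
  have [|y yP] := @hcomplete _ Hs (fun n => g (u n)).
    (* The 2 pays for the triangle inequality between two approximants; [k + 1] instead of [k] keeps
       the divisor positive and the final estimate strict. *)
    move=> e e0; have [|N NP] := @inv_nat_lt R (e / ((k + 1) *+ 2)).
      by rewrite divr_gt0 // pmulrn_lgt0 // ltr_wpDl.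
    exists N => m n Nm Nn; rewrite -/(hnorm _) -(linB gL).
    have un p : (N <= p)%N -> hnorm (x - D (u p)) < e / ((k + 1) *+ 2).
      move=> Np; apply: lt_trans (uP p) _; apply: le_lt_trans NP.
      by rewrite lef_pV2 ?posrE ?ltr0n // ler_nat.
    apply: le_lt_trans (gk _) _; rewrite (linB D_lin).
    have -> : D (u m) - D (u n) = (x - D (u n)) - (x - D (u m)).
      by rewrite subrACA4 subrr sub0r opprB.
    have tri : hnorm ((x - D (u n)) - (x - D (u m))) <= (e / ((k + 1) *+ 2)) *+ 2.
      apply: le_trans (hnorm_triangle _ _) _; rewrite hnorm_opp mulr2n.
      by rewrite lerD // ltW // un.
    apply: le_lt_trans (ler_wpM2l k0 tri) _.
    have k1 : 0 < k + 1 by rewrite ltr_wpDl.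
    rewrite -[(k + 1) *+ 2]mulr_natr invfM -mulrnAr mulrA -mulr_natr -!mulrA.
    rewrite mulVf ?pnatr_eq0 // mulr1 mulrCA gtr_pMr //.
    by rewrite ltr_pdivrMr // mul1r ltrDl ltr01.
  exists y => e e0; have [N NP] := yP e e0; have [N' NP'] := inv_nat_lt e0.
  exists (u (maxn N N')); split.
    apply: lt_trans (uP _) _; apply: le_lt_trans NP'.
    by rewrite lef_pV2 ?posrE ?ltr0n // ler_nat ltnS leq_maxr.
  by rewrite hnorm_sub; apply: NP; exact: leq_maxl.
have rel_bound x y : rel x y -> hnorm y <= k * hnorm x.
  move=> xy; apply: (le_eps (k := k + 1));
    rewrite ?ger0_real ?mulr_ge0 ?hnorm_ge0 ?addr_ge0 //.
  move=> e e0; have [m [xm ym]] := xy e e0.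
  rewrite -[y in X in X <= _](subrK (g m)).
  apply: le_trans (hnorm_triangle _ _) _;
  rewrite addrC mulrDl mul1r addrA lerD ?(ltW ym) //.
  apply: le_trans (gk m) _; rewrite -mulrDr ler_wpM2l //.
  rewrite -[D m](subrK x) addrC; apply: le_trans (hnorm_triangle _ _) _.
  by rewrite lerD // hnorm_sub ltW.
have rel_lin c x y x' y' : rel x y -> rel x' y' -> rel (c *: x + x') (c *: y + y').
  move=> xy xy' e e0.
  have c1 : 0 < `|c| + 1 by rewrite ltr_wpDl.
  have d0 : 0 < e / (`|c| + 1) by rewrite divr_gt0.
  have d1 : (`|c| + 1) * (e / (`|c| + 1)) = e by rewrite mulrC divfK ?gt_eqF.
  have [m [xm ym]] := xy _ d0; have [n [xn yn]] := xy' _ d0.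
  have est u v u' v' : hnorm (u - u') < e / (`|c| + 1) ->
      hnorm (v - v') < e / (`|c| + 1) -> hnorm ((c *: u + v) - (c *: u' + v')) < e.
    move=> uu vv; rewrite opprD addrACA -scalerBr -d1 mulrDl mul1r.
    apply: le_lt_trans (hnorm_triangle _ _) _; rewrite hnorm_scale ler_ltD //.
    by rewrite ler_wpM2l // ltW.
  by exists (c *: m + n); rewrite D_lin gL; split; apply: est.
have /choice[T TP] := relE.
have relU x y y' : rel x y -> rel x y' -> y = y'.
  move=> xy xy'; apply/eqP; rewrite -subr_eq0; apply/eqP/hnorm_eq0/eqP.
  have := rel_bound _ _ (rel_lin (-1) _ _ _ _ xy' xy).
  rewrite !scaleN1r addNr (_ : hnorm 0 = 0) ?mulr0; last first.
    by rewrite -(scale0r (0 : Hs)) hnorm_scale normr0 mul0r.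
  by rewrite addrC => le; rewrite eq_le le hnorm_ge0.
exists T; split; last first.
  move=> m; apply: relU (TP _) _ => e e0; exists m.
  by rewrite !subrr -(scale0r (0 : Hs)) hnorm_scale normr0 mul0r.
split=> [c x y|]; last by exists k => x; apply: rel_bound; exact: TP.
by apply: relU (TP _) _; apply: rel_lin; exact: TP.
Qed.

End Dense.
End BoundedOperators.

(** * Module algebras *)

Section ModuleAlgebra.
Variables (R : realType) (A : falgType R[i]) (W : weakCstarHopf A).
Local Notation S := (antip W).
Local Notation st := (star W).
Local Notation PiL := (PiL W).
Local Notation A_L := (A_L W).
Local Notation A_R := (A_R W).
Local Notation Si := (antipi W).
Local Notation "'\D_' ( a , b <- x ) F" := (sweedler (comul W x) (fun a b => F))
  (at level 41, F at level 41, a name, b name, x at level 35,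
   format "'[' \D_ ( a ,  b  <-  x ) '/  '  F ']'").
Variables (M : vonNeumannAlgebra R) (T : moduleAlgebra W M).

Lemma lin_actl m : lin (fun a => T a m).
Proof. by move=> c a b; rewrite act_linearl. Qed.

Lemma lin_actr a : lin (T a).
Proof. by move=> c m n; rewrite act_linearr. Qed.

Lemma act_Pi a : T a 1 = T (PiL a) 1.
Proof. by rewrite PiL_def act_unit. Qed.

(** [Δ(b)] is [1_1 b ⊗ 1_2], so the product rule applied to [1_M m] collects into the action of 1 on
    [(b ▷ 1_M) m]. *)
Lemma act_A_L b m : A_L b -> T b m = T b 1 * m.
Proof.
move=> bL; rewrite -{1}[m]mul1r act_prod.
rewrite (D_A_L_comm (f := fun p q => T p 1 * T q m) bL); last first.
  split=> z; [apply: lin_mull | apply: lin_mulr]; exact: lin_actl.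
rewrite -[RHS](act_one T) act_prod; apply: eq_sw => c d.
by rewrite act_mul.
Qed.

Lemma act_A_R r m : A_R r -> T r m = m * T r 1.
Proof.
move=> rR; rewrite -{1}[m]mulr1 act_prod.
rewrite (D_A_R (f := fun p q => T p m * T q 1) rR); last first.
  split=> z; [apply: lin_mull | apply: lin_mulr]; exact: lin_actl.
rewrite -[RHS](act_one T) act_prod; apply: eq_sw => c d.
by rewrite act_mul.
Qed.

(** [Si b] lies in [A_R], so it acts by right multiplication; on [1_M] it acts as
    [PiL (Si b) = S (Si b) = b]. This is why [Lambda] respects the relation of the crossed
    product. *)
Lemma act_antipi b m : A_L b -> T (Si b) m = m * T b 1.
Proof.
move=> bL; have rR := A_R_antipi bL.
by rewrite act_A_R // act_Pi -antip_A_R // antipiK.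
Qed.

Section InvariantState.
Variables (h : A) (omega : M -> R[i]).
Hypothesis h_haar : haar_integral (alg_ops W) h.
Hypothesis omega_state : state omega.
Hypothesis omega_inv : invariant_functional T h omega.

Lemma lin_omega : lin (omega : M -> R[i]^o).
Proof. by move=> c m n; exact: state_linear. Qed.

(** Insert [h] on both sides by invariance and distribute it over the product; moving [b] from the
    first leg of [h] to the second is [D_right_integral]. *)
Lemma omega_act b m n : omega (T b m * n) = omega (m * T (S b) n).
Proof.
have oL := lin_omega; have [_ hr _ _] := h_haar.
pose f p q : R[i]^o := omega (T p m * T q n).
have fL : bil f.
  split=> z; rewrite /f; apply: (lin_comp oL); [apply: lin_mull | apply: lin_mulr];
  exact: lin_actl.
have e x y : omega (x * y) = \D_(p, q <- h) omega (T p x * T q y).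
  by rewrite -omega_inv act_prod (lin_sw _ _ oL).
rewrite e [RHS]e.
have := D_right_integral b hr fL; rewrite /f => E.
transitivity (\D_(p, q <- h) (omega (T (p * b) m * T q n) : R[i]^o)).
  by apply: eq_sw => p q; rewrite act_mul.
by rewrite E; apply: eq_sw => p q; rewrite act_mul.
Qed.

Lemma omega_star_act a m n :
  omega (vn_star (T a m) * n) = omega (vn_star m * T (st a) n).
Proof. by rewrite act_star omega_act /lower_star star_antip antipiK. Qed.

Variable G : gns omega.
Local Notation ket := (gket G).
Local Notation pi := (gns_rep G).

Lemma lin_gket : lin ket.
Proof. by move=> c m n; rewrite /gket (rep_linear (gns_repP G)). Qed.

Lemma gns_rep_gket m n : pi m (ket n) = ket (m * n).
Proof. by rewrite /gket (rep_mul (gns_repP G)). Qed.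

Lemma inner_gket m n : inner (ket m) (ket n) = omega (vn_star m * n).
Proof.
by rewrite {1}/gket (rep_star (gns_repP G)) gns_rep_gket /gket gns_state.
Qed.

Lemma gket_dense (x : G) e : 0 < e -> exists m, hnorm (x - ket m) < e.
Proof. exact: gns_cyclic. Qed.

Lemma lin_gns_repl xi : lin (fun m => pi m xi).
Proof. by move=> c m n; rewrite (rep_linear (gns_repP G)). Qed.

Lemma gns_rep_bounded m : bounded_operator (pi m).
Proof. exact: (rep_bounded (gns_repP G)). Qed.

Lemma lin_gns_repr m : lin (pi m).
Proof. exact: bounded_lin (gns_rep_bounded m). Qed.

(** The squared norm of [a ▷ m] is the sum of [r] times the squared norms of [e r ▷ m], which
    themselves sum to that of [m]. The nonnegative eigenvalues are bounded crudely by their sum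
    [K]. *)
Lemma act_bounded a : exists2 k : R[i], 0 <= k &
  forall m, hnorm (ket (T a m)) <= k * hnorm (ket m).
Proof.
have sa : st (st a * a) = st a * a by rewrite starM starK.
have pW := @star_proper _ _ W.
have [s [e sp]] := spectral_exists (starP W) pW sa.
pose K := \sum_(r <- s) r.
have s0 := spectral_ge0 (starP W) pW sp.
have K0 : 0 <= K by rewrite /K big_seq; apply: sumr_ge0.
have kL m : lin (fun b => omega (vn_star m * T b m) : R[i]^o).
  by apply: (lin_comp lin_omega); apply: lin_mulr; exact: lin_actl.
have ne r m : r \in s -> hnorm (ket (T (e r) m)) ^+ 2 = omega (vn_star m * T (e r) m).
  move=> rs; rewrite hnorm_sqr inner_gket omega_star_act -act_mul.
  by rewrite (spec_star sp rs) (spec_idem sp rs).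
have n1 m : hnorm (ket m) ^+ 2 = \sum_(r <- s) hnorm (ket (T (e r) m)) ^+ 2.
  rewrite hnorm_sqr inner_gket -{2}[m](act_one T) -(spec_sum sp) (lin_sum (kL m)).
  by rewrite big_seq [RHS]big_seq; apply: eq_bigr => r rs; rewrite ne.
exists (sqrtC K) => [|m]; first by rewrite sqrtC_ge0.
rewrite -(@ler_pXn2r _ 2) ?nnegrE ?mulr_ge0 ?sqrtC_ge0 ?hnorm_ge0 // exprMn (sqrtCK K).
rewrite [X in X <= _]hnorm_sqr inner_gket omega_star_act -act_mul.
rewrite (spectral_decomp sp) (lin_sum (kL m)) n1 mulr_sumr big_seq [X in _ <= X]big_seq.
apply: ler_sum => r rs; rewrite (linZ (kL m)) -ne // -[_ *: _]/(_ * _).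
rewrite ler_wpM2r ?exprn_ge0 ?hnorm_ge0 // /K (bigD1_seq r) ?(spec_uniq sp) //=.
rewrite lerDl big_seq_cond; apply: sumr_ge0 => q /andP[qs _]; exact: s0.
Qed.

Lemma action_exists : exists U : A -> G -> G,
  (forall a, bounded_operator (U a)) /\ (forall a m, U a (ket m) = ket (T a m)).
Proof.
have /choice[U UP] : forall a, exists Ua : G -> G,
    bounded_operator Ua /\ forall m, Ua (ket m) = ket (T a m).
  move=> a; have [k k0 kP] := act_bounded a.
  apply: (bounded_extension lin_gket gket_dense (g := fun m => ket (T a m)) _ k0 kP).
  exact: lin_comp lin_gket (lin_actr a).
by exists U; split=> a; have [] := UP a.
Qed.

Section Action.
Variable U : A -> G -> G.
Hypothesis U_bounded : forall a, bounded_operator (U a).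
Hypothesis U_gket : forall a m, U a (ket m) = ket (T a m).

Let dense_op := dense_eq gket_dense.

Lemma lin_Ur a : lin (U a). Proof. exact: bounded_lin. Qed.

Lemma lin_Ul xi : lin (fun a => U a xi).
Proof.
move=> c a b; move: xi; apply: dense_op => //.
  by apply: bounded_add => //; apply: bounded_scale.
by move=> m; rewrite !U_gket (lin_actl m) lin_gket.
Qed.

Lemma U_mul a b xi : U (a * b) xi = U a (U b xi).
Proof.
move: xi; apply: dense_op => [||m]; [exact: U_bounded | exact: bounded_comp |].
by rewrite !U_gket act_mul.
Qed.

Lemma U_1 xi : U 1 xi = xi.
Proof.
move: xi; apply: dense_op => [||m]; [exact: U_bounded | exact: bounded_id |].
by rewrite U_gket act_one.
Qed.

Lemma U_adj a xi eta : inner (U a xi) eta = inner xi (U (st a) eta).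
Proof.
apply: (dense_adjoint gket_dense) => // m n.
by rewrite !U_gket !inner_gket omega_star_act.
Qed.

Lemma U_cov a m xi : U a (pi m xi) = \D_(p, q <- a) pi (T p m) (U q xi).
Proof.
move: xi; apply: dense_op => [||n].
- exact: bounded_comp (U_bounded a) (gns_rep_bounded m).
- apply: bounded_sum => p; exact: bounded_comp (gns_rep_bounded _) (U_bounded _).
rewrite gns_rep_gket U_gket act_prod (lin_sw _ _ lin_gket); apply: eq_sw => p q.
by rewrite U_gket gns_rep_gket.
Qed.

Lemma U_A_L b xi : A_L b -> U b xi = pi (T b 1) xi.
Proof.
move=> bL; move: xi; apply: dense_op => [||m]; [exact: U_bounded | exact: gns_rep_bounded |].
by rewrite U_gket act_A_L // gns_rep_gket.
Qed.

End Action.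
End InvariantState.
End ModuleAlgebra.

(** * Crossed products *)

Section CrossedProduct.
Variables (R : realType) (A : falgType R[i]) (W : weakCstarHopf A).
Local Notation PiL := (PiL W).
Local Notation A_L := (A_L W).
Local Notation Si := (antipi W).
Local Notation "'\D_' ( a , b <- x ) F" := (sweedler (comul W x) (fun a b => F))
  (at level 41, F at level 41, a name, b name, x at level 35,
   format "'[' \D_ ( a ,  b  <-  x ) '/  '  F ']'").
Hint Resolve lin_PiL lin_PiR lin_antipi : lin.
Variables (M : vonNeumannAlgebra R) (T : moduleAlgebra W M).
Local Notation "x ⋅ y" := (cr_mul T x y) (at level 40, left associativity).
Local Notation crossed := (crossed T).
Local Notation cr := (cr T).

Let actB : bil (act T).
Proof. by split=> z; [exact: lin_actl | exact: lin_actr]. Qed.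

Lemma bil_cr : bil cr.
Proof. exact: bil_tens. Qed.
Let crB := bil_cr.

Lemma cr_A_L m b a : A_L b -> cr m (b * a) = cr (m * T b 1) a.
Proof. by move=> bL; apply: tens_balanced; exists b. Qed.

Lemma cr_Pi m y a : cr m (PiL y * a) = cr (m * T y 1) a.
Proof. by rewrite cr_A_L; [rewrite -act_Pi | exact: A_L_PiL]. Qed.

Lemma crossed_eq (Z : lmodType R[i]) (f g : crossed -> Z) : lin f -> lin g ->
  (forall m a, f (cr m a) = g (cr m a)) -> forall x, f x = g x.
Proof.
move=> fL gL fg x; rewrite [x]tens_sum (lin_sw _ _ fL) (lin_sw _ _ gL).
by apply: eq_sw => m a; exact: fg.
Qed.

Definition cr_mul_gen m a m' a' : crossed := \D_(p, q <- a) cr (m * T p m') (q * a').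
Local Notation CF := cr_mul_gen.

(** Write [y b] as [PiL(y_1 b) y_2]. The projection crosses the tensor sign as the action of [y_1 b]
    on [1_M], where the product rule reassembles the action on [m' (b ▷ 1_M)]. *)
Lemma bal_cr_mul_gen2 m a : bal (crossed_rel T) (CF m a).
Proof.
move=> m' ba' m'' a' [b bL [-> ->]]; rewrite /cr_mul_gen.
transitivity (\D_(s, y <- a) \D_(t, q <- y) cr (m * T s m') (PiL (t * b) * (q * a'))).
  apply: eq_sw => s y.
  have -> : y * (b * a') = (\D_(t, q <- y) (PiL (t * b) * q)) * a'.
    rewrite -(D_mulLr (f := fun t q => PiL t * q) y bL); last by lin_tac.
    by rewrite PiL_mull mulrA.
  rewrite sw_mulr (lin_sw _ _ (proj2 crB _)); apply: eq_sw => t q.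
  by rewrite mulrA.
rewrite -(@D_assoc _ _ W _ (fun s t q => cr (m * T s m') (PiL (t * b) * (q * a'))));
  last by lin_tac.
apply: eq_sw => p q; rewrite act_prod sw_mull (lin_sw _ _ (proj1 crB _)).
by apply: eq_sw => s t; rewrite cr_Pi mulrA act_mul.
Qed.

Lemma bil_cr_mul_gen2 m a : bil (CF m a).
Proof. by rewrite /cr_mul_gen; lin_tac. Qed.

Lemma bal_cr_mul_gen1 m' a' : bal (crossed_rel T) (fun m a => CF m a m' a').
Proof.
move=> m ba m'' a [b bL [-> ->]]; rewrite /cr_mul_gen.
rewrite (D_mulLl (f := fun p q => cr (m * T p m') (q * a')) a bL); last by lin_tac.
by apply: eq_sw => p q; rewrite act_mul act_A_L // mulrA.
Qed.

Lemma bil_cr_mul_gen1 m' a' : bil (fun m a => CF m a m' a').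
Proof. by rewrite /cr_mul_gen; lin_tac. Qed.

Lemma cr_mul_crl m a y : cr m a ⋅ y = sweedler y (CF m a).
Proof.
rewrite /cr_mul sw_tens // => [|v w v' w' e]; last first.
  by apply: eq_sw => m' a'; exact: (@bal_cr_mul_gen1 _ _ _ _ _ _ e).
split=> z; apply: lin_swr => m' a'.
- exact: (proj1 (bil_cr_mul_gen1 m' a')).
- exact: (proj2 (bil_cr_mul_gen1 m' a')).
Qed.

Lemma cr_mul_cr m a m' a' : cr m a ⋅ cr m' a' = CF m a m' a'.
Proof.
by rewrite cr_mul_crl sw_tens //; [exact: bil_cr_mul_gen2 | exact: bal_cr_mul_gen2].
Qed.

Lemma lin_cr_mull y : lin (fun x => x ⋅ y).
Proof.
apply: sw_lin => [|m a m' a' e]; last first.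
  by apply: eq_sw => m'' a''; exact: (@bal_cr_mul_gen1 _ _ _ _ _ _ e).
split=> z; apply: lin_swr => m' a'.
- exact: (proj1 (bil_cr_mul_gen1 m' a')).
- exact: (proj2 (bil_cr_mul_gen1 m' a')).
Qed.

Lemma lin_cr_mulr x : lin (fun y => x ⋅ y).
Proof.
apply: lin_bigsum => p.
by apply: sw_lin; [exact: bil_cr_mul_gen2 | exact: bal_cr_mul_gen2].
Qed.

Let mulB : bil (cr_mul T).
Proof. by split=> z; [exact: lin_cr_mull | exact: lin_cr_mulr]. Qed.

Lemma cr_mulA : associative (cr_mul T).
Proof.
move=> x y z; move: x; apply: crossed_eq; [by lin_tac | by lin_tac | move=> m a].
move: y; apply: crossed_eq; [by lin_tac | by lin_tac | move=> m' a'].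
move: z; apply: crossed_eq; [by lin_tac | by lin_tac | move=> m'' a''].
rewrite !cr_mul_cr /cr_mul_gen (lin_sw _ _ (lin_cr_mulr _)) (lin_sw _ _ (lin_cr_mull _)).
transitivity (\D_(s, t <- a') \D_(p, q <- a) \D_(p1, p2 <- p)
    cr (m * T p1 m' * T (p2 * s) m'') (q * t * a'')).
  apply: eq_sw => s t; rewrite cr_mul_cr; apply: eq_sw => p q.
  rewrite act_prod sw_mull (lin_sw _ _ (proj1 crB _)); apply: eq_sw => p1 p2.
  by rewrite act_mul !mulrA.
rewrite [LHS]swap_sw.
transitivity (\D_(p, q <- a) \D_(p1, p2 <- p) \D_(s, t <- a')
    cr (m * T p1 m' * T (p2 * s) m'') (q * t * a'')).
  by apply: eq_sw => p q; rewrite [LHS]swap_sw.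
rewrite (@D_assoc _ _ W _ (fun p1 p2 q => \D_(s, t <- a')
    cr (m * T p1 m' * T (p2 * s) m'') (q * t * a''))); last by lin_tac.
apply: eq_sw => p q; rewrite cr_mul_cr /cr_mul_gen [RHS]D_mul //; last by lin_tac.
Qed.

(** The second leg of [Δ(1)] may be taken in [A_L] and crosses to the left; the product rule then
    yields the action of 1 on [m']. *)
Lemma cr_mul_M m m' a : cr m 1 ⋅ cr m' a = cr (m * m') a.
Proof.
rewrite cr_mul_cr /cr_mul_gen.
transitivity (\D_(p, q <- 1) cr (m * (T p m' * T q 1)) a).
  apply: D_1_eq => [||p q pR qL]; [by lin_tac | by lin_tac |].
  by rewrite cr_A_L // mulrA.
have cL : lin (fun n => cr (m * n) a) by lin_tac.
by rewrite -(lin_sw _ _ cL) -act_prod mulr1 act_one.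
Qed.

Lemma cr_split m a : cr m a = cr m 1 ⋅ cr 1 a.
Proof. by rewrite cr_mul_M mulr1. Qed.

Section Ideal.
Variable h : A.
Hypothesis h_haar : haar_integral (alg_ops W) h.

(** The left-integral property replaces [a_2 h] by [PiL(a_2) h]; the projection crosses to [M] and
    completes the product rule for [m * 1]. *)
Lemma cr_mul_haar n a m : cr n a ⋅ cr m h = cr (n * T a m) h.
Proof.
have /haar_integralE[hl _ _ _] := h_haar.
have cL : lin (fun x => cr (n * x) h) by lin_tac.
rewrite cr_mul_cr /cr_mul_gen -{2}[m]mulr1 act_prod (lin_sw _ _ cL).
by apply: eq_sw => p q; rewrite hl cr_Pi mulrA.
Qed.

(** [D_right_integral] at [Si a] moves [a], which is [S (Si a)], from the second leg of [h] to the
    first, where it acts on [m]. *)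
Lemma haar_cr_mul m a : cr 1 h ⋅ cr m a = cr 1 h ⋅ cr (T (Si a) m) 1.
Proof.
have [_ hr _ _] := h_haar; rewrite !cr_mul_cr /cr_mul_gen.
have := D_right_integral (Si a) (f := fun p q => cr (1 * T p m) q) hr.
rewrite antipiK => <-; last by lin_tac.
by apply: eq_sw => p q; rewrite act_mul mulr1.
Qed.

Definition MhM_gen m m' : crossed := cr m 1 ⋅ cr 1 h ⋅ cr m' 1.

Lemma lin_MhM_genl m' : lin (fun m => MhM_gen m m').
Proof. by rewrite /MhM_gen; lin_tac. Qed.

Lemma MhM_gen_in m m' : MhM T h (MhM_gen m m').
Proof. by exists [:: (m, m')]; rewrite big_seq1. Qed.

Lemma MhM_0 : MhM T h 0.
Proof. by exists [::]; rewrite big_nil. Qed.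

Lemma MhM_lin c x y : MhM T h x -> MhM T h y -> MhM T h (c *: x + y).
Proof.
move=> [s ->] [t ->]; exists ([seq (c *: p.1, p.2) | p <- s] ++ t).
rewrite big_cat big_map scaler_sumr; congr (_ + _); apply: eq_bigr => p _.
exact: (esym (linZ (lin_MhM_genl _) _ _)).
Qed.

Lemma MhM_sum I (r : seq I) (F : I -> crossed) :
  (forall i, MhM T h (F i)) -> MhM T h (\sum_(i <- r) F i).
Proof.
move=> HF; elim: r => [|i r IH]; first by rewrite big_nil; exact: MhM_0.
by rewrite big_cons -[F i]scale1r; exact: MhM_lin.
Qed.

Lemma MhM_genE m m' : MhM_gen m m' = cr m h ⋅ cr m' 1.
Proof. by rewrite /MhM_gen -cr_split. Qed.

Lemma MhM_ideal : two_sided_ideal (MhM T h).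
Proof.
split; [exact: MhM_0 | exact: MhM_lin | move=> x y [s ->] | move=> x y [s ->]].
- rewrite (lin_sum (lin_cr_mulr x)); apply: MhM_sum => p.
  rewrite -/(MhM_gen _ _) [x]tens_sum (lin_sw _ _ (lin_cr_mull _)).
  apply: MhM_sum => q; rewrite MhM_genE cr_mulA cr_mul_haar -MhM_genE.
  exact: MhM_gen_in.
- rewrite (lin_sum (lin_cr_mull y)); apply: MhM_sum => p.
  rewrite -/(MhM_gen _ _) [y]tens_sum (lin_sw _ _ (lin_cr_mulr _)).
  apply: MhM_sum => q; rewrite /MhM_gen -!cr_mulA cr_mul_M haar_cr_mul !cr_mulA.
  exact: MhM_gen_in.
Qed.

End Ideal.
End CrossedProduct.

(** * The scalar product on [Hs ⊗ A] *)

Section TensorInner.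
Variables (R : realType) (A : falgType R[i]) (W : weakCstarHopf A).
Local Notation st := (star W).
Hint Resolve lin_PiL lin_PiR lin_antipi : lin.
Variables (H : 'Hom(A, R[i]^o)) (Hs : hilbertSpace R).
Hypothesis H_star : forall x, H (st x) = (H x)^*.
Hypothesis H_pos : forall x, 0 <= H (x * st x).
Hypothesis H_faithful : forall x, H (x * st x) = 0 -> x = 0.

Let B (x y : A) : R[i] := H (st x * y).
Let HL : lin H. Proof. exact: lin_linear. Qed.
Let B_lin x : lin (B x : A -> R[i]^o). Proof. by rewrite /B; lin_tac. Qed.
Let B_herm x y : B y x = (B x y)^*.
Proof. by rewrite /B -H_star starM starK. Qed.
Let B_ge0 x : 0 <= B x x.
Proof. by rewrite /B -{2}[x](starK W). Qed.
Let B_def x : B x x = 0 -> x = 0.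
Proof. by rewrite /B -{2}[x](starK W) => /H_faithful /(congr1 st); rewrite starK star0. Qed.

(** The form [tinner] over an arbitrary Hilbert space; for the GNS space the two are convertible. *)
Definition tensor_inner (s t : Hs ⊗ A) : R[i] :=
  sweedler s (fun xi a => sweedler t (fun (eta : Hs) b => inner xi eta * H (st a * b))).

Let bil_inner xi a : bil (fun (eta : Hs) b => inner xi eta * H (st a * b) : R[i]^o).
Proof.
by split=> z; [apply: lin_smull; exact: inner_lin | lin_tac].
Qed.

Lemma lin_tensor_inner s : lin (tensor_inner s : Hs ⊗ A -> R[i]^o).
Proof. by apply: lin_bigsum => p; apply: sw_lin. Qed.

Lemma tensor_inner_herm s t : tensor_inner t s = (tensor_inner s t)^*.
Proof.
rewrite /tensor_inner /sweedler cconj_sum [LHS]exchange_big; apply: eq_bigr => p _ /=.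
rewrite cconj_sum; apply: eq_bigr => q _.
by rewrite cconjM -inner_herm -H_star starM starK.
Qed.

(** Second legs are expanded in the family given by [orthonormal_exists] for the form of [H];
    positivity and definiteness are thereby reduced to those of [Hs]. *)
Lemma tensor_inner_gram t : exists u : seq A, exists zeta : A -> Hs,
  t = \sum_(v <- u) zeta v ⊗ v /\
  tensor_inner t t = \sum_(v <- u) inner (zeta v) (zeta v).
Proof.
have [u uP] := orthonormal_exists B_lin B_herm B_ge0 B_def.
exists u, (fun v => sweedler t (fun z b => B v b *: z)); split.
  rewrite {1}[t]tens_sum.
  transitivity (sweedler t (fun z b => \sum_(v <- u) (B v b *: z) ⊗ v)).
    apply: eq_sw => z b; rewrite {1}[b]uP (lin_sum (@lin_tensr _ _ _ _ z)).
    by apply: eq_bigr => v _; rewrite tensZr tensZl.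
  rewrite sw_sumr; apply: eq_bigr => v _.
  by rewrite (lin_sw _ _ (@lin_tensl _ _ _ _ v)).
rewrite -(@gram_sum _ _ B B_lin B_herm Hs R[i]^o (@inner R Hs) u _ (repr t) fst snd uP).
- apply: eq_bigr => p _; apply: eq_bigr => q _; exact: mulrC.
- exact: inner_lin.
- by move=> y c x x'; rewrite inner_alin.
Qed.

Lemma tensor_inner_ge0 t : 0 <= tensor_inner t t.
Proof.
have [u [zeta [_ ->]]] := tensor_inner_gram t.
by apply: sumr_ge0 => v _; exact: inner_ge0.
Qed.

Lemma tensor_inner_def t : tensor_inner t t = 0 -> t = 0.
Proof.
have [u [zeta [-> ->]]] := tensor_inner_gram t.
move=> /eqP; rewrite psumr_eq0 => [/allP z0|v _]; last exact: inner_ge0.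
rewrite big_seq big1 // => v /z0 /= /eqP /inner_def ->.
by rewrite (lin0 (@lin_tensl _ _ _ _ v)).
Qed.

Lemma tensor_inner_parallelogram s t :
  tensor_inner (s - t) (s - t) <= (tensor_inner s s + tensor_inner t t) *+ 2.
Proof.
have BR x y z : tensor_inner x (y - z) = tensor_inner x y - tensor_inner x z.
  exact: (linB (lin_tensor_inner x)).
have DR x y z : tensor_inner x (y + z) = tensor_inner x y + tensor_inner x z.
  exact: (linD (lin_tensor_inner x)).
have BL x y z : tensor_inner (x - y) z = tensor_inner x z - tensor_inner y z.
  by rewrite tensor_inner_herm BR rmorphB /= -!tensor_inner_herm.
have DL x y z : tensor_inner (x + y) z = tensor_inner x z + tensor_inner y z.
  by rewrite tensor_inner_herm DR rmorphD /= -!tensor_inner_herm.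
have -> : (tensor_inner s s + tensor_inner t t) *+ 2 =
    tensor_inner (s - t) (s - t) + tensor_inner (s + t) (s + t).
  by rewrite BR !BL DR !DL mulr2n; ring.
by rewrite lerDl tensor_inner_ge0.
Qed.

(* The parallelogram law avoids comparing the two isometries by Cauchy-Schwarz. *)
Lemma isometry_dense_unique (V : lmodType R[i]) (D : V -> Hs) (I J : Hs -> Hs ⊗ A) :
  (forall x e, 0 < e -> exists m, hnorm (x - D m) < e) ->
  lin I -> lin J ->
  (forall x y, tensor_inner (I x) (I y) = inner x y) ->
  (forall x y, tensor_inner (J x) (J y) = inner x y) ->
  (forall m, I (D m) = J (D m)) -> forall x, I x = J x.
Proof.
move=> dense IL JL II JJ IJ x; apply/eqP; rewrite -subr_eq0; apply/eqP.
apply: tensor_inner_def; apply/eqP; rewrite eq_le tensor_inner_ge0 andbT.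
(* The parallelogram law gives a factor 2 for each of the two isometries, and [x] is approximated
   within [sqrtC e]. *)
apply: (le_eps (k := 4%:R)); rewrite ?real0 ?ger0_real ?tensor_inner_ge0 ?ler0n // => e e0.
have [m xm] := dense x (sqrtC e) ltac:(by rewrite sqrtC_gt0).
have -> : I x - J x = I (x - D m) - J (x - D m).
  by rewrite (linB IL) (linB JL) IJ subrACA4 subrr subr0.
apply: le_trans (tensor_inner_parallelogram _ _) _.
rewrite II JJ -hnorm_sqr add0r -mulr2n -mulrnA -[X in X <= _]mulr_natl.
apply: (ler_wpM2l (ler0n _ 4)).
by rewrite -[e]sqrtCK ler_pXn2r ?nnegrE ?hnorm_ge0 ?sqrtC_ge0 ?ltW.
Qed.

End TensorInner.

(** * The isometry *)

Section Isometry.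
Variables (R : realType) (A : falgType R[i]) (W : weakCstarHopf A).
Local Notation S := (antip W).
Local Notation st := (star W).
Local Notation PiL := (PiL W).
Local Notation A_L := (A_L W).
Local Notation Si := (antipi W).
Local Notation "'\D_' ( a , b <- x ) F" := (sweedler (comul W x) (fun a b => F))
  (at level 41, F at level 41, a name, b name, x at level 35,
   format "'[' \D_ ( a ,  b  <-  x ) '/  '  F ']'").
Hint Resolve lin_PiL lin_PiR lin_antipi : lin.
Variables (M : vonNeumannAlgebra R) (T : moduleAlgebra W M).
Variables (h : A) (H : 'Hom(A, R[i]^o)) (gL : A) (omega : M -> R[i]) (G : gns omega).
Hypothesis h_haar : haar_integral (alg_ops W) h.
Hypothesis H_haar : haar_functional W H.
Hypothesis gL_pos : positive_elt st gL.
Hypothesis gL_sq : gL * gL = expect W H h.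
Hypothesis omega_state : state omega.
Hypothesis omega_inv : invariant_functional T h omega.
Variable U : A -> G -> G.
Hypothesis U_bounded : forall a, bounded_operator (U a).
Hypothesis U_gket : forall a m, U a (gket G m) = gket G (T a m).

Local Notation ket := (gket G).
Local Notation pi := (gns_rep G).
Local Notation cr := (cr T).
Local Notation "x ⋅ y" := (cr_mul T x y) (at level 40, left associativity).
Local Notation l0 := (h * gL^-1).

Let actB : bil (act T).
Proof. by split=> z; [exact: lin_actl | exact: lin_actr]. Qed.
Let piB : bil (gns_rep G).
Proof. by split=> z; [exact: lin_gns_repl | exact: lin_gns_repr]. Qed.
Let UB : bil U.
Proof. by split=> z; [exact: lin_Ul | exact: lin_Ur]. Qed.
Let HL : lin H. Proof. exact: lin_linear. Qed.
Let ketL : lin ket. Proof. exact: lin_gket. Qed.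

Let gU : gL \is a GRing.unit := gL_unit h_haar H_haar gL_sq.
Let gVL : A_L gL^-1 := A_L_gLV h_haar H_haar gL_pos gL_sq.
Let gLL : A_L gL := A_L_gL H_haar gL_pos gL_sq.

Lemma left_integral_l0 : left_integral (alg_ops W) l0.
Proof.
by apply/left_integralE => a; have /haar_integralE[hl _ _ _] := h_haar; rewrite !mulrA hl.
Qed.

Lemma star_l0 : st l0 = gL^-1 * h.
Proof. by rewrite starM (haar_star h_haar) (star_gLV h_haar H_haar gL_pos gL_sq). Qed.

Definition Lambda_gen (m : M) (a : A) (xi : G) (b : A) : G ⊗ A :=
  \D_(p, q <- a) \D_(s, t <- b) (pi (T (Si (p * s)) m) xi ⊗ (q * t)).
Local Notation LF := Lambda_gen.

Lemma bil_Lambda_gen2 m a : bil (LF m a).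
Proof. by rewrite /Lambda_gen; lin_tac. Qed.

Lemma bil_Lambda_gen1 xi b : bil (fun m a => LF m a xi b).
Proof. by rewrite /Lambda_gen; lin_tac. Qed.

Lemma bal_Lambda_gen xi b : bal (crossed_rel T) (fun m a => LF m a xi b).
Proof.
move=> m ca m' a [c cL [-> ->]]; rewrite /Lambda_gen.
rewrite (D_mulLl (f := fun p q =>
  \D_(s, t <- b) (pi (T (Si (p * s)) m) xi ⊗ (q * t))) a cL); last by lin_tac.
apply: eq_sw => p q; apply: eq_sw => s t.
by rewrite -[c * p * s]mulrA antipiM act_mul (act_antipi T m cL).
Qed.

Lemma LambdaE x t : Lambda T x t = sweedler x (fun m a => sweedler t (LF m a)).
Proof.
apply: eq_sw => m a; apply: eq_sw => xi b; apply: eq_sw => p q; apply: eq_sw => s r.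
by rewrite antip_invE.
Qed.

Lemma Lambda_cr m a t : Lambda T (cr m a) t = sweedler t (LF m a).
Proof.
rewrite LambdaE sw_tens // => [|v w v' w' e].
  split=> z; apply: lin_swr => xi b; first exact: (proj1 (bil_Lambda_gen1 xi b) z).
  exact: (proj2 (bil_Lambda_gen1 xi b) z).
by apply: eq_sw => xi b; exact: (@bal_Lambda_gen _ _ _ _ _ _ e).
Qed.

Lemma cketE m a : cket T G m a = \D_(p, q <- a) (ket (T (Si p) m) ⊗ q).
Proof.
rewrite /cket Lambda_cr sw_tens //; last exact: bil_Lambda_gen2.
rewrite -[a in RHS]mulr1 [RHS]D_mul //.
by lin_tac; exact: (@lin_antipi _ _ W).
Qed.

(** The formula [cketE] at [l0], with the action on [M] replaced by its bounded extension [U] so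
    that every vector is allowed. *)
Definition cross_isometry (xi : G) : G ⊗ A := \D_(p, q <- l0) (U (Si p) xi ⊗ q).
Local Notation V := cross_isometry.

Lemma lin_cross_isometry : lin V.
Proof. by rewrite /cross_isometry; lin_tac. Qed.

Lemma cross_isometry_gket m : V (ket m) = cket T G m l0.
Proof. by rewrite cketE; apply: eq_sw => p q; rewrite U_gket. Qed.

(** Covariance unites the two actions into [U (Si n)]. The left-integral identity moves [d] off the
    second leg, where [Si] turns it into [U d] in front of [pi]. Covariance again brings out
    [a_2 Si(a_1)], which is [Si (PiL _)]: it multiplies [m] on the right and is absorbed into [U] as
    [PiL(a_1) a_2 = a]. *)
Lemma Lambda_cr_isometry m a xi : Lambda T (cr m a) (V xi) = V (pi m (U a xi)).
Proof.
have piA x y eta : pi (x * y) eta = pi x (pi y eta) by rewrite (rep_mul (gns_repP G)).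
rewrite Lambda_cr.
have lL := sw_lin (bil_Lambda_gen2 m a) (@bal_no_rel _ _ _ _ _).
rewrite /cross_isometry (lin_sw _ _ lL).
transitivity (\D_(c, d <- a) \D_(n, t <- l0) \D_(p, s <- n)
    (pi (T (Si (c * s)) m) (U (Si p) xi) ⊗ (d * t))).
  transitivity (\D_(p, q <- l0) \D_(s, t <- q) \D_(c, d <- a)
      (pi (T (Si (c * s)) m) (U (Si p) xi) ⊗ (d * t))).
    apply: eq_sw => p q; rewrite sw_tens //; last exact: bil_Lambda_gen2.
    by rewrite /Lambda_gen [LHS]swap_sw.
  rewrite -(@D_assoc _ _ W _ (fun p s t => \D_(c, d <- a)
      (pi (T (Si (c * s)) m) (U (Si p) xi) ⊗ (d * t)))); last by lin_tac.
  rewrite [RHS]swap_sw; apply: eq_sw => n t.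
  by rewrite [RHS]swap_sw.
transitivity (\D_(c, d <- a) \D_(n, t <- l0) (U (Si n) (U d (pi (T (Si c) m) xi)) ⊗ t)).
  apply: eq_sw => c d.
  transitivity (\D_(n, t <- l0) (U (Si n) (pi (T (Si c) m) xi) ⊗ (d * t))).
    apply: eq_sw => n t; rewrite (U_cov U_bounded U_gket).
    rewrite (@D_antipi _ _ W _ (fun x y => pi (T x (T (Si c) m)) (U y xi)));
      last by lin_tac.
    rewrite (lin_sw _ _ (@lin_tensl _ _ _ _ (d * t))); apply: eq_sw => p s.
    by rewrite antipiM act_mul.
  rewrite (D_left_integral d (f := fun n t => U (Si n) (pi (T (Si c) m) xi) ⊗ t)
    left_integral_l0); last by lin_tac.
  by apply: eq_sw => n t; rewrite antipiM antipK (U_mul U_bounded U_gket).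
rewrite [LHS]swap_sw; apply: eq_sw => n t.
have gL' : lin (fun eta => U (Si n) eta ⊗ t) by lin_tac.
rewrite -(lin_sw _ _ gL'); congr (U _ _ ⊗ _).
transitivity (\D_(x, q <- a) \D_(c, p <- x) pi (T (p * Si c) m) (U q xi)).
  rewrite (@D_assoc _ _ W _ (fun c p q => pi (T (p * Si c) m) (U q xi)));
    last by lin_tac.
  apply: eq_sw => c d; rewrite (U_cov U_bounded U_gket); apply: eq_sw => p q.
  by rewrite act_mul.
transitivity (\D_(x, q <- a) pi m (U (PiL x * q) xi)).
  apply: eq_sw => x q.
  have fL : lin (fun z => pi (T z m) (U q xi)) by lin_tac.
  rewrite -(lin_sw _ _ fL) -antipi_PiL act_antipi; last exact: A_L_PiL.
  rewrite piA (U_mul U_bounded U_gket); congr (pi _ _).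
  by rewrite (U_A_L U_bounded U_gket _ (A_L_PiL W x)).
have fL : lin (fun z => pi m (U z xi)) by lin_tac.
by rewrite -(lin_sw _ _ fL) PiL_mull.
Qed.

Definition coisometry_gen (eta : G) (b : A) : G :=
  \D_(p, q <- st l0) (H (q * b) *: U (S p) eta).
Definition cross_coisometry (t : G ⊗ A) : G := sweedler t coisometry_gen.
Local Notation Vs := cross_coisometry.

Lemma bil_coisometry_gen : bil coisometry_gen.
Proof. by rewrite /coisometry_gen; lin_tac. Qed.

Lemma lin_cross_coisometry : lin Vs.
Proof. by apply: sw_lin; [exact: bil_coisometry_gen | ]. Qed.

(** The left-integral identity carries [q] to the first leg of [l0], whose sum becomes
    [Si (expect l0)]. What remains is [S(x_1) S(gL) x_2] for [x = st l0], and this is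
    [PiR h = 1]. *)
Lemma cross_coisometryK xi : Vs (V xi) = xi.
Proof.
rewrite /cross_isometry (lin_sw _ _ lin_cross_coisometry).
transitivity (\D_(s, t <- l0) coisometry_gen (U (Si s) xi) t).
  by apply: eq_sw => s t; rewrite /cross_coisometry sw_tens //; exact: bil_coisometry_gen.
pose Z := \D_(p, q <- st l0) \D_(s, t <- l0) (H (q * t) *: (S p * Si s)).
transitivity (U Z xi).
  rewrite /Z /coisometry_gen (lin_sw _ _ (proj1 UB xi)).
  rewrite [LHS]swap_sw; apply: eq_sw => p q; rewrite (lin_sw _ _ (proj1 UB xi)).
  apply: eq_sw => s t; rewrite (linZ (proj1 UB xi)) (U_mul U_bounded U_gket) //.
suff -> : Z = 1 by rewrite (U_1 U_bounded U_gket).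
(* One factor [gL] survives here; the [gL^-1] in [st l0] cancels it below. *)
have EE : expect W H l0 = gL.
  by rewrite (expect_mulr H_haar) // -gL_sq mulrK.
transitivity (\D_(p, q <- st l0) (S p * S gL * q)).
  apply: eq_sw => p q.
  rewrite (D_left_integral q (f := fun s t => H t *: (S p * Si s)) left_integral_l0);
    last by lin_tac.
  rewrite -(antipi_gL h_haar H_haar gL_pos gL_sq) -{2}EE /expect.
  rewrite (lin_sw _ _ (@lin_antipi _ _ W)) sw_mull sw_mulr; apply: eq_sw => s t.
  by rewrite antipiM antipK (linZ (@lin_antipi _ _ W)) -scalerAr -scalerAl mulrA.
have /haar_integralE[_ _ h1 _] := h_haar.
rewrite star_l0 (D_mulLl (f := fun p q => S p * S gL * q) h gVL); last by lin_tac.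
rewrite -h1 PiR_def; apply: eq_sw => p q.
by rewrite antipM -[S p * _ * _]mulrA (antip_gLV h_haar H_haar gL_sq) mulr1.
Qed.

(** The right-integral identity frees [h_1 H(h_2)] from [d], so the sum over [h] is explicit. The
    remaining [d S(gL) Si(c)] is [Si (PiL (a * gL))], which acts by right multiplication. *)
Lemma cross_coisometry_cket m a : Vs (cket T G m a) = ket (m * T (a * gL) 1).
Proof.
rewrite cketE (lin_sw _ _ lin_cross_coisometry).
transitivity (\D_(c, d <- a) ket (T (\D_(p, q <- st l0) (H (q * d) *: (S p * Si c))) m)).
  apply: eq_sw => c d; rewrite /cross_coisometry sw_tens //; last exact: bil_coisometry_gen.
  have kL : lin (fun z => ket (T z m)) by lin_tac.
  rewrite (lin_sw _ _ kL); apply: eq_sw => p q.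
  by rewrite U_gket (linZ kL) act_mul.
have [_ hr _ _] := h_haar.
have kL : lin (fun z => ket (T z m)) by lin_tac.
rewrite -(lin_sw _ _ kL); congr (ket _).
transitivity (T (Si (PiL (a * gL))) m); last first.
  by rewrite act_antipi -?act_Pi //; exact: A_L_PiL.
congr (T _ m); rewrite antipi_PiL.
rewrite (D_mulLr (f := fun c d => d * Si c) a gLL); last by lin_tac.
apply: eq_sw => c d.
rewrite star_l0 (D_mulLl (f := fun p q => H (q * d) *: (S p * Si c)) h gVL);
  last by lin_tac.
rewrite -{1}(antipiK W d).
rewrite -(D_right_integral (Si d)
  (f := fun p q => H q *: (S (gL^-1 * p) * Si c)) hr); last by lin_tac.
(* Of the two factors in [expect h = gL * gL], one is spent on the [gL^-1] of [st l0]; the other is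
   the [gL] in [a * gL]. *)
have SE : S gL * S gL * S gL^-1 = S gL.
  by rewrite -mulrA -antipM mulVr // antip1 mulr1.
rewrite antipiM (antipi_gL h_haar H_haar gL_pos gL_sq) -SE -antipM gL_sq /expect.
rewrite (lin_sw _ _ (lin_antip W)) !sw_mulr sw_mull; apply: eq_sw => p q.
rewrite (linZ (lin_antip W)) !antipM antipiK -!scalerAl -scalerAr.
by rewrite !mulrA.
Qed.

Let H_star x : H (st x) = (H x)^*.
Proof. exact: (haar_functional_star H_haar). Qed.

(** [D_star] matches the legs of [st l0] with those of [l0], and the adjoint of [U (S (st p))] is
    [U (Si p)] by the definition of [antipi]. *)
Lemma cross_coisometry_adjoint t xi : inner (Vs t) xi = tensor_inner W H t (V xi).
Proof.
rewrite /cross_coisometry /tensor_inner /sweedler inner_suml; apply: eq_bigr => r _.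
rewrite -/(sweedler _ (fun eta b => inner r.1 eta * H (st r.2 * b))).
have iB : bil (fun (eta : G) b => inner r.1 eta * H (st r.2 * b) : R[i]^o).
  by split=> z; [apply: lin_smull; exact: inner_lin | lin_tac].
have iL := sw_lin iB (@bal_no_rel _ _ _ _ _).
rewrite /cross_isometry (lin_sw _ _ iL) /coisometry_gen D_star; last by lin_tac.
rewrite /sweedler inner_suml; apply: eq_bigr => p _ /=.
rewrite -/(sweedler _ (fun eta b => inner r.1 eta * H (st r.2 * b))).
rewrite (sw_tens (Z := R[i]^o)) // innerZl -H_star starM starK mulrC.
by rewrite (U_adj h_haar omega_state omega_inv U_bounded U_gket).
Qed.

Lemma cross_isometryP xi eta : tensor_inner W H (V xi) (V eta) = inner xi eta.
Proof. by rewrite -cross_coisometry_adjoint cross_coisometryK. Qed.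

(** For the left integral [l0], [a gL l0] is [PiL(a gL) l0], and the projection crosses to [M]. *)
Lemma cross_isometry_cket m a : V (Vs (cket T G m a)) = cket T G m (a * gL * l0).
Proof.
have /left_integralE lI := left_integral_l0.
by rewrite cross_coisometry_cket cross_isometry_gket /cket lI -cr_Pi.
Qed.

(** The extended representation in closed form, independent of [V]; [pi_extE] identifies it with
    compression by [V]. Its algebraic laws are easier to verify here. *)
Definition gns_ext (x : crossed T) (xi : G) : G := sweedler x (fun m a => pi m (U a xi)).
Local Notation Pi := gns_ext.

Let bil_gns_ext xi : bil (fun m a => pi m (U a xi)).
Proof. by lin_tac. Qed.

Let bal_gns_ext xi : bal (crossed_rel T) (fun m a => pi m (U a xi)).
Proof.
move=> m ba m' a [b bL [-> ->]].
by rewrite (rep_mul (gns_repP G)) (U_mul U_bounded U_gket) (U_A_L U_bounded U_gket).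
Qed.

Lemma Lambda_isometry x xi : Lambda T x (V xi) = V (Pi x xi).
Proof.
rewrite LambdaE (lin_sw _ _ lin_cross_isometry); apply: eq_sw => m a.
by rewrite -Lambda_cr_isometry Lambda_cr.
Qed.

Lemma pi_extE x xi : pi_ext T V Vs x xi = Pi x xi.
Proof. by rewrite /pi_ext Lambda_isometry cross_coisometryK. Qed.

Lemma gns_ext_cr m a xi : Pi (cr m a) xi = pi m (U a xi).
Proof. by rewrite /gns_ext sw_tens. Qed.

Lemma lin_gns_ext xi : lin (fun x => Pi x xi).
Proof. exact: sw_lin. Qed.

Lemma gns_ext_bounded x : bounded_operator (Pi x).
Proof.
apply: bounded_sum => p; exact: bounded_comp (gns_rep_bounded G p.1) (U_bounded p.2).
Qed.

Lemma gns_ext_mul x y xi : Pi (x ⋅ y) xi = Pi x (Pi y xi).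
Proof.
move: x; apply: crossed_eq => [||m a]; last 1 first.
- move: y; apply: crossed_eq => [||m' a'].
  + apply: (lin_comp (lin_gns_ext xi)); exact: lin_cr_mulr.
  + exact: (lin_comp (bounded_lin (gns_ext_bounded _)) (lin_gns_ext xi)).
  rewrite cr_mul_cr /cr_mul_gen (lin_sw _ _ (lin_gns_ext xi)) !gns_ext_cr.
  rewrite (U_cov U_bounded U_gket) (lin_sw _ _ (proj2 piB m)); apply: eq_sw => p q.
  by rewrite gns_ext_cr (U_mul U_bounded U_gket) (rep_mul (gns_repP G)).
- apply: (lin_comp (lin_gns_ext xi)); exact: lin_cr_mull.
- exact: lin_gns_ext.
Qed.

Lemma gns_ext_star x xi eta : inner (Pi x xi) eta = inner xi (Pi (cr_star T x) eta).
Proof.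
rewrite /cr_star (lin_sw _ _ (lin_gns_ext eta)) [in LHS]/gns_ext /sweedler.
rewrite inner_suml inner_sumr.
apply: eq_bigr => p _; rewrite gns_ext_mul !gns_ext_cr.
rewrite (rep_star (gns_repP G)) (U_adj h_haar omega_state omega_inv U_bounded U_gket).
by rewrite (rep_one (gns_repP G)) (U_1 U_bounded U_gket).
Qed.

Lemma gns_ext_star_representation :
  star_representation (cr_mul T) (cr_one T) (cr_star T) Pi.
Proof.
split.
- exact: gns_ext_bounded.
- by move=> c x y xi; exact: lin_gns_ext.
- exact: gns_ext_mul.
- by move=> xi; rewrite gns_ext_cr (rep_one (gns_repP G)) (U_1 U_bounded U_gket).
- exact: gns_ext_star.
Qed.

Hypothesis omega_faithful : faithful_functional omega.

Lemma gket_inj m : ket m = 0 -> m = 0.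
Proof.
move=> m0; apply: omega_faithful.
by rewrite -(inner_gket G) m0 inner0r.
Qed.

Lemma alin_vn_star : alin (@vn_star R M : M -> M).
Proof. exact: (star_semilinear (vn_starP M)). Qed.

(** [k m h] is [n h] for a single [n] in [M], and the GNS vector of [n] is [k] applied to that of
    [m]; faithfulness makes [n] vanish. *)
Lemma ker_mul_haarl k m : (forall xi, Pi k xi = 0) -> k ⋅ cr m h = 0.
Proof.
move=> k0; rewrite [k]tens_sum (lin_sw _ _ (lin_cr_mull _)).
under eq_sw => n a do rewrite -/(cr n a) cr_mul_haar //.
have cL : lin (fun x => cr x h) by exact: (proj1 (bil_cr T)).
rewrite -(lin_sw _ _ cL) (_ : sweedler k _ = 0) ?(lin0 cL) //.
apply: gket_inj; rewrite (lin_sw _ _ ketL) -[RHS](k0 (ket m)).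
by apply: eq_sw => n a; rewrite U_gket gns_rep_gket.
Qed.

(** [h k] is [h] times a single element of [M]. The GNS vector of its adjoint pairs with [eta] as
    the cyclic vector does with [Pi k eta], which is zero; no adjoint of [k] in the crossed product
    is formed. *)
Lemma ker_mul_haarr k : (forall xi, Pi k xi = 0) -> cr 1 h ⋅ k = 0.
Proof.
move=> k0; rewrite [k]tens_sum (lin_sw _ _ (lin_cr_mulr _)).
under eq_sw => n a do rewrite -/(cr n a) haar_cr_mul //.
have cL : lin (fun x => cr 1 h ⋅ cr x 1).
  exact: (lin_comp (lin_cr_mulr (cr 1 h)) (proj1 (bil_cr T) 1)).
rewrite -(lin_sw _ _ cL) (_ : sweedler k _ = 0) ?(lin0 cL) //.
suff z0 : vn_star (sweedler k (fun n a => T (Si a) n)) = 0.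
  by rewrite -[LHS](star_invol (vn_starP M)) z0 (alin0 alin_vn_star).
apply: gket_inj; apply: inner_eqP => eta; rewrite inner0r.
rewrite /sweedler (alin_sum alin_vn_star) (lin_sum ketL) inner_sumr.
transitivity (inner (Pi k eta) (gns_vec G)); last by rewrite k0 inner_herm inner0r conjC0.
rewrite /gns_ext /sweedler inner_suml; apply: eq_bigr => p _.
rewrite (rep_star (gns_repP G)) (U_adj h_haar omega_state omega_inv U_bounded U_gket).
by rewrite -/(gket G _) U_gket act_star /lower_star antipiK.
Qed.

Lemma MhM_ker x k : MhM T h x -> (forall xi, Pi k xi = 0) -> x ⋅ k = 0 /\ k ⋅ x = 0.
Proof.
move=> [s ->] k0; rewrite (lin_sum (lin_cr_mull k)) (lin_sum (lin_cr_mulr k)).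
split; apply: big1 => p _; rewrite -/(MhM_gen T h _ _).
- rewrite /MhM_gen -!cr_mulA ker_mul_haarr ?(lin0 (lin_cr_mulr _)) // => xi.
  by rewrite gns_ext_mul k0 (lin0 (bounded_lin (gns_ext_bounded _))).
- by rewrite MhM_genE cr_mulA ker_mul_haarl // (lin0 (lin_cr_mull _)).
Qed.

End Isometry.

Theorem proposition4p1p2 (R : realType) (A : falgType R[i]) (W : weakCstarHopf A)
    (h : A) (hhat : 'Hom(A, R[i]^o))
    (M : vonNeumannAlgebra R) (T : moduleAlgebra W M)
    (omega : M -> R[i]) (G : gns omega) (gL : A)
    (h_haar : haar_integral (alg_ops W) h)
    (hhat_haar : haar_integral (dual_ops W) hhat)
    (omega_state : state omega)
    (omega_faithful : faithful_functional omega)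
    (omega_normal : normal_functional omega)
    (omega_invariant : invariant_functional T h omega)
    (gL_sqrt : positive_sqrt W gL (dual_actl W hhat h)) :
  let l0 := h * gL^-1 in
  [/\ A_L W gL, gL \is a GRing.unit, left_integral (alg_ops W) l0 &
  exists (V : G -> G ⊗ A) (Vs : G ⊗ A -> G),
    [/\
     (* (i) *)
     [/\ isometry_to_H_cros T hhat V,
         forall m, V (gket G m) = cket T G m l0,
         forall V', isometry_to_H_cros T hhat V' ->
           (forall m, V' (gket G m) = cket T G m l0) -> forall xi, V' xi = V xi &
         adjoint_on_H_cros T hhat V Vs] /\
     [/\ forall m a, Vs (cket T G m a) = gket G (m * T (a * gL) 1),
         forall m a, V (Vs (cket T G m a)) = cket T G m (a * gL * l0) &
         forall m xi, gns_rep G m xi = Vs (Lambda T (cr T m 1) (V xi))],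
     (* (ii) *)
     [/\ forall x xi, exists eta, Lambda T x (V xi) = V eta,
         star_representation (cr_mul T) (cr_one T) (cr_star T)
           (pi_ext T V Vs),
         forall m xi, pi_ext T V Vs (cr T m 1) xi = gns_rep G m xi &
         forall m a m', pi_ext T V Vs (cr T m a) (gket G m') = gket G (m * T a m')] &
     (* (iii) *)
     two_sided_ideal (MhM T h) /\
     forall x k, MhM T h x -> in_ker_pi_ext T V Vs k ->
       cr_mul T x k = 0 /\ cr_mul T k x = 0]].
Proof.
move=> l0; have H_haar := haar_integral_dualE hhat_haar.
have [gL_pos gL_sq] := gL_sqrt.
have [U [U_bounded U_gket]] := action_exists h_haar omega_state omega_invariant G.
pose V := cross_isometry W h gL U.
pose Vs := cross_coisometry W h hhat gL U.
have H_star := haar_functional_star H_haar.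
have H_pos := haar_positive h_haar H_haar gL_pos gL_sq.
have H_def := haar_faithful h_haar H_haar gL_pos gL_sq.
have VL : lin V by exact: lin_cross_isometry.
have V_gket m : V (gket G m) = cket T G m l0 by exact: cross_isometry_gket.
have VV xi eta : tinner W hhat (V xi) (V eta) = inner xi eta.
  exact: (cross_isometryP h_haar H_haar gL_pos gL_sq omega_state omega_invariant).
have extE : pi_ext T V Vs = gns_ext U.
  by apply: funext => x; apply: funext => xi; exact: (pi_extE h_haar H_haar gL_pos gL_sq).
have ext_cr m a xi : pi_ext T V Vs (cr T m a) xi = gns_rep G m (U a xi).
  by rewrite extE gns_ext_cr.
have pi_cr m xi : pi_ext T V Vs (cr T m 1) xi = gns_rep G m xi.
  by rewrite ext_cr (U_1 U_bounded U_gket).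
have ext_rep : star_representation (cr_mul T) (cr_one T) (cr_star T)
    (@gns_ext _ _ _ _ T _ G U).
  exact: (gns_ext_star_representation h_haar omega_state omega_invariant).
have ranV x xi : Lambda T x (V xi) = V (gns_ext U x xi).
  exact: Lambda_isometry.
split; [exact: (A_L_gL H_haar gL_pos gL_sq) | exact: (gL_unit h_haar H_haar gL_sq) |
  exact: left_integral_l0 |].
exists V, Vs; split.
- split; split=> //.
  (* [Lambda] of the unit fixes the range of [V], by intertwining, so [V xi] is its own preimage. *)
  + split=> // xi; exists (V xi).
    by rewrite ranV (rep_one ext_rep).
  + move=> V' [V'L _ V'V'] V'_gket.
    apply: (isometry_dense_unique H_star H_pos H_def (@gket_dense _ _ _ G)) => //.
    by move=> m; rewrite V'_gket V_gket.
  + move=> t _ xi.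
    exact: (cross_coisometry_adjoint gL h_haar H_haar omega_state omega_invariant U_bounded U_gket t xi).
  + exact: (cross_coisometry_cket h_haar H_haar gL_pos gL_sq).
  + exact: (cross_isometry_cket h_haar H_haar gL_pos gL_sq).
  + by move=> m xi; rewrite -[RHS]/(pi_ext T V Vs (cr T m 1) xi) pi_cr.
- split=> //.
  + by move=> x xi; exists (gns_ext U x xi).
  + by rewrite extE.
  + by move=> m a m'; rewrite ext_cr U_gket gns_rep_gket.
- split; first exact: MhM_ideal.
  move=> x k xM k0; apply: (MhM_ker h_haar omega_state omega_invariant U_bounded U_gket) => //.
  by move=> xi; rewrite -extE.
Qed.
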